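(* Let $G$ be a homologically balanced nilpotent group which is not isomorphic to $\mathbb{Z}^3$. If $G$ has an abelian normal subgroup $A$ such that $G/A\cong\mathbb{Z}^2$, then $G\cong\mathbb{Z}^2$, or $G\cong\Gamma_q$ for some $q\geq 1$, or $G\cong\Omega$.
   Context: For a group $G$ and field $F$ (with trivial $G$-action), $\beta_i(G;F)=\dim_F H_i(G;F)$. A group $G$ is homologically balanced if it is finitely generated and $\beta_2(G;F)\leq\beta_1(G;F)$ for all fields $F$. For $q\geq1$, $\Gamma_q$ is the group with presentation $\langle x,y,z\mid [x,y]=z^q,\ xz=zx,\ yz=zy\rangle$. $\Omega$ is the group with presentation $\langle t,u\mid [t,[t,[t,u]]]=[u,[t,u]]=1\rangle$. Here $[a,b]$ denotes the commutator of $a$ and $b$. *)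

(* Defs.v *)
From HB Require Import structures.
From mathcomp Require Import all_boot all_order all_algebra generic_quotient.
From mathcomp Require Import finmap monalg.
From mathcomp Require Import boolp classical_sets.

Set Implicit Arguments.
Unset Strict Implicit.
Unset Printing Implicit Defensive.

Import GRing.Theory.

Local Open Scope quotient_scope.
Local Open Scope classical_set_scope.

Section Groups.
Local Open Scope group_scope.

Definition isomorphic (G H : groupType) : Prop :=
  exists f : {multiplicative G -> H}, bijective f.

Inductive generated (G : groupType) (S : set G) : set G :=
| generated_incl x : S x -> generated S x
| generated_1 : generated S 1
| generated_M x y : generated S x -> generated S y -> generated S (x * y)
| generated_V x : generated S x -> generated S x^-1.

Definition finitely_generated (G : groupType) : Prop :=
  exists s : seq G, forall x : G, generated [set` s] x.

(* lower_central n is the (n+1)-st term of the lower central series. *)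
Fixpoint lower_central (G : groupType) (n : nat) : set G :=
  if n is m.+1 then
    generated [set g | exists x y, lower_central m y /\ g = [~ x, y]]
  else setT.

Definition nilpotent_group (G : groupType) : Prop :=
  exists n, @lower_central G n `<=` [set 1].

Record normal_subgroup (G : groupType) := NormalSubgroup {
  ns_set :> set G;
  ns_1 : ns_set 1;
  ns_M : forall x y, ns_set x -> ns_set y -> ns_set (x * y);
  ns_V : forall x, ns_set x -> ns_set x^-1;
  ns_J : forall x y, ns_set x -> ns_set (x ^ y)
}.

Definition abelian_set (G : groupType) (A : set G) : Prop :=
  forall x y, A x -> A y -> commute x y.

Section Quotient.
Variables (G : groupType) (N : normal_subgroup G).

Definition coset_rel (x y : G) : bool := `[< ns_set N (x^-1 * y) >].

Lemma coset_rel_refl : reflexive coset_rel.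
Proof. by move=> x; apply/asboolP; rewrite mulVg; exact: ns_1. Qed.

Lemma coset_rel_sym : symmetric coset_rel.
Proof.
suff H x y : coset_rel x y -> coset_rel y x by move=> x y; apply/idP/idP; apply: H.
by move=> /asboolP/ns_V; rewrite invgM invgK => h; apply/asboolP.
Qed.

Lemma coset_rel_trans : transitive coset_rel.
Proof.
move=> y x z /asboolP h1 /asboolP h2; apply/asboolP.
by have := ns_M h1 h2; rewrite -mulgA mulVKg.
Qed.

Canonical coset_equiv :=
  EquivRel coset_rel coset_rel_refl coset_rel_sym coset_rel_trans.

Definition quotient_group := {eq_quot coset_equiv}.
HB.instance Definition _ := Choice.on quotient_group.
HB.instance Definition _ := EqQuotient.on quotient_group.

Let Q := quotient_group.
Definition quotient_mul (a b : Q) : Q := \pi_Q (repr a * repr b).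
Definition quotient_one : Q := \pi_Q 1.
Definition quotient_inv (a : Q) : Q := \pi_Q (repr a)^-1.

Lemma quotient_eqP (x y : G) : reflect (ns_set N (x^-1 * y)) (\pi_Q x == \pi_Q y).
Proof. by rewrite eqmodE; apply: asboolP. Qed.

Lemma quotient_repr (x : G) : ns_set N (x^-1 * repr (\pi_Q x)).
Proof. by apply/quotient_eqP; rewrite reprK. Qed.

Lemma quotient_mulE (x y : G) : \pi_Q (x * y) = quotient_mul (\pi_Q x) (\pi_Q y).
Proof.
apply/eqP/quotient_eqP; rewrite invgM.
have h1 := ns_J y (quotient_repr x); have h2 := quotient_repr y.
by have := ns_M h1 h2; rewrite /conjg !mulgA mulgK.
Qed.

Lemma quotient_invE (x : G) : \pi_Q x^-1 = quotient_inv (\pi_Q x).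
Proof.
apply/eqP/quotient_eqP; rewrite invgK.
have := ns_J x^-1 (ns_V (quotient_repr x)).
by rewrite /conjg invgM !invgK !mulgA mulgK.
Qed.

Fact quotient_mulA : associative quotient_mul.
Proof.
move=> a b c; elim/quotW: a => x; elim/quotW: b => y; elim/quotW: c => z.
by rewrite -(quotient_mulE y z) -(quotient_mulE x y) -!quotient_mulE mulgA.
Qed.

Fact quotient_mul1 : left_id quotient_one quotient_mul.
Proof. by move=> a; elim/quotW: a => x; rewrite -quotient_mulE mul1g. Qed.

Fact quotient_mulr1 : right_id quotient_one quotient_mul.
Proof. by move=> a; elim/quotW: a => x; rewrite -quotient_mulE mulg1. Qed.

Fact quotient_mulV : left_inverse quotient_one quotient_inv quotient_mul.
Proof. by move=> a; elim/quotW: a => x; rewrite -quotient_invE -quotient_mulE mulVg. Qed.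

Fact quotient_mulrV : right_inverse quotient_one quotient_inv quotient_mul.
Proof. by move=> a; elim/quotW: a => x; rewrite -quotient_invE -quotient_mulE mulgV. Qed.

HB.instance Definition _ := isGroup.Build quotient_group
  quotient_mulA quotient_mul1 quotient_mulr1 quotient_mulV quotient_mulrV.

End Quotient.

Section NormalClosure.
Variables (G : groupType) (S : set G).

Definition normal_closure_set : set G :=
  generated [set g | exists x y, S x /\ g = x ^ y].

Lemma normal_closure_J x y : normal_closure_set x -> normal_closure_set (x ^ y).
Proof.
elim=> [g [a [b [Sa ->]]]||a b _ ha _ hb|a _ ha].
- by rewrite -conjgM; apply: generated_incl; exists a, (b * y).
- by rewrite conj1g; exact: generated_1.
- by rewrite conjMg; exact: generated_M.
- by rewrite conjVg; exact: generated_V.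
Qed.

Definition normal_closure : normal_subgroup G :=
  @NormalSubgroup G normal_closure_set (@generated_1 _ _) (@generated_M _ _)
    (@generated_V _ _) normal_closure_J.

End NormalClosure.

(* The free group on X: words in letters (x, b), with (x, true) standing for x
   and (x, false) for its inverse, modulo cancellation of adjacent inverse
   letters. *)
Section FreeGroup.
Variable X : choiceType.
Definition letterV (a : X * bool) : X * bool := (a.1, ~~ a.2).

Inductive word_equiv : seq (X * bool) -> seq (X * bool) -> Prop :=
| word_equiv_cancel u v a :
    word_equiv (u ++ [:: a, letterV a & v]) (u ++ v)
| word_equiv_refl u : word_equiv u u
| word_equiv_sym u v : word_equiv u v -> word_equiv v u
| word_equiv_trans u v w : word_equiv u v -> word_equiv v w -> word_equiv u w.

Definition word_rel (u v : seq (X * bool)) : bool := `[< word_equiv u v >].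

Lemma word_rel_refl : reflexive word_rel.
Proof. by move=> u; apply/asboolP; exact: word_equiv_refl. Qed.

Lemma word_rel_sym : symmetric word_rel.
Proof.
by move=> u v; apply/asboolP/asboolP; exact: word_equiv_sym.
Qed.

Lemma word_rel_trans : transitive word_rel.
Proof.
move=> v u w /asboolP h1 /asboolP h2; apply/asboolP.
exact: word_equiv_trans h1 h2.
Qed.

Canonical word_equivrel :=
  EquivRel word_rel word_rel_refl word_rel_sym word_rel_trans.

Definition free_group := {eq_quot word_equivrel}.
HB.instance Definition _ := Choice.on free_group.
HB.instance Definition _ := EqQuotient.on free_group.

Let Q := free_group.
Definition wordV (u : seq (X * bool)) := rev (map letterV u).
Definition free_mul (a b : Q) : Q := \pi_Q (repr a ++ repr b).
Definition free_one : Q := \pi_Q [::].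
Definition free_inv (a : Q) : Q := \pi_Q (wordV (repr a)).
Definition free_gen (x : X) : Q := \pi_Q [:: (x, true)].

Lemma free_eqP u v : reflect (word_equiv u v) (\pi_Q u == \pi_Q v).
Proof. by rewrite eqmodE; apply: asboolP. Qed.

Lemma letterVK : involutive letterV.
Proof. by case=> x b; rewrite /letterV /= negbK. Qed.

Lemma word_equiv_catl w u v : word_equiv u v -> word_equiv (w ++ u) (w ++ v).
Proof.
elim=> {u v} [u v a|u|u v _ h|u v t _ h1 _ h2].
- by rewrite !catA; exact: word_equiv_cancel.
- exact: word_equiv_refl.
- exact: word_equiv_sym.
- exact: word_equiv_trans h1 h2.
Qed.

Lemma word_equiv_catr w u v : word_equiv u v -> word_equiv (u ++ w) (v ++ w).
Proof.
elim=> {u v} [u v a|u|u v _ h|u v t _ h1 _ h2].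
- by rewrite -!catA; exact: word_equiv_cancel.
- exact: word_equiv_refl.
- exact: word_equiv_sym.
- exact: word_equiv_trans h1 h2.
Qed.

Lemma word_equiv_V u v : word_equiv u v -> word_equiv (wordV u) (wordV v).
Proof.
elim=> {u v} [u v a|u|u v _ h|u v t _ h1 _ h2].
- rewrite /wordV !map_cat !rev_cat /= !rev_cons -!cats1 -!catA letterVK /=.
  by apply: word_equiv_cancel.
- exact: word_equiv_refl.
- exact: word_equiv_sym.
- exact: word_equiv_trans h1 h2.
Qed.

Lemma word_equiv_mulV u : word_equiv (u ++ wordV u) [::].
Proof.
elim: u => [|a u ih]; first exact: word_equiv_refl.
rewrite /wordV /= rev_cons -cats1 catA -/(wordV u).
apply: word_equiv_trans (word_equiv_cancel [::] [::] a).
exact: (word_equiv_catl [:: a] (word_equiv_catr [:: letterV a] ih)).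
Qed.

Lemma wordVK : involutive wordV.
Proof. by move=> u; rewrite /wordV map_rev revK mapK //; exact: letterVK. Qed.

Lemma word_equiv_repr u : word_equiv u (repr (\pi_Q u)).
Proof. by apply/free_eqP; rewrite reprK. Qed.

Lemma free_mulE u v : \pi_Q (u ++ v) = free_mul (\pi_Q u) (\pi_Q v).
Proof.
apply/eqP/free_eqP; apply: word_equiv_trans.
  exact/word_equiv_catr/word_equiv_repr.
exact/word_equiv_catl/word_equiv_repr.
Qed.

Lemma free_invE u : \pi_Q (wordV u) = free_inv (\pi_Q u).
Proof. by apply/eqP/free_eqP/word_equiv_V/word_equiv_repr. Qed.

Fact free_mulA : associative free_mul.
Proof.
move=> a b c; elim/quotW: a => x; elim/quotW: b => y; elim/quotW: c => z.
by rewrite -(free_mulE y z) -(free_mulE x y) -!free_mulE catA.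
Qed.

Fact free_mul1 : left_id free_one free_mul.
Proof. by move=> a; elim/quotW: a => x; rewrite -free_mulE. Qed.

Fact free_mulr1 : right_id free_one free_mul.
Proof. by move=> a; elim/quotW: a => x; rewrite -free_mulE cats0. Qed.

Fact free_mulrV : right_inverse free_one free_inv free_mul.
Proof.
move=> a; elim/quotW: a => x; rewrite -free_invE -free_mulE.
by apply/eqP/free_eqP/word_equiv_mulV.
Qed.

Fact free_mulV : left_inverse free_one free_inv free_mul.
Proof.
move=> a; elim/quotW: a => x; rewrite -free_invE -free_mulE -{2}(wordVK x).
by apply/eqP/free_eqP/word_equiv_mulV.
Qed.

HB.instance Definition _ := isGroup.Build free_group
  free_mulA free_mul1 free_mulr1 free_mulV free_mulrV.

End FreeGroup.

Definition presented_group (X : choiceType) (relators : seq (free_group X)) :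
  groupType := quotient_group (normal_closure [set` relators]).

Definition free_abelian (n : nat) : groupType := Algebra.to_multiplicative 'rV[int]_n.

(* A relation r = s of a presentation is encoded by the relator r / s. The
   library commutator is [~ x, y] = x^-1 * y^-1 * x * y; the presentations of
   Gamma q and Omega read with the other convention x * y * x^-1 * y^-1 define
   isomorphic groups (invert the generators x, y, resp. t, u). *)
Definition Gamma (q : nat) : groupType :=
  let x : free_group 'I_3 := free_gen (inord 0) in
  let y : free_group 'I_3 := free_gen (inord 1) in
  let z : free_group 'I_3 := free_gen (inord 2) in
  presented_group [:: [~ x, y] / z ^+ q; (x * z) / (z * x); (y * z) / (z * y)].

Definition Omega : groupType :=
  let t : free_group 'I_2 := free_gen (inord 0) in
  let u : free_group 'I_2 := free_gen (inord 1) in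
  presented_group [:: [~ t, [~ t, [~ t, u]]]; [~ u, [~ t, u]]].

End Groups.

Local Open Scope ring_scope.

Section QuotientModule.
Variables (R : nzRingType) (V : lmodType R).

Record submodule := Submodule {
  sm_set :> set V;
  sm_0 : sm_set 0;
  sm_D : forall u v, sm_set u -> sm_set v -> sm_set (u + v);
  sm_Z : forall a u, sm_set u -> sm_set (a *: u)
}.

Variable W : submodule.

Lemma sm_N u : sm_set W u -> sm_set W (- u).
Proof. by move=> h; rewrite -scaleN1r; exact: sm_Z. Qed.

Definition mod_rel (u v : V) : bool := `[< sm_set W (u - v) >].

Lemma mod_rel_refl : reflexive mod_rel.
Proof. by move=> u; apply/asboolP; rewrite subrr; exact: sm_0. Qed.

Lemma mod_rel_sym : symmetric mod_rel.
Proof.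
by move=> u v; apply/asboolP/asboolP => /sm_N; rewrite opprB.
Qed.

Lemma mod_rel_trans : transitive mod_rel.
Proof.
move=> v u w /asboolP h1 /asboolP h2; apply/asboolP.
by have := sm_D h1 h2; rewrite addrA subrK.
Qed.

Canonical mod_equiv := EquivRel mod_rel mod_rel_refl mod_rel_sym mod_rel_trans.

Definition quotient_module := {eq_quot mod_equiv}.
HB.instance Definition _ := Choice.on quotient_module.
HB.instance Definition _ := EqQuotient.on quotient_module.

Let Q := quotient_module.
Definition qmod_add (a b : Q) : Q := \pi_Q (repr a + repr b).
Definition qmod_zero : Q := \pi_Q 0.
Definition qmod_opp (a : Q) : Q := \pi_Q (- repr a).
Definition qmod_scale (c : R) (a : Q) : Q := \pi_Q (c *: repr a).

Lemma qmod_eqP u v : reflect (sm_set W (u - v)) (\pi_Q u == \pi_Q v).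
Proof. by rewrite eqmodE; apply: asboolP. Qed.

Lemma qmod_repr u : sm_set W (u - repr (\pi_Q u)).
Proof. by apply/qmod_eqP; rewrite reprK. Qed.

Lemma qmod_addE u v : \pi_Q (u + v) = qmod_add (\pi_Q u) (\pi_Q v).
Proof.
apply/eqP/qmod_eqP; rewrite opprD addrACA.
by apply: sm_D; exact: qmod_repr.
Qed.

Lemma qmod_oppE u : \pi_Q (- u) = qmod_opp (\pi_Q u).
Proof. by apply/eqP/qmod_eqP; rewrite -opprD; apply/sm_N/qmod_repr. Qed.

Lemma qmod_scaleE c u : \pi_Q (c *: u) = qmod_scale c (\pi_Q u).
Proof. by apply/eqP/qmod_eqP; rewrite -scalerBr; apply/sm_Z/qmod_repr. Qed.

Fact qmod_addA : associative qmod_add.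
Proof.
move=> a b c; elim/quotW: a => x; elim/quotW: b => y; elim/quotW: c => z.
by rewrite -(qmod_addE y z) -(qmod_addE x y) -!qmod_addE addrA.
Qed.

Fact qmod_addC : commutative qmod_add.
Proof. by move=> a b; elim/quotW: a => x; elim/quotW: b => y; rewrite -!qmod_addE addrC. Qed.

Fact qmod_add0 : left_id qmod_zero qmod_add.
Proof. by move=> a; elim/quotW: a => x; rewrite -qmod_addE add0r. Qed.

Fact qmod_addN : left_inverse qmod_zero qmod_opp qmod_add.
Proof. by move=> a; elim/quotW: a => x; rewrite -qmod_oppE -qmod_addE addNr. Qed.

HB.instance Definition _ := GRing.isZmodule.Build quotient_module
  qmod_addA qmod_addC qmod_add0 qmod_addN.

Fact qmod_scaleA a b v : qmod_scale a (qmod_scale b v) = qmod_scale (a * b) v.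
Proof. by elim/quotW: v => x; rewrite -(qmod_scaleE b) -!qmod_scaleE scalerA. Qed.

Fact qmod_scale1 : left_id 1 qmod_scale.
Proof. by move=> a; elim/quotW: a => v; rewrite -qmod_scaleE scale1r. Qed.

Fact qmod_scaleDr : right_distributive qmod_scale +%R.
Proof.
move=> a b c; elim/quotW: b => u; elim/quotW: c => v.
rewrite -(qmod_scaleE a u) -(qmod_scaleE a v).
rewrite -[LHS]/(qmod_scale a (qmod_add (\pi_Q u) (\pi_Q v))).
by rewrite -qmod_addE -qmod_scaleE scalerDr; exact: qmod_addE.
Qed.

Fact qmod_scaleDl v : {morph qmod_scale^~ v : a b / a + b}.
Proof.
elim/quotW: v => v a b.
by rewrite -!qmod_scaleE scalerDl; exact: qmod_addE.
Qed.

HB.instance Definition _ := GRing.Zmodule_isLmodule.Build R quotient_module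
  qmod_scaleA qmod_scale1 qmod_scaleDr qmod_scaleDl.

End QuotientModule.

(* Group homology with trivial coefficients, computed by the (inhomogeneous)
   bar complex: chains of degree n are the formal F-linear combinations of
   n-tuples [g_1|...|g_n]. *)
Section Homology.
Variables (G : groupType) (F : fieldType).

Definition chain (n : nat) := {malg F[n.-tuple G]}.
HB.instance Definition _ n := GRing.Lmodule.on (chain n).

(* For 0 < i < n+1, the i-th face multiplies g_i and g_(i+1); the 0-th face
   drops g_1 and the (n+1)-st one drops g_(n+1). *)
Definition face (n : nat) (i : 'I_n.+2) (g : n.+1.-tuple G) : n.-tuple G :=
  [tuple (if (j.+1 < i)%N then tnth g (widen_ord (leqnSn n) j)
          else if j.+1 == i :> nat
          then (tnth g (widen_ord (leqnSn n) j) * tnth g (lift ord0 j))%g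
          else tnth g (lift ord0 j)) | j < n].

Definition boundary_gen (n : nat) (g : n.+1.-tuple G) : chain n :=
  \sum_(i < n.+2) (-1) ^+ i *: (<< face i g >> : chain n).

Definition boundary (n : nat) (c : chain n.+1) : chain n :=
  \sum_(g <- msupp c) c@_g *: boundary_gen g.

Lemma boundaryEw n (d : {fset n.+1.-tuple G}) (c : chain n.+1) :
  (msupp c `<=` d)%fset -> boundary c = \sum_(g <- d) c@_g *: boundary_gen g.
Proof.
move=> le; rewrite /boundary (big_fset_incl _ le) // => g _ /mcoeff_outdom ->.
by rewrite scale0r.
Qed.

Fact boundary_is_linear n : linear (@boundary n).
Proof.
move=> a u v; pose d := (msupp (a *: u + v) `|` (msupp u `|` msupp v))%fset.
rewrite (@boundaryEw _ d) ?fsubsetUl //.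
rewrite (@boundaryEw _ d u); last by rewrite /d fsetUCA fsubsetUl.
rewrite (@boundaryEw _ d v); last by rewrite /d fsetUA fsubsetUr.
rewrite scaler_sumr -big_split /=; apply: eq_bigr => g _.
by rewrite mcoeffD mcoeffZ scalerDl scalerA.
Qed.

HB.instance Definition _ n :=
  GRing.isLinear.Build F (chain n.+1) (chain n) _ (@boundary n)
    (@boundary_is_linear n).

Definition cycle_pred (n : nat) : {pred chain n} :=
  if n is m.+1 return {pred chain n}
  then [pred c | boundary c == 0] else predT.

Fact cycle_submod_closed n : submod_closed (@cycle_pred n).
Proof.
case: n => [|n]; split=> //; first by rewrite inE linear0.
by move=> a u v; rewrite !inE => /eqP hu /eqP hv;
rewrite boundary_is_linear hu hv scaler0 addr0.
Qed.

HB.instance Definition _ n := GRing.isSubmodClosed.Build F (chain n)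
  (@cycle_pred n) (@cycle_submod_closed n).

Definition cycles (n : nat) := {c : chain n | c \in @cycle_pred n}.
HB.instance Definition _ n := SubChoice.on (cycles n).
HB.instance Definition _ n := [SubChoice_isSubLmodule of cycles n by <:].

Definition boundary_set (n : nat) : set (cycles n) :=
  [set z | exists b : chain n.+1, boundary b = val z].

Fact boundary_set0 n : @boundary_set n 0.
Proof. by exists 0; rewrite linear0 raddf0. Qed.

Fact boundary_setD n u v :
  @boundary_set n u -> @boundary_set n v -> @boundary_set n (u + v).
Proof.
by move=> [b hb] [c hc]; exists (b + c); rewrite raddfD /= -hb -hc.
Qed.

Fact boundary_setZ n a u : @boundary_set n u -> @boundary_set n (a *: u).
Proof.
by move=> [b hb]; exists (a *: b); rewrite linearZ_LR /= -hb.
Qed.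

Definition boundaries n : submodule (cycles n) :=
  @Submodule F (cycles n) (@boundary_set n)
    (@boundary_set0 n) (@boundary_setD n) (@boundary_setZ n).

Definition homology (n : nat) : lmodType F := quotient_module (boundaries n).

End Homology.

Definition has_dim (F : fieldType) (V : lmodType F) (n : nat) : Prop :=
  exists f : {linear 'rV[F]_n -> V}, bijective f.

(* beta_i(G; F) = b; no b satisfies this if H_i(G; F) is infinite-dimensional. *)
Definition betti (G : groupType) (F : fieldType) (i b : nat) : Prop :=
  has_dim (homology G F i) b.

(* As G is finitely generated, beta_1(G; F) is finite for every F, so that the
   inequality beta_2 <= beta_1 forces beta_2(G; F) to be finite as well. *)
Definition homologically_balanced (G : groupType) : Prop :=
  finitely_generated G /\
  forall F : fieldType, exists b1 b2 : nat,
    [/\ betti G F 1 b1, betti G F 2 b2 & (b2 <= b1)%N].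

(* Main.v *)
From HB Require Import structures.
Require Import Defs.
From mathcomp Require Import all_boot all_order all_algebra generic_quotient.
From mathcomp Require Import finmap monalg.
From mathcomp Require Import ring zify.
From mathcomp Require Import boolp classical_sets.

(** Lift a basis of the quotient [Z^2] to elements [s] and [t] of the group [G],
    let [A] be the abelian kernel and [c] the commutator of [t] and [s]. The
    homomorphisms from [A] to the field with [p] elements form a space [V] on
    which [s] and [t] act unipotently, because [G] is nilpotent. Betti numbers
    enter through a single consequence of balance: if [K] is normal in [G] with
    infinite cyclic quotient, restriction of two-dimensional classes from [G] to
    [K] has rank at most one ([restriction_rank_le1]). Indeed homomorphisms on
    [K], taken modulo the image of [t - 1], provide at least [b1 - 1]
    independent classes that vanish on [K], and all classes together form a
    space of dimension at most [b1].

    Take for [K] the subgroup generated by [A] and [s]. If [V] is nonzero, there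
    are classes of [G] that vanish on [A] but not on [K]. They use up the one
    dimension, so every class of [G] vanishes on [A]
    ([cocycle_trivial_on_fker]). On the other hand a class on [A] extends to [G]
    once an explicit obstruction vanishes ([extend_two_steps]). So this
    obstruction cannot vanish for a nontrivial class on [A], and two kinds of
    classes determine [A].

    For an invariant [phi] and a second homomorphism [psi], the class with
    alternation [phi /\ psi] would extend ([pair_obstruction]) unless its
    obstruction, a combination of [phi] and [psi] with coefficients formed from
    [phi c] and [psi c], is outside the image of the augmentation ideal. This leaves two
    possibilities for [V]: it is at most a line, or it is a plane on which the
    action is nontrivial, with fixed line spanned by a [phi] that does not
    vanish on [c] ([homs_mod_p]). In both cases [A] modulo [p] is a cyclic
    module under one operator. If [A] had [p]-torsion, a presentation of [A]
    modulo a power of [p] over the polynomial ring in this operator would give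
    an extension of [A] by the prime field that extends to [G], although an
    element of order [p] acquires order [p ^ 2] in it ([torsion_extension],
    [no_torsion]).

    So [A], which is finitely generated ([kernel_fg]), is free abelian, and its
    rank is at most two ([coords_le2]). In rank zero [G] is [Z^2]. In rank one
    [A] is central, so that [G] is determined by [c], a multiple of a generator
    of [A]: it is [Z^3] or some [Gamma q]. In rank two the second possibility
    holds modulo every prime, so [A] is generated by [c] and its images under
    [s - 1] and [t - 1]; these two images are proportional, and in a suitable
    basis of the quotient [s] acts trivially ([omega_frame]). The group is then
    given by the presentation of [Omega] ([iso_omega]). *)

Set Implicit Arguments.
Unset Strict Implicit.
Unset Printing Implicit Defensive.

Import Order.TTheory GRing.Theory Num.Theory.

Local Open Scope quotient_scope.
Local Open Scope classical_set_scope.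
Local Open Scope group_scope.

(** * Integer powers and conjugation in a group *)

Ltac gsimp := do ?[progress rewrite ?(invgM, invgK, invg1) -?mulgA
  ?(mulKg, mulVKg, mulgV, mulVg, mulg1, mul1g)].

Lemma int_ind_pm (P : int -> Prop) :
  P 0%R -> (forall i, P i -> P (i + 1)%R) -> (forall i, P i -> P (i - 1)%R) ->
  forall i, P i.
Proof.
move=> P0 Pp Pm; elim/int_rect=> // n Pn.
  by rewrite -addn1 PoszD; exact: Pp.
by rewrite -addn1 PoszD opprD; exact: Pm.
Qed.

Section Zpow.
Variable G : groupType.
Implicit Types (x y g h a : G) (i j : int).

Definition zpow x i : G := if i is Negz n then x ^- n.+1 else x ^+ `|i|%N.

Lemma zpow0 x : zpow x 0 = 1. Proof. by []. Qed.
Lemma zpow1 x : zpow x 1 = x. Proof. by []. Qed.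
Lemma zpow_nat x n : zpow x (Posz n) = x ^+ n. Proof. by []. Qed.

Lemma zpowS x i : zpow x (i + 1)%R = zpow x i * x.
Proof.
case: i => [n|[|n]]; first by rewrite -PoszD addn1 /= expgSr.
  by rewrite /= expg1 mulVg.
have -> : (Negz n.+1 + 1)%R = Negz n by rewrite !NegzE -addn1 PoszD opprD addrK.
by rewrite /= [in RHS]expgS invgM mulgVK.
Qed.

Lemma zpowB x i : zpow x (i - 1)%R = zpow x i * x^-1.
Proof. by rewrite -{2}(subrK 1%R i) zpowS mulgK. Qed.

Lemma zpowD x i j : zpow x (i + j)%R = zpow x i * zpow x j.
Proof.
elim/int_ind_pm: j => [|j IH|j IH]; first by rewrite addr0 mulg1.
  by rewrite addrA !zpowS IH mulgA.
by rewrite addrA !zpowB IH mulgA.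
Qed.

Lemma zpowN x i : zpow x (- i)%R = (zpow x i)^-1.
Proof. by apply: (mulIg (zpow x i)); rewrite -zpowD addNr mulVg. Qed.

Lemma zpow1g i : zpow (1 : G) i = 1.
Proof.
by elim/int_ind_pm: i => [|i IH|i IH] //; rewrite ?zpowS ?zpowB IH ?invg1 mulg1.
Qed.

Lemma zpowM x i j : zpow x (i * j)%R = zpow (zpow x i) j.
Proof.
elim/int_ind_pm: j => [|j IH|j IH]; first by rewrite mulr0.
  by rewrite zpowS -IH mulrDr mulr1 zpowD.
by rewrite zpowB -IH mulrDr mulrN1 zpowD zpowN.
Qed.

Lemma commute_zpow x y i : commute x y -> commute x (zpow y i).
Proof.
move=> cxy; elim/int_ind_pm: i => [|i IH|i IH]; first exact: commute1.
  by rewrite zpowS; exact: commuteM.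
by rewrite zpowB; apply: commuteM => //; exact: commuteV.
Qed.

Lemma zpowMg x y i : commute x y -> zpow (x * y) i = zpow x i * zpow y i.
Proof.
move=> cxy; elim/int_ind_pm: i => [|i IH|i IH]; first by rewrite mulg1.
  rewrite !zpowS IH -!mulgA; congr (_ * _); rewrite !mulgA; congr (_ * _).
  exact/esym/commute_zpow.
rewrite !zpowB IH -!mulgA; congr (_ * _); rewrite cxy invgM !mulgA.
by congr (_ * _); apply/esym/commute_zpow/commute_sym/commuteV.
Qed.

(** Left conjugation; the subgroups below act from the left, so that words
    such as [s ^ i * t ^ j] act in the order in which they are written. *)
Definition cj g a : G := g * a * g^-1.

Lemma cjM g a b : cj g (a * b) = cj g a * cj g b.
Proof. by rewrite /cj; gsimp. Qed.
Lemma cj1 g : cj g 1 = 1. Proof. by rewrite /cj; gsimp. Qed.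
Lemma cj1g a : cj 1 a = a. Proof. by rewrite /cj; gsimp. Qed.
Lemma cjV g a : cj g a^-1 = (cj g a)^-1. Proof. by rewrite /cj; gsimp. Qed.
Lemma cj_cj g h a : cj g (cj h a) = cj (g * h) a. Proof. by rewrite /cj; gsimp. Qed.
Lemma cjK g a : cj g^-1 (cj g a) = a. Proof. by rewrite cj_cj mulVg cj1g. Qed.
Lemma cjVK g a : cj g (cj g^-1 a) = a. Proof. by rewrite cj_cj mulgV cj1g. Qed.
Lemma cj_comm g a : cj g a * g = g * a. Proof. by rewrite /cj; gsimp. Qed.
Lemma cj_id g a : commute g a -> cj g a = a.
Proof. by move=> c; rewrite /cj c mulgK. Qed.
Lemma cj_idP g a : cj g a = a -> commute g a.
Proof. by move=> e; rewrite /commute -cj_comm e. Qed.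
Lemma cj_zpow g a i : cj g (zpow a i) = zpow (cj g a) i.
Proof.
by elim/int_ind_pm: i => [|i IH|i IH]; rewrite ?cj1 // ?zpowS ?zpowB cjM IH ?cjV.
Qed.
Lemma cj_inj g : injective (cj g). Proof. exact: can_inj (cjK g). Qed.

Definition int_char (d : G -> int) := forall g h, d (g * h) = (d g + d h)%R.

Lemma int_char1 d : int_char d -> d 1 = 0%R.
Proof. by move=> D; apply: (addrI (d 1)); rewrite -D mulg1 addr0. Qed.
Lemma int_charV d g : int_char d -> d g^-1 = (- d g)%R.
Proof. by move=> D; apply: (addrI (d g)); rewrite -D mulgV int_char1 // addrN. Qed.
Lemma int_char_cj d g a : int_char d -> d (cj g a) = d a.
Proof. by move=> D; rewrite /cj !D int_charV // addrAC addrN add0r. Qed.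
Lemma int_char_zpow d g i : int_char d -> d (zpow g i) = (i * d g)%R.
Proof.
move=> D; elim/int_ind_pm: i => [|i IH|i IH]; first by rewrite mul0r int_char1.
  by rewrite zpowS D IH mulrDl mul1r.
by rewrite zpowB D int_charV // IH mulrDl mulN1r.
Qed.

Record is_subgroup (H : set G) : Prop := IsSubgroup {
  sub1 : H 1;
  subM : forall x y, H x -> H y -> H (x * y);
  subV : forall x, H x -> H x^-1
}.

Lemma sub_zpow H x i : is_subgroup H -> H x -> H (zpow x i).
Proof.
case=> H1 HM HV Hx; elim/int_ind_pm: i => [|i IH|i IH] //.
  by rewrite zpowS; exact: HM.
by rewrite zpowB; apply: HM => //; exact: HV.
Qed.

Lemma sub_cj H g a : is_subgroup H -> H g -> H a -> H (cj g a).
Proof. by case=> _ HM HV Hg Ha; apply/HM/HV => //; exact: HM. Qed.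

End Zpow.

Local Open Scope ring_scope.

(** * Two-cocycles on a group split over the integers *)

(** Identities between values of cochains follow by adding and subtracting
    instances of the cocycle equation: the hypotheses are combined into one
    equation, and the difference with the goal is left to [ring]. *)
Section LinComb.
Variable V : zmodType.
Lemma eq_lincomb (a b l r : V) : l = r -> a - b = l - r -> a = b.
Proof. by move=> ->; rewrite subrr => /eqP; rewrite subr_eq0 => /eqP. Qed.
Lemma addeq (a b c d : V) : a = b -> c = d -> a + c = b + d.
Proof. by move=> -> ->. Qed.
Lemma subeq (a b c d : V) : a = b -> c = d -> a - c = b - d.
Proof. by move=> -> ->. Qed.
End LinComb.

Section Cocycles.
Variables (G : groupType) (F : comNzRingType).
Implicit Types (f w : G -> G -> F) (u b : G -> F) (g h x y : G) (H : set G).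

Definition cocycle_on H f := forall g h k, H g -> H h -> H k ->
  f g h + f (g * h)%g k = f h k + f g (h * k)%g.

Definition delta u g h : F := u g + u h - u (g * h)%g.

Definition normalized_on H f := forall g, H g -> f 1%g g = 0 /\ f g 1%g = 0.

(** In the central extension defined by [f], conjugation by a lift of [g]
    carries the standard lift of [a] to the standard lift of [cj g a] shifted
    by [slant f g a]. *)
Definition slant f g a : F := f g a - f (cj g a) g.

Lemma cocycle_delta H u : cocycle_on H (delta u).
Proof. by move=> g h k _ _ _; rewrite /delta mulgA; ring. Qed.

Lemma slantM H f g h a : is_subgroup H -> cocycle_on H f -> H g -> H h -> H a ->
  slant f (g * h)%g a = slant f g (cj h a) + slant f h a.
Proof.
move=> sH cf Hg Hh Ha; have H1 : H (cj h a) by exact: sub_cj.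
have H2 : H (cj g (cj h a)) by exact: sub_cj.
have e1 := cf g h a Hg Hh Ha; have e2 := cf g (cj h a) h Hg H1 Hh.
have e3 := cf (cj g (cj h a)) g h H2 Hg Hh.
move: e2 e3; rewrite !cj_comm => e2 e3; rewrite /slant -cj_cj.
by apply: (eq_lincomb (addeq (subeq e1 e2) e3)); ring.
Qed.

Section Split.
Variables (H : set G) (d : G -> int) (t : G).
Hypotheses (sH : is_subgroup H) (dM : int_char d) (Ht : H t) (dt : d t = 1).

Definition ker_on g := H g /\ d g = 0.
Definition kerpart g := (g * zpow t (- d g))%g.

Lemma ker_on_subgroup : is_subgroup ker_on.
Proof.
split; first by split; [exact: sub1|exact: int_char1].
  by move=> x y [Hx dx] [Hy dy]; split; [exact: subM|rewrite dM dx dy].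
by move=> x [Hx dx]; split; [exact: subV|rewrite int_charV // dx oppr0].
Qed.

Lemma Hzt i : H (zpow t i). Proof. exact: sub_zpow. Qed.
Lemma d_zt i : d (zpow t i) = i.
Proof. by rewrite int_char_zpow // dt mulr1. Qed.

Lemma ker_cj g x : H g -> ker_on x -> ker_on (cj g x).
Proof. by move=> Hg [Hx dx]; split; [exact: sub_cj|rewrite int_char_cj]. Qed.

Lemma kerpart_ker g : H g -> ker_on (kerpart g).
Proof.
move=> Hg; split; first by apply: subM => //; exact: Hzt.
by rewrite /kerpart dM d_zt addrN.
Qed.

Lemma kerpartE g : g = (kerpart g * zpow t (d g))%g.
Proof. by rewrite /kerpart zpowN mulgVK. Qed.

Lemma kerpart_id g : ker_on g -> kerpart g = g.
Proof. by case=> _ dg; rewrite /kerpart dg mulg1. Qed.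

Lemma kerpartM g h : kerpart (g * h)%g = (kerpart g * cj (zpow t (d g)) (kerpart h))%g.
Proof. by rewrite /kerpart /cj dM opprD addrC zpowD !zpowN; gsimp. Qed.

Section Extend.
Variables (w : G -> G -> F) (b : G -> F).
Hypothesis cw : cocycle_on ker_on w.
Hypothesis nw : normalized_on ker_on w.
Hypothesis wb : forall x y, ker_on x -> ker_on y ->
  b (x * y)%g + w x y = b x + b y + w (cj t x) (cj t y).

(** The iterates of the automorphism [(v, x) |-> (v + b x, cj t x)] of the
    extension of the kernel defined by [w]. *)
Definition bz (i : int) x : F :=
  match i with
  | Posz n => \sum_(m < n) b (cj (zpow t (Posz m)) x)
  | Negz n => - \sum_(m < n.+1) b (cj (zpow t (Negz m)) x)
  end.

Lemma bzS i x : bz (i + 1) x = bz i x + b (cj (zpow t i) x).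
Proof.
case: i => [n|[|n]]; first by rewrite -PoszD addn1 /= big_ord_recr.
  by rewrite /= big_ord0 big_ord1 addNr.
have -> : (Negz n.+1 + 1)%R = Negz n by rewrite !NegzE -addn1 PoszD opprD addrK.
by rewrite [in RHS]/bz big_ord_recr /= opprD addrNK.
Qed.

Lemma bz0 x : bz 0 x = 0. Proof. exact: big_ord0. Qed.
Lemma bz1 x : bz 1 x = b x. Proof. by rewrite -[1]add0r bzS bz0 add0r cj1g. Qed.

Lemma bzD i j x : bz (i + j) x = bz j x + bz i (cj (zpow t j) x).
Proof.
elim/int_ind_pm: i => [|i IH|i IH]; first by rewrite add0r bz0 addr0.
  by rewrite addrAC !bzS IH cj_cj -zpowD addrA.
have e1 := bzS (i - 1 + j) x; have e2 := bzS (i - 1) (cj (zpow t j) x).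
rewrite (_ : i - 1 + j + 1 = i + j) in e1; last by ring.
rewrite cj_cj -zpowD subrK in e2.
by apply: (eq_lincomb (subeq (addeq IH e2) e1)); ring.
Qed.

Lemma bz_w i x y : ker_on x -> ker_on y ->
  bz i (x * y)%g + w x y
  = bz i x + bz i y + w (cj (zpow t i) x) (cj (zpow t i) y).
Proof.
move=> Nx Ny; have K j z : ker_on z -> ker_on (cj (zpow t j) z).
  by apply: ker_cj; exact: Hzt.
elim/int_ind_pm: i => [|i IH|i IH].
- by rewrite !bz0 zpow0 !cj1g !add0r.
- have := wb (K i _ Nx) (K i _ Ny); rewrite !cj_cj -cjM !bzS.
  rewrite (_ : t * zpow t i = zpow t (i + 1))%g; last by rewrite addrC zpowD.
  by move=> e; apply: (eq_lincomb (addeq IH e)); ring.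
- have := wb (K (i - 1) _ Nx) (K (i - 1) _ Ny); rewrite !cj_cj -cjM.
  rewrite (_ : t * zpow t (i - 1) = zpow t i)%g; last first.
    by rewrite -{1}[t]zpow1 -zpowD; congr zpow; ring.
  have := bzS (i - 1) x; have := bzS (i - 1) y; have := bzS (i - 1) (x * y)%g.
  rewrite subrK => e1 e2 e3 e.
  by apply: (eq_lincomb (addeq (addeq (subeq (subeq IH e) e1) e2) e3)); ring.
Qed.

(** With respect to the decomposition of a group element into its factor in
    the kernel and a power of [t], this is the cocycle of the semidirect product
    of the extension defined by [w] with the integers. *)
Definition extend_cocycle g h : F :=
  w (kerpart g) (cj (zpow t (d g)) (kerpart h)) + bz (d g) (kerpart h).

Lemma b_at1 : b 1%g = 0.
Proof.
have N1 : ker_on 1%g by exact: sub1 ker_on_subgroup.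
have := wb N1 N1; rewrite !cj1 mulg1 (nw N1).1 !addr0 => e.
by apply: (addrI (b 1%g)); rewrite -e addr0.
Qed.

Lemma bz_at1 i : bz i 1%g = 0.
Proof.
elim/int_ind_pm: i => [|i IH|i IH]; first exact: bz0.
  by rewrite bzS IH cj1 b_at1 addr0.
by have := bzS (i - 1) 1%g; rewrite subrK IH cj1 b_at1 addr0.
Qed.

(** If the automorphism [cj t] of the kernel lifts to the central extension
    defined by [w], the semidirect product of that extension with the
    integers is a central extension of the whole group. *)
Lemma extend_cocycleP :
  exists f, [/\ cocycle_on H f, normalized_on H f,
    forall x y, ker_on x -> ker_on y -> f x y = w x y &
    forall x, ker_on x -> slant f t x = b x].
Proof.
have N1 : ker_on 1%g by exact: sub1 ker_on_subgroup.
have np1 : kerpart 1%g = 1%g by exact: kerpart_id.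
have npt : kerpart t = 1%g by rewrite /kerpart dt zpowN zpow1 mulgV.
exists extend_cocycle; split.
- move=> g h k Hg Hh Hk; rewrite /extend_cocycle dM !kerpartM.
  set n := kerpart g; set l := kerpart h; set m := kerpart k; set i := d g; set j := d h.
  have K k0 z : ker_on z -> ker_on (cj (zpow t k0) z) by apply: ker_cj; exact: Hzt.
  have Nn : ker_on n := kerpart_ker Hg; have Nl : ker_on l := kerpart_ker Hh.
  have Nm : ker_on m := kerpart_ker Hk.
  have e1 := cw Nn (K i _ Nl) (K i _ (K j _ Nm)).
  have e2 := bz_w i Nl (K j _ Nm).
  rewrite bzD cjM zpowD -!cj_cj.
  by apply: (eq_lincomb (subeq e1 e2)); ring.
- move=> g Hg; rewrite /extend_cocycle int_char1 // np1 !cj1.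
  rewrite bz0 bz_at1 !addr0; split; first by case: (nw (ker_cj (Hzt 0) (kerpart_ker Hg))).
  by case: (nw (kerpart_ker Hg)).
- move=> x y Nx Ny; rewrite /extend_cocycle !kerpart_id // (proj2 Nx) bz0 addr0.
  by rewrite cj1g.
- move=> x Nx; have Nx' := ker_cj Ht Nx; rewrite /slant /extend_cocycle.
  rewrite dt npt !kerpart_id // (proj2 Nx') bz0 bz1 cj1 addr0.
  by rewrite (proj1 (nw (ker_cj (Hzt 1) Nx))) (proj2 (nw Nx')) add0r subr0.
Qed.

End Extend.

Lemma cocycle_normalized f x : cocycle_on H f -> f 1%g 1%g = 0 -> H x ->
  f 1%g x = 0 /\ f x 1%g = 0.
Proof.
move=> cf f1 Hx; have H1 := sub1 sH; split.
  have := cf 1%g 1%g x H1 H1 Hx; rewrite !mul1g f1 add0r => e.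
  by apply: (addrI (f 1%g x)); rewrite addr0 -e.
have := cf x 1%g 1%g Hx H1 H1; rewrite !mulg1 f1 add0r => e.
by apply: (addrI (f x 1%g)); rewrite addr0 e.
Qed.

(** A class is determined by its restriction to the kernel together with the
    conjugation action of a lift of [t]: when both are trivial, the kernel
    and [t] lift to a complement. *)
Lemma cocycle_trivial f :
  cocycle_on H f -> (forall x y, ker_on x -> ker_on y -> f x y = 0) ->
  (forall x, ker_on x -> slant f t x = 0) ->
  exists u, forall g h, H g -> H h -> f g h = delta u g h.
Proof.
move=> cf fN ft; have N1 : ker_on 1%g by exact: sub1 ker_on_subgroup.
have nf := @cocycle_normalized f _ cf (fN _ _ N1 N1).
have K i z : ker_on z -> ker_on (cj (zpow t i) z) by apply: ker_cj; exact: Hzt.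
have fti i x : ker_on x -> slant f (zpow t i) x = 0.
  move=> Nx; elim/int_ind_pm: i => [|i IH|i IH].
  - by rewrite /slant cj1g (nf _ (proj1 Nx)).1 (nf _ (proj1 Nx)).2 subrr.
  - rewrite addrC zpowD (slantM sH cf) ?IH ?addr0 ?ft //; last exact: (proj1 Nx).
      exact: K.
    exact: Hzt.
  - have : slant f (t * zpow t (i - 1))%g x = 0.
      by rewrite -{1}[t]zpow1 -zpowD addrC subrK.
    rewrite (slantM sH cf) ?ft ?add0r //; [exact: K|exact: Hzt|exact: (proj1 Nx)].
(* The powers of [t] generate a free group, so their lifts can be chosen
   multiplicatively: [nu] is the cochain that trivializes [f] on them. *)
pose nu (i : int) : F := match i with
  | Posz n => \sum_(m < n) f (zpow t (Posz m)) t
  | Negz n => - \sum_(m < n.+1) f (zpow t (Negz m)) t end.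
have nuS i : nu (i + 1) = nu i + f (zpow t i) t.
  case: i => [n|[|n]]; first by rewrite -PoszD addn1 /= big_ord_recr.
    by rewrite /= big_ord0 big_ord1 addNr.
  have -> : (Negz n.+1 + 1)%R = Negz n by rewrite !NegzE -addn1 PoszD opprD addrK.
  by rewrite [in RHS]/nu big_ord_recr /= opprD addrNK.
have nu0 : nu 0 = 0 by exact: big_ord0.
have nuD i j : nu (i + j) = nu i + nu j + f (zpow t i) (zpow t j).
  elim/int_ind_pm: j => [|j IH|j IH].
  - by rewrite addr0 nu0 (nf _ (Hzt i)).2 !addr0.
  - have := cf _ _ _ (Hzt i) (Hzt j) Ht; rewrite -!zpowD -zpowS => e.
    by rewrite addrA !nuS IH; apply: (eq_lincomb e); ring.
  - have := cf _ _ _ (Hzt i) (Hzt (j - 1)) Ht; rewrite -!zpowD -zpowS subrK => e.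
    have e1 := nuS (j - 1); have e2 := nuS (i + (j - 1)).
    rewrite subrK in e1; move: e2; rewrite -addrA subrK IH => e2.
    by apply: (eq_lincomb (subeq (subeq e1 e2) e)); ring.
(* The change of lifts that makes the lift of [n * t ^ i] the product of the
   lifts of [n] and of [t ^ i]. *)
pose a g := f (kerpart g) (zpow t (d g)) + nu (d g).
exists (fun g => - a g) => g h Hg Hh; rewrite /delta /a dM kerpartM nuD.
set n := kerpart g; set m := kerpart h; set i := d g; set j := d h.
have Nn : ker_on n := kerpart_ker Hg; have Nm : ker_on m := kerpart_ker Hh.
have Nm' := K i _ Nm; have Hn := proj1 Nn; have Hm := proj1 Nm; have Hm' := proj1 Nm'.
have HH := subM sH.
have e1 := cf n (zpow t i) (m * zpow t j)%g Hn (Hzt i) (HH _ _ Hm (Hzt j)).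
have e2 := cf (zpow t i) m (zpow t j) (Hzt i) Hm (Hzt j).
have e3 := cf _ (zpow t i) (zpow t j) Hm' (Hzt i) (Hzt j).
have e4 := cf n _ (zpow t (i + j)) Hn Hm' (Hzt _).
have e5 := fti i m Nm; rewrite /slant in e5.
have E : (zpow t i * h = cj (zpow t i) m * zpow t (i + j))%g.
  by rewrite zpowD mulgA cj_comm -mulgA -kerpartE.
move: e1 e2 e3 e4; rewrite -!kerpartE E cj_comm (fN _ _ Nn Nm') -zpowD => e1 e2 e3 e4.
by apply: (eq_lincomb (addeq (addeq (subeq e1 e2) (subeq e3 e4)) e5)); ring.
Qed.

End Split.
End Cocycles.

(** * Extensions of a free abelian group of rank two by an abelian group *)

Definition whole (G : groupType) : set G := fun=> True.

Lemma whole_subgroup (G : groupType) : is_subgroup (@whole G).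
Proof. by []. Qed.

(** The pair [(dx, dy)] is a homomorphism onto the free abelian group of rank
    two with abelian kernel, and [s], [t] lift its standard basis. *)
Record frame (G : groupType) (dx dy : G -> int) (s t : G) : Prop := Frame {
  frame_xM : int_char dx;
  frame_yM : int_char dy;
  frame_xs : dx s = 1;
  frame_ys : dy s = 0;
  frame_xt : dx t = 0;
  frame_yt : dy t = 1;
  frame_ab : forall a b, dx a = 0 -> dy a = 0 -> dx b = 0 -> dy b = 0 -> commute a b
}.

Section Frame.
Variables (G : groupType) (dx dy : G -> int) (s t : G).
Hypothesis fr : frame dx dy s t.

(** The group is reached from the abelian kernel [fker] in two steps with
    infinite cyclic quotient, generated by [s] and then by [t]; [fker2] is the
    intermediate group. *)
Definition fker2 : set G := ker_on (@whole G) dy.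
Definition fker : set G := ker_on fker2 dx.
Definition fcomm : G := (cj t s * s^-1)%g.

Let dxM := frame_xM fr.
Let dyM := frame_yM fr.

Lemma fkerP a : fker a <-> dx a = 0 /\ dy a = 0.
Proof. by split=> [[[_ ?] ?]|[]]. Qed.

Lemma fker2_subgroup : is_subgroup fker2.
Proof. exact: (ker_on_subgroup (@whole_subgroup G)). Qed.

Lemma fker_subgroup : is_subgroup fker.
Proof. exact: (ker_on_subgroup fker2_subgroup). Qed.

Lemma fker_comm a b : fker a -> fker b -> commute a b.
Proof. by move=> /fkerP[xa ya] /fkerP[xb yb]; exact: (frame_ab fr). Qed.

Lemma fker_cj g a : fker a -> fker (cj g a).
Proof. by move=> /fkerP[xa ya]; apply/fkerP; rewrite !int_char_cj. Qed.

Lemma fker_cj_id a b : fker a -> fker b -> cj a b = b.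
Proof. by move=> Aa Ab; exact/cj_id/fker_comm. Qed.

Lemma fker2_s : fker2 s. Proof. by split=> //; exact: (frame_ys fr). Qed.

Lemma fker_fker2 a : fker a -> fker2 a. Proof. by case. Qed.

Lemma fcomm_fker : fker fcomm.
Proof.
by apply/fkerP; rewrite dxM dyM !int_char_cj // !int_charV // !addrN.
Qed.

Lemma cj_t_s : cj t s = (fcomm * s)%g. Proof. by rewrite /fcomm mulgVK. Qed.

Lemma cj_s_t a : fker a -> cj s (cj t a) = cj t (cj s a).
Proof.
move=> Aa; rewrite !cj_cj -(cj_comm t s) cj_t_s -mulgA -[RHS]cj_cj.
by rewrite [RHS]fker_cj_id //; [exact: fcomm_fker|exact: fker_cj].
Qed.

Section TwoStep.
Variables (F : comNzRingType) (w : G -> G -> F) (bs bt : G -> F).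
Hypotheses (cw : cocycle_on fker w) (nw : normalized_on fker w).
Hypothesis ws : forall x y, fker x -> fker y ->
  bs (x * y)%g + w x y = bs x + bs y + w (cj s x) (cj s y).
Hypothesis wt : forall x y, fker x -> fker y ->
  bt (x * y)%g + w x y = bt x + bt y + w (cj t x) (cj t y).
Hypothesis obstruction : forall a, fker a ->
  bs (cj t a) - bs a + bt a - bt (cj s a)
    + (w fcomm (cj s (cj t a)) - w (cj s (cj t a)) fcomm) = 0.

(** A class on the abelian kernel whose extension group admits lifts of both
    [cj s] and [cj t] comes from the whole group as soon as these two lifts
    commute up to conjugation by a lift of [fcomm]; the obstruction measures
    the difference. It extends first over [s], and the resulting class is then
    invariant under [t] by the criterion [cocycle_trivial]. *)
Lemma extend_two_steps :
  exists f, [/\ cocycle_on (@whole G) f,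
    forall x y, fker x -> fker y -> f x y = w x y &
    forall a, fker a -> slant f s a = bs a].
Proof.
have Ks := fker2_s; have xs := frame_xs fr; have K2 := fker2_subgroup.
have cjK g a : fker2 a -> fker2 (cj g a).
  by move=> [_ ya]; split=> //; rewrite int_char_cj.
have [f1 [cf1 nf1 f1w f1s]] := extend_cocycleP K2 dxM Ks xs cw nw ws.
(* [be] extends [bt] over the powers of [s] by zero; [f2] measures the failure
   of [f1] to be invariant under [t] by means of [be]. *)
pose be x := bt (kerpart dx s x).
have beA x : fker x -> be x = bt x by move=> Ax; rewrite /be (kerpart_id s Ax).
pose f2 x y := f1 (cj t x) (cj t y) - f1 x y + delta be x y.
have cf2 : cocycle_on fker2 f2.
  move=> g h k Kg Kh Kk; have e1 := cf1 g h k Kg Kh Kk.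
  have e2 := cf1 _ _ _ (cjK t _ Kg) (cjK t _ Kh) (cjK t _ Kk).
  have e3 := cocycle_delta be Kg Kh Kk.
  rewrite /f2 !cjM.
  by apply: (eq_lincomb (addeq (subeq e2 e1) e3)); ring.
have f2A x y : fker x -> fker y -> f2 x y = 0.
  move=> Ax Ay; rewrite /f2 !f1w ?beA //; try exact: fker_cj.
  rewrite /delta !beA //; last exact: (subM fker_subgroup).
  by apply: (eq_lincomb (esym (wt Ax Ay))); ring.
have f2s a : fker a -> slant f2 s a = 0.
  move=> Aa; have Asa := fker_cj s Aa; have Ata := fker_cj t Aa.
  have e1 := obstruction Aa; have e2 := f1s _ Aa.
  have e3 : slant f1 (cj t s) (cj t a)
      = w fcomm (cj s (cj t a)) - w (cj s (cj t a)) fcomm + bs (cj t a).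
    have Ac := fcomm_fker; have Asta := fker_cj s Ata.
    rewrite cj_t_s (slantM K2 cf1) //; last exact: fker_fker2.
      rewrite f1s //; congr (_ + _).
      by rewrite /slant (fker_cj_id Ac Asta) !f1w.
    exact: fker_fker2.
  have e4 : cj (cj t s) (cj t a) = cj t (cj s a).
    by rewrite !cj_cj cj_comm.
  rewrite /slant e4 in e3; rewrite /slant in e2.
  rewrite /slant /f2 /delta cj_comm (beA _ Aa) (beA _ Asa).
  by apply: (eq_lincomb (addeq (subeq e3 e2) e1)); ring.
(* Correcting [be] by a cochain that trivializes [f2] makes [f1] invariant. *)
have [u fu] := cocycle_trivial K2 dxM Ks xs cf2 f2A f2s.
pose bK x := be x - u x.
have bKP x y : fker2 x -> fker2 y ->
    bK (x * y)%g + f1 x y = bK x + bK y + f1 (cj t x) (cj t y).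
  move=> Kx Ky; have := fu x y Kx Ky; rewrite /f2 /bK /delta => e.
  by apply: (eq_lincomb (esym e)); ring.
have [f [cf _ ff1 _]] := extend_cocycleP (@whole_subgroup G) dyM
  (I : whole t) (frame_yt fr) cf1 nf1 bKP.
exists f; split=> // [x y Ax Ay|a Aa].
  by rewrite ff1 ?f1w //; exact: fker_fker2.
rewrite -f1s // /slant !ff1 //; try exact: fker_fker2.
exact/fker_fker2/fker_cj.
Qed.

End TwoStep.
End Frame.

(** * Functionals over a prime field *)

Section ModPFunctional.
Variables (p : nat) (p_pr : prime p) (B : zmodType).
Implicit Types (X L : set B).

Definition subclosed X := X 0 /\ forall a b, X a -> X b -> X (a - b).

Lemma subclosedN X a : subclosed X -> X a -> X (- a).
Proof. by move=> [X0 XB] Xa; rewrite -[- a]add0r; exact: XB. Qed.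

Lemma subclosedD X a b : subclosed X -> X a -> X b -> X (a + b).
Proof. by move=> sX Xa Xb; rewrite -[b]opprK; apply: (proj2 sX) => //; exact: subclosedN. Qed.

Lemma subclosedMn X a n : subclosed X -> X a -> X (a *+ n).
Proof.
move=> sX Xa; elim: n => [|n IH]; first exact: (proj1 sX).
by rewrite mulrS; exact: subclosedD.
Qed.

Lemma subclosed_prime X a k : subclosed X -> X (a *+ p) -> X (a *+ k) ->
  ~~ (p %| k)%N -> X a.
Proof.
move=> sX Xp Xk pk; have k0 : (0 < k)%N by case: k pk {Xk} => //; rewrite dvdn0.
case: (egcdnP p k0) => u v e _; have e1 : gcdn k p = 1%N.
  by apply/eqP; rewrite gcdnC -/(coprime p k) prime_coprime.
rewrite -[a](addKr (a *+ (p * v))) addrC; apply: (proj2 sX).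
  rewrite -[X in _ + X]mulr1n -mulrnDr -e1 [(p * v)%N]mulnC -e mulnC mulrnA.
  exact: subclosedMn.
by rewrite mulrnA; exact: subclosedMn.
Qed.

(** Over the prime field every vector outside a subspace is separated from it
    by a linear functional; stated for abelian groups, so that it applies to
    spaces of chains and to quotients of groups of polynomials alike. *)
Lemma modp_functional L H0 x :
  subclosed L -> subclosed H0 -> H0 `<=` L -> (forall l, L l -> H0 (l *+ p)) ->
  L x -> ~ H0 x ->
  exists th : B -> 'F_p, [/\ forall a b, L a -> L b -> th (a + b) = th a + th b,
    forall a, H0 a -> th a = 0 & th x = 1].
Proof.
move=> sL sH HL Lp Lx Hx.
(* A subgroup [M] maximal among those that contain [H0] but not [x]; the empty
   set is admitted as the union of the empty chain. *)
pose good X := [/\ H0 `<=` X, X `<=` L, subclosed X & ~ X x].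
pose P X := X = set0 \/ good X.
have [|M [PM Mmax]] := @Zorn_bigcup B P.
  move=> FF FP tot; have [[X FX gX]|no] := pselect (exists2 X, FF X & good X).
    right; split.
    - by move=> a Ha; exists X => //; case: gX => + _ _ _; apply.
    - by move=> a [Y FY Ya]; case: (FP _ FY) => [Y0|[_ YL _ _]];
        [rewrite Y0 in Ya|exact: YL].
    - split; first by exists X => //; case: gX => _ _ [].
      move=> a b [Ya FYa Ha] [Yb FYb Hb].
      have gd Y : FF Y -> Y !=set0 -> good Y.
        by move=> FY [z Yz]; case: (FP _ FY) => // Y0; rewrite Y0 in Yz.
      case: (tot _ _ FYa FYb) => sub.
        exists Yb => //; have [|_ _ [_ YB] _] := gd _ FYb; first by exists b.
        by apply: YB => //; exact: sub.
      exists Ya => //; have [|_ _ [_ YB] _] := gd _ FYa; first by exists a.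
      by apply: YB => //; exact: sub.
    - by move=> [Y FY Yx]; case: (FP _ FY) => [Y0|[]]; first by rewrite Y0 in Yx.
  left; rewrite -subset0 => a [Y FY Ya].
  by case: (FP _ FY) => [Y0|gY]; [rewrite Y0 in Ya|case: no; exists Y].
have {PM} [HM ML sM Mx] : good M.
  case: PM => // M0; exfalso; apply: (Mmax H0); last by right; split.
  rewrite M0; split; first exact: sub0set.
  by move=> /(_ 0); apply; exact: (proj1 sH).
have Mp l : L l -> M (l *+ p) by move=> Ll; exact/HM/Lp.
(* By maximality [M] and [x] span [L], so the functional is the coordinate
   along [x] modulo [M]. *)
have ex l : L l -> exists j, M (l - x *+ j).
  move=> Ll; have [Ml|Ml] := pselect (M l); first by exists 0%N; rewrite subr0.
  pose M' y := exists k, M (y - l *+ k).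
  have MM' : M `<=` M' by move=> y My; exists 0%N; rewrite subr0.
  have M'x : M' x.
    apply: contrapT => nx; apply: (Mmax M').
      split=> // M'M; apply: Ml; apply: M'M; exists 1%N.
      by rewrite subrr; exact: (proj1 sM).
    right; split=> //; first exact: subset_trans MM'.
      move=> y [k Mk]; rewrite -(subrK (l *+ k) y); apply: subclosedD => //.
        exact: ML.
      exact: subclosedMn.
    split; first by exists 0%N; rewrite subr0; exact: (proj1 sM).
    move=> a b [k Ma] [k' Mb]; exists (k + p.-1 * k')%N.
    have -> : a - b - l *+ (k + p.-1 * k')
              = (a - l *+ k) - (b - l *+ k') - l *+ (p * k').
      have -> : (p * k' = k' + p.-1 * k')%N.
        by rewrite -{1}[p]prednK ?prime_gt0 // mulSn.
      rewrite !mulrnDr !opprD !opprK -!addrA; congr (_ + _).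
      by rewrite addNKr addrCA.
    by rewrite mulrnA; apply: (proj2 sM); [exact: (proj2 sM)|apply: subclosedMn; auto].
  case: M'x => k Mk; have pk : ~~ (p %| k)%N.
    apply/negP => /dvdnP[v kv]; apply: Mx.
    rewrite -(subrK (l *+ k) x); apply: subclosedD => //.
    by rewrite kv mulnC mulrnA; apply: subclosedMn; auto.
  have [v Ev] : exists v, M (l - l *+ (k * v)).
    have k0 : (0 < k)%N by case: k pk {Mk} => //; rewrite dvdn0.
    case: (egcdnP p k0) => u v e _; exists u.
    have e1 : gcdn k p = 1%N.
      by apply/eqP; rewrite gcdnC -/(coprime p k) prime_coprime.
    rewrite mulnC e e1 mulrnDr opprD addrCA subrr addr0; apply: subclosedN => //.
    by rewrite mulnC mulrnA; apply: subclosedMn; auto.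
  exists v; have -> : l - x *+ v = (l - l *+ (k * v)) - (x - l *+ k) *+ v.
    by rewrite mulrnBl -mulrnA opprB addrA subrK.
  by apply: (proj2 sM) => //; exact: subclosedMn.
have uniq l j k : M (l - x *+ j) -> M (l - x *+ k) -> j%:R = k%:R :> 'F_p.
  wlog le_jk : j k / (j <= k)%N.
    move=> W Mj Mk; case: (leqP j k) => [|/ltnW] le; first exact: W.
    exact/esym/W.
  move=> Mj Mk; have Mx' : M (x *+ (k - j)).
    have := (proj2 sM) _ _ Mj Mk; rewrite opprB addrC addrA subrK => e.
    by rewrite mulrnBr.
  have : (p %| k - j)%N.
    by apply: contrapT => /negP npk; apply: Mx; apply: subclosed_prime npk => //; auto.
  move=> /dvdnP[v e]; rewrite -(subnK le_jk) natrD e.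
  by rewrite natrM pchar_Fp_0 // mulr0 add0r.
pose th l : 'F_p := if pselect (L l) is left Ll then (sval (cid (ex l Ll)))%:R else 0.
have thE l j : L l -> M (l - x *+ j) -> th l = j%:R.
  move=> Ll Mj; rewrite /th; case: pselect => // Ll'.
  by case: cid => /= k Mk; exact: uniq Mk Mj.
exists th; split.
- move=> a b La Lb; have [j Mj] := ex a La; have [k Mk] := ex b Lb.
  rewrite (thE a j) // (thE b k) // -natrD; apply: thE; first exact: subclosedD.
  by rewrite mulrnDr opprD addrACA; exact: subclosedD.
- by move=> a Ha; rewrite (thE a 0%N) //; [exact: HL|rewrite subr0; exact: HM].
- by rewrite (thE x 1%N) // subrr; exact: (proj1 sM).
Qed.

End ModPFunctional.

(** * Cocycles and homology in degrees one and two *)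

Section QuotientProjection.
Variables (R : nzRingType) (V : lmodType R) (W : submodule V).

Definition qproj (v : V) : quotient_module W := \pi_(quotient_module W) v.

Fact qproj_is_linear : linear qproj.
Proof.
move=> a u v; rewrite /qproj; have -> := qmod_addE W (a *: u) v.
by have -> := qmod_scaleE W a u.
Qed.

HB.instance Definition _ :=
  GRing.isLinear.Build R V (quotient_module W) _ qproj qproj_is_linear.

Lemma qproj_eq0 v : qproj v = 0 -> sm_set W v.
Proof. by move=> /eqP/(qmod_eqP W v 0); rewrite subr0. Qed.

Lemma qproj_repr (q : quotient_module W) : qproj (repr q) = q.
Proof. exact: reprK. Qed.

Lemma qproj0 v : sm_set W v -> qproj v = 0.
Proof. by move=> Wv; apply/eqP/(qmod_eqP W v 0); rewrite subr0. Qed.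

End QuotientProjection.

Section ChainEval.
Variables (G : groupType) (F : fieldType).

(** The linear functional on chains with prescribed values on the basis. *)
Definition evc n (f : n.-tuple G -> F) (c : chain G F n) : F :=
  \sum_(g <- msupp c) c@_g * f g.

Lemma evcEw n f (d : {fset n.-tuple G}) (c : chain G F n) :
  (msupp c `<=` d)%fset -> evc f c = \sum_(g <- d) c@_g * f g.
Proof.
move=> le; rewrite /evc (big_fset_incl _ le) // => g _ /mcoeff_outdom ->.
by rewrite mul0r.
Qed.

Fact evc_is_linear n (f : n.-tuple G -> F) : scalar (@evc n f).
Proof.
move=> a u v; pose d := (msupp (a *: u + v) `|` (msupp u `|` msupp v))%fset.
rewrite (@evcEw _ _ d) ?fsubsetUl //.
rewrite (@evcEw _ _ d u); last by rewrite /d fsetUCA fsubsetUl.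
rewrite (@evcEw _ _ d v); last by rewrite /d fsetUA fsubsetUr.
rewrite mulr_sumr -big_split /=; apply: eq_bigr => g _.
by rewrite mcoeffD mcoeffZ mulrDl mulrA.
Qed.

HB.instance Definition _ n f :=
  GRing.isLinear.Build F (chain G F n) F _ (@evc n f) (@evc_is_linear n f).

Definition cell n (g : n.-tuple G) : chain G F n := << g >>.

Lemma msupp_cell n (g : n.-tuple G) : msupp (cell g) = [fset g]%fset.
Proof. by rewrite /cell msuppU oner_eq0. Qed.

Lemma evc_cell n f (g : n.-tuple G) : evc f (cell g) = f g.
Proof. by rewrite /evc msupp_cell big_seq_fset1 /cell mcoeffUU mul1r. Qed.

Lemma chainE n (c : chain G F n) : c = \sum_(g <- msupp c) c@_g *: cell g.
Proof.
rewrite [LHS]monalgE; apply: eq_bigr => g _; apply/malgP => h.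
by rewrite mcoeffZ /cell !mcoeffU mulr_natr.
Qed.

Lemma boundary_cell n (g : n.+1.-tuple G) : boundary (cell g) = boundary_gen F g.
Proof. by rewrite /boundary msupp_cell big_seq_fset1 /cell mcoeffUU scale1r. Qed.

Lemma evc_boundary_cell n f (g : n.+1.-tuple G) :
  evc f (boundary (cell g)) = \sum_(i < n.+2) (-1) ^+ i * f (face i g).
Proof.
rewrite boundary_cell /boundary_gen linear_sum; apply: eq_bigr => i _.
by rewrite linearZ /= -/(cell _) evc_cell.
Qed.

Lemma boundary_genE n (g : n.+1.-tuple G) :
  boundary_gen F g = \sum_(i < n.+2) (-1) ^+ i *: cell (face i g).
Proof. by []. Qed.

Lemma boundary1 (g : G) : boundary (cell [tuple g]) = 0.
Proof.
rewrite boundary_cell /boundary_gen big_ord_recl big_ord1 expr0 expr1.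
rewrite scale1r scaleN1r.
by rewrite [face ord0 _]tuple0 [face (lift _ _) _]tuple0 subrr.
Qed.

Lemma boundary2 (g h : G) : boundary (cell [tuple g; h])
  = cell [tuple h] - cell [tuple (g * h)%g] + cell [tuple g].
Proof.
have f0 : face ord0 [tuple g; h] = [tuple h].
  by apply: eq_from_tnth => i; rewrite (ord1 i) tnth_mktuple.
have f1 : face (lift ord0 ord0) [tuple g; h] = [tuple (g * h)%g].
  by apply: eq_from_tnth => i; rewrite (ord1 i) tnth_mktuple.
have f2 : face (lift ord0 (lift ord0 ord0)) [tuple g; h] = [tuple g].
  by apply: eq_from_tnth => i; rewrite (ord1 i) tnth_mktuple.
rewrite boundary_cell boundary_genE 2!big_ord_recl big_ord1 f0 f1 f2.
rewrite expr0 expr1 scale1r scaleN1r.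
by rewrite sqrrN expr1n scale1r addrA.
Qed.

Lemma evc_boundary3 (f : G -> G -> F) (g h k : G) :
  evc (fun x : 2.-tuple G => f (tnth x ord0) (tnth x (lift ord0 ord0)))
    (boundary (cell [tuple g; h; k]))
  = f h k - f (g * h)%g k + f g (h * k)%g - f g h.
Proof.
rewrite evc_boundary_cell 3!big_ord_recl big_ord1 !tnth_mktuple /=.
rewrite expr0 mul1r expr1 mulN1r; rewrite !addrA; congr (_ - _ + _ + _).
  by rewrite sqrrN expr1n mul1r.
by rewrite exprS sqrrN expr1n mulr1 mulN1r.
Qed.

End ChainEval.

Section LowDegree.
Variables (G : groupType).

Definition additive_on (F : zmodType) (H : set G) (f : G -> F) :=
  forall g h, H g -> H h -> f (g * h)%g = f g + f h.

Lemma additive_zpow (F : zmodType) (H : set G) (f : G -> F) a k :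
  is_subgroup H -> additive_on H f -> H a -> f (zpow a k) = f a *~ k.
Proof.
move=> sH fM Ha; have Hz i : H (zpow a i) by exact: sub_zpow.
elim/int_ind_pm: k => [|k IH|k IH].
- by apply: (addrI (f 1%g)); rewrite mulr0z addr0 -(fM _ _ (Hz 0) (Hz 0)) mulg1.
- by rewrite zpowS fM // IH mulrzDr mulr1z.
apply: (addIr (f a)); rewrite -fM // -zpowS subrK IH.
by rewrite mulrzBr mulr1z subrK.
Qed.

Section H1.
Variable F : fieldType.

Fact cell1_cycle (g : G) : cell F [tuple g] \in @cycle_pred G F 1.
Proof. by rewrite inE boundary1. Qed.

Definition cell1 g : cycles G F 1 := exist _ (cell F [tuple g]) (cell1_cycle g).

Lemma cell1M g h : qproj (boundaries G F 1) (cell1 (g * h)%g)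
  = qproj _ (cell1 g) + qproj _ (cell1 h).
Proof.
apply/eqP; rewrite eq_sym -subr_eq0 -raddfD -raddfB; apply/eqP/qproj0.
by exists (cell F [tuple g; h]); rewrite boundary2 /= addrAC [RHS]addrAC [in RHS]addrC addrA.
Qed.

Lemma cycle1E (z : cycles G F 1) :
  z = \sum_(g <- msupp (val z)) (val z)@_g *: cell1 (tnth g ord0).
Proof.
apply: val_inj; rewrite raddf_sum [LHS]chainE; apply: eq_bigr => g _.
rewrite [RHS]linearZ_LR; congr (_ *: cell _ _); apply: eq_from_tnth => i.
by rewrite (ord1 i).
Qed.

(** The coordinates of the classes of the one-cells [g], which generate the
    first homology, are homomorphisms. *)
Lemma betti1_homs b : betti G F 1 b ->
  exists chi : 'I_b -> G -> F, (forall i, additive_on (@whole G) (chi i)) /\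
    forall x : 'rV[F]_b, (forall g, \sum_i x 0 i * chi i g = 0) -> x = 0.
Proof.
case=> Phi bPhi; have [Psi PhiK PsiK] := bPhi.
have Psi_lin : linear Psi by move=> a u v; apply: (can_inj PhiK); rewrite linearP !PsiK.
exists (fun i g => Psi (qproj _ (cell1 g)) 0 i); split.
  move=> i g h _ _; rewrite cell1M -[in LHS](scale1r (qproj _ (cell1 g))) Psi_lin.
  by rewrite scale1r mxE.
have PsiZ a u : Psi (a *: u) = a *: Psi u.
  by apply: (can_inj PhiK); rewrite linearZ_LR !PsiK.
pose PsiL : {linear homology G F 1 -> 'rV[F]_b} := HB.pack_for
  {linear homology G F 1 -> 'rV[F]_b} Psi (GRing.isLinear.Build _ _ _ _ _ Psi_lin).
move=> x hx; have key (y : 'rV[F]_b) : \sum_i x 0 i * y 0 i = 0.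
  have -> : y = PsiL (Phi y) by rewrite /= PhiK.
  rewrite -(qproj_repr (Phi y)) [repr _]cycle1E !linear_sum.
  under eq_bigr => i _ do rewrite summxE mulr_sumr.
  rewrite exchange_big big1 //= => g _.
  under eq_bigr => i _ do rewrite linearZ_LR /= PsiZ mxE mulrCA.
  by rewrite -mulr_sumr hx mulr0.
apply/rowP => i; rewrite mxE; have := key (delta_mx 0 i).
rewrite (bigD1 i) //= mxE !eqxx mulr1 big1 ?addr0 // => j nji.
by rewrite mxE eqxx (negPf nji) mulr0.
Qed.

End H1.

Section H2.
Variables (p : nat) (p_pr : prime p).
Local Notation F := 'F_p.
Implicit Types f : G -> G -> F.

Local Notation evc2 f :=
  (evc (fun x : 2.-tuple G => f (tnth x ord0) (tnth x (lift ord0 ord0)) : F)).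

Lemma evc2_boundary f (c : chain G F 3) :
  cocycle_on (@whole G) f -> evc2 f (boundary c) = 0.
Proof.
move=> cf; have key (x : 3.-tuple G) : evc2 f (boundary (cell F x)) = 0.
  have -> : x = [tuple tnth x ord0; tnth x (lift ord0 ord0); tnth x ord_max].
    apply: eq_from_tnth => i; case: (unliftP ord0 i) => [j|] -> //.
    case: (unliftP ord0 j) => [k|] -> //; rewrite (ord1 k) /=.
    by congr tnth; apply: val_inj.
  set g := tnth _ _; set h := tnth _ _; set k := tnth _ _; rewrite evc_boundary3.
  by apply: (eq_lincomb (esym (cf g h k I I I))); ring.
have -> : boundary c = \sum_(x <- msupp c) c@_x *: boundary (cell F x).
  by rewrite {1}[c]chainE linear_sum; apply: eq_bigr => x _; rewrite linearZ_LR.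
rewrite linear_sum big1 // => x _.
by rewrite linearZ_LR -[RHS](mulr0 (c@_x)) -(key x).
Qed.

(** A cocycle that pairs trivially with all cycles factors through the group
    of one-dimensional boundaries; a functional on all one-dimensional chains
    extending it is the cochain sought. *)
Lemma cocycle_is_delta f :
  (forall c : chain G F 2, boundary c = 0 -> evc2 f c = 0) ->
  exists u, forall g h, f g h = delta u g h.
Proof.
move=> fz; pose B : zmodType := (chain G F 1 * F)%type.
pose H0 : set B := [set v | exists c : chain G F 2, v = (boundary c, evc2 f c)].
have sH : subclosed H0.
  split; first by exists 0; rewrite !raddf0.
  by move=> _ _ [c ->] [c' ->]; exists (c - c'); rewrite !raddfB.
have sT : subclosed (setT : set B) by [].
have pF (a : F) : a *+ p = 0 by rewrite -mulr_natr pchar_Fp_0 // mulr0.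
have pH (l : B) : setT l -> H0 (l *+ p).
  move=> _; suff -> : l *+ p = 0 by exact: (proj1 sH).
  case: l => l1 l2; apply/pair_eqP; rewrite /= !raddfMn /= pF eqxx andbT.
  by rewrite -scaler_nat pchar_Fp_0 // scale0r.
have nH : ~ H0 (0, 1).
  move=> [c [c0 c1]]; have := fz c (esym c0); rewrite -c1 => /eqP.
  by rewrite oner_eq0.
have [th [thD thH th1]] :=
  modp_functional p_pr sT sH (fun _ _ => I) pH (I : setT ((0, 1) : B)) nH.
have th0 : th 0 = 0 by apply: thH; exact: (proj1 sH).
have thN v : th (- v) = - th v.
  by apply/eqP; rewrite -addr_eq0 -thD // addNr th0.
have thn n : th (0, n%:R) = n%:R.
  elim: n => [|n IH]; first exact: th0.
  have -> : (0, n.+1%:R) = ((0, n%:R) : B) + ((0, 1) : B).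
    by apply/pair_eqP; rewrite /= addr0 natr1 !eqxx.
  by rewrite thD // IH th1 natr1.
have thF (a : F) : th (0, a) = a by rewrite -[a]natr_Zp thn.
exists (fun g => - th (cell F [tuple g], 0)) => g h.
have := thH (boundary (cell F [tuple g; h]), evc2 f (cell F [tuple g; h])).
move=> /(_ (ex_intro _ _ erefl)); rewrite boundary2.
have -> : evc2 f (cell F [tuple g; h]) = f g h by rewrite evc_cell.
set x := cell _ _; set y := cell _ _; set z := cell _ _.
have -> : (x - y + z, f g h)
    = ((x, 0) : B) - ((y, 0) : B) + ((z, 0) : B) + ((0, f g h) : B).
  by apply/pair_eqP; rewrite /= addr0 !subr0 !add0r !eqxx.
rewrite !thD // thN thF /delta => e.
by apply: (eq_lincomb e); ring.
Qed.

(** The values of the [m] cocycles on representatives of a basis of the second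
    homology form a matrix with more rows than columns; a relation between its
    rows gives a combination that vanishes on all cycles. *)
Lemma cocycles_dependent b m (fs : 'I_m -> G -> G -> F) :
  betti G F 2 b -> (b < m)%N -> (forall i, cocycle_on (@whole G) (fs i)) ->
  exists x : 'rV[F]_m, x != 0 /\
    exists u, forall g h, \sum_i x 0 i * fs i g h = delta u g h.
Proof.
case=> Phi [Psi PhiK PsiK] lt_bm cfs.
pose zc j := repr (Phi (delta_mx 0 j)) : cycles G F 2.
pose P := \matrix_(i < m, j < b) evc2 (fs i) (val (zc j)).
have kP : kermx P != 0.
  rewrite -mxrank_eq0 mxrank_ker subn_eq0 -ltnNge.
  exact: leq_ltn_trans (rank_leq_col _) lt_bm.
exists (nz_row (kermx P)); rewrite nz_row_eq0; split=> //.
set x := nz_row _; have xP : x *m P = 0 by apply/sub_kermxP/nz_row_sub.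
pose f g h := \sum_i x 0 i * fs i g h.
have evf c : evc2 f c = \sum_i x 0 i * evc2 (fs i) c.
  rewrite /evc; under [RHS]eq_bigr => i _ do rewrite mulr_sumr.
  rewrite exchange_big /=; apply: eq_bigr => g _; rewrite /f mulr_sumr.
  by apply: eq_bigr => i _; rewrite mulrCA.
apply: cocycle_is_delta => c c0.
have cz : c \in @cycle_pred G F 2 by rewrite inE c0.
pose z : cycles G F 2 := exist _ c cz.
pose y := Psi (qproj (boundaries G F 2) z).
have : qproj (boundaries G F 2) (z - \sum_j y 0 j *: zc j) = 0.
  rewrite raddfB raddf_sum /=.
  under eq_bigr => j _ do rewrite linearZ_LR /= qproj_repr -linearZ_LR.
  rewrite -raddf_sum -row_sum_delta; apply/eqP.
  by rewrite subr_eq0 -{1}(PsiK (qproj _ z)).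
move=> /qproj_eq0 [d]; rewrite raddfB raddf_sum /= => hd.
have -> : c = boundary d + \sum_j y 0 j *: val (zc j).
  by rewrite hd subrK.
rewrite evf; under eq_bigr => i _ do
  rewrite raddfD /= evc2_boundary // add0r linear_sum mulr_sumr.
rewrite exchange_big big1 //= => j _.
under eq_bigr => i _ do rewrite linearZ_LR /= mulrCA.
rewrite -mulr_sumr; have := congr1 (fun A : 'rV_b => A 0 j) xP; rewrite !mxE.
by under eq_bigr => i _ do rewrite mxE; move=> ->; rewrite mulr0.
Qed.

End H2.
End LowDegree.

(** * Restriction to a normal subgroup with infinite cyclic quotient *)

Section Homs.
Variables (G : groupType) (F : fieldType) (K : set G).
Implicit Types (phi : G -> F).

(** The consequence of finite generation of [K] on which the finite dimension
    of its space of homomorphisms depends. *)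
Definition fin_separated (ks : seq G) := (forall k, k \in ks -> K k) /\
  forall phi, additive_on K phi ->
  (forall k, k \in ks -> phi k = 0) -> forall k, K k -> phi k = 0.

Lemma additive_comb n (x : 'rV[F]_n) (phi : 'I_n -> G -> F) :
  (forall i, additive_on K (phi i)) ->
  additive_on K (fun g => \sum_i x 0 i * phi i g).
Proof.
move=> a g h Kg Kh; rewrite -big_split; apply: eq_bigr => i _.
by rewrite a // mulrDr.
Qed.

Lemma additiveB phi psi :
  additive_on K phi -> additive_on K psi -> additive_on K (fun g => phi g - psi g).
Proof. by move=> a b g h Kg Kh; rewrite a // b // opprD addrACA. Qed.

(** A family of homomorphisms of maximal size among those whose values at the
    separating elements are linearly independent. *)
Lemma homs_basis ks : fin_separated ks ->
  exists n (phi : 'I_n -> G -> F), [/\ forall i, additive_on K (phi i),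
    forall x : 'rV[F]_n, (forall k, K k -> \sum_i x 0 i * phi i k = 0) -> x = 0 &
    forall psi, additive_on K psi ->
      exists x : 'rV[F]_n, forall k, K k -> psi k = \sum_i x 0 i * phi i k].
Proof.
move=> [ksK sep]; pose N := size ks.
pose ev phi : 'rV[F]_N := \row_j phi (tnth (in_tuple ks) j).
pose E m (phi : 'I_m -> G -> F) : 'M[F]_(m, N) := \matrix_i ev (phi i).
pose P m := `[< exists phi : 'I_m -> G -> F,
  (forall i, additive_on K (phi i)) /\ row_free (E m phi) >].
have exP : exists m, P m.
  exists 0%N; apply/asboolP; exists (fun _ _ => 0); split; first by case.
  by rewrite /row_free -leqn0 rank_leq_row.
have Pb m : P m -> (m <= N)%N.
  by move=> /asboolP[phi [_ /eqP <-]]; exact: rank_leq_col.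
case: (ex_maxnP exP Pb) => n /asboolP[phi [aphi fphi]] nmax.
have evE (x : 'rV_n) : ev (fun g => \sum_i x 0 i * phi i g) = x *m E n phi.
  by apply/rowP => j; rewrite !mxE; apply: eq_bigr => i _; rewrite !mxE.
exists n, phi; split=> //.
  move=> x x0; have : x *m E n phi = 0.
    by rewrite -evE; apply/rowP => j; rewrite !mxE x0 //; apply/ksK/mem_tnth.
  by move/eqP; rewrite mulmx_free_eq0 // => /eqP.
move=> psi apsi; have : (ev psi <= E n phi)%MS.
  apply: contraT => nsub; have : P n.+1.
    apply/asboolP; exists (fun i => if unlift ord_max i is Some j then phi j else psi).
    split; first by move=> i; case: (unlift _ _).
    set A := E _ _.
    have sub : (E n phi <= A)%MS.
      apply/row_subP => i; have -> : row i (E n phi) = row (lift ord_max i) A.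
        by rewrite !rowK liftK.
      exact: row_sub.
    have sub2 : (ev psi <= A)%MS.
      have -> : ev psi = row ord_max A by rewrite rowK unlift_none.
      exact: row_sub.
    have lt : (E n phi < A)%MS.
      rewrite ltmxEneq sub /=; apply: contra nsub => AE.
      exact: submx_trans sub2 AE.
    rewrite /row_free eqn_leq rank_leq_row /=.
    by move: lt; rewrite ltmxErank (eqP fphi) => /andP[].
  by move=> /nmax; rewrite ltnn.
case/submxP => x xE; exists x => k Kk; apply/eqP; rewrite -subr_eq0; apply/eqP.
apply: (sep (fun g => psi g - \sum_i x 0 i * phi i g)) => //.
  by apply: additiveB => //; exact: additive_comb.
move=> l lks; have [j ->] : exists j, l = tnth (in_tuple ks) j.
  by exists (Ordinal (etrans (index_mem l ks) lks)); rewrite (tnth_nth l) nth_index.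
have := congr1 (fun A : 'rV_N => A 0 j) xE; rewrite -evE !mxE => ->.
by rewrite subrr.
Qed.

End Homs.

Section Restriction.
Variables (G : groupType) (p : nat).
Hypothesis p_pr : prime p.
Local Notation F := 'F_p.
Variables (d : G -> int) (t : G) (ks : seq G) (b1 b2 : nat).
Hypotheses (dM : int_char d) (dt : d t = 1).
Let K : set G := ker_on (@whole G) d.
Hypothesis sep : fin_separated F K ks.
Hypotheses (Hb1 : betti G F 1 b1) (Hb2 : betti G F 2 b2) (le_b : (b2 <= b1)%N).

Let K_cj k : K k -> K (cj t k).
Proof. exact: (ker_cj (@whole_subgroup G) dM I). Qed.

Let sK : is_subgroup K. Proof. exact: ker_on_subgroup. Qed.

(** For a normal subgroup [K] with infinite cyclic quotient generated by [t],
    each homomorphism on [K] yields a cocycle on [G] that vanishes on [K], and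
    it is trivial exactly when the homomorphism lies in the image of [t - 1].
    As [t - 1] has kernel and cokernel of the same dimension, at least
    [b1 - 1], these classes fill up all but at most one dimension of the second
    cohomology. So the restriction to [K] has rank at most one. *)
Lemma restriction_rank_le1 (f1 f2 : G -> G -> F) :
  cocycle_on (@whole G) f1 -> cocycle_on (@whole G) f2 ->
  exists l1 l2 : F, (l1 != 0) || (l2 != 0) /\
    exists u, forall g h, K g -> K h -> l1 * f1 g h + l2 * f2 g h = delta u g h.
Proof.
move=> cf1 cf2; have [n [phi [aphi iphi sphi]]] := homs_basis sep.
(* The matrix of [t - 1] on the homomorphisms from [K]. *)
have [X XE] : exists X : 'M[F]_n, forall i k, K k ->
    phi i (cj t k) - phi i k = \sum_j X i j * phi j k.
  have ex i : exists x : 'rV[F]_n, forall k, K k ->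
      phi i (cj t k) - phi i k = \sum_j x 0 j * phi j k.
    apply: (sphi (fun k => phi i (cj t k) - phi i k)); apply: additiveB => //.
    by move=> g h Kg Kh; rewrite cjM aphi //; exact: K_cj.
  exists (\matrix_(i, j) sval (cid (ex i)) 0 j) => i k Kk.
  by rewrite (svalP (cid (ex i)) k Kk); apply: eq_bigr => j _; rewrite mxE.
have combX (x : 'rV[F]_n) k : K k ->
    \sum_i x 0 i * phi i (cj t k) - \sum_i x 0 i * phi i k
    = \sum_j (x *m X) 0 j * phi j k.
  move=> Kk; rewrite -sumrB.
  under eq_bigr => i _ do rewrite -mulrBr XE // mulr_sumr.
  rewrite exchange_big; apply: eq_bigr => j _; rewrite mxE mulr_suml.
  by apply: eq_bigr => i _; rewrite mulrA.
have [chi [achi ichi]] := betti1_homs Hb1.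
(* The restrictions to [K] of independent homomorphisms on the group. *)
have [C CE] : exists C : 'M[F]_(b1, n), forall i k, K k ->
    chi i k = \sum_j C i j * phi j k.
  have ex i : exists x : 'rV[F]_n, forall k, K k ->
      chi i k = \sum_j x 0 j * phi j k.
    by apply: sphi => g h _ _; exact: achi.
  exists (\matrix_(i, j) sval (cid (ex i)) 0 j) => i k Kk.
  by rewrite (svalP (cid (ex i)) k Kk); apply: eq_bigr => j _; rewrite mxE.
have CX : C *m X = 0.
  apply/row_matrixP => i; rewrite row0; apply: iphi => k Kk.
  rewrite row_mul -combX //.
  have RE k' : K k' -> \sum_j row i C 0 j * phi j k' = chi i k'.
    by move=> Kk'; rewrite CE //; apply: eq_bigr => j _; rewrite mxE.
  rewrite !RE //; last exact: K_cj.
  have ci : chi i (t * k)%g = chi i (cj t k * t)%g by rewrite cj_comm.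
  by move: ci; rewrite !achi // addrC => /addIr <-; rewrite subrr.
(* The restrictions lie in the kernel of [t - 1]; a combination is lost by
   restriction only if it is a multiple of [d], hence the successor. *)
have rX : (b1 <= (n - \rank X).+1)%N.
  have rC : (\rank C <= n - \rank X)%N.
    by rewrite -mxrank_ker; apply/mxrankS/sub_kermxP.
  pose v : 'cV[F]_b1 := \col_i chi i t.
  have kv : (kermx C :&: kermx v)%MS = 0.
    apply/eqP; rewrite -submx0; apply/rV_subP => x.
    rewrite sub_capmx => /andP[/sub_kermxP xC /sub_kermxP xv].
    suff -> : x = 0 by exact: sub0mx.
    apply: ichi; pose h g := \sum_i x 0 i * chi i g.
    have ah : additive_on (@whole G) h by exact: additive_comb.
    have hK k : K k -> h k = 0.
      move=> Kk; rewrite /h; under eq_bigr => i _ do rewrite CE // mulr_sumr.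
      rewrite exchange_big big1 //= => j _.
      under eq_bigr => i _ do rewrite mulrA.
      rewrite -mulr_suml.
      by have := congr1 (fun A : 'rV_n => A 0 j) xC; rewrite !mxE => ->; rewrite mul0r.
    have ht : h t = 0.
      have := congr1 (fun A : 'rV_1 => A 0 0) xv; rewrite !mxE => <-.
      by apply: eq_bigr => i _; rewrite mxE.
    have htz i : h (zpow t i) = 0.
      by rewrite (additive_zpow _ (@whole_subgroup G) ah I) ht mul0rz.
    move=> g; rewrite -/(h g) (kerpartE d t g) ah // htz addr0; apply: hK.
    exact: (kerpart_ker (@whole_subgroup G) dM I dt).
  have := mxrank_mul_ker (kermx C) v; rewrite kv mxrank0 addn0 mxrank_ker => e.
  have := rank_leq_col (kermx C *m v); rewrite e leq_subLR addn1 => h.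
  exact: leq_trans h _.
(* Homomorphisms representing the cokernel of [t - 1]. *)
pose D := row_base (X^C)%MS; pose r := \rank (X^C)%MS.
have Dinj (y : 'rV[F]_r) : (y *m D <= X)%MS -> y = 0.
  move=> yX; have yC : (y *m D <= X^C)%MS.
    by rewrite (submx_trans (submxMl _ _)) // eq_row_base.
  have : (y *m D <= X :&: X^C)%MS by rewrite sub_capmx yX.
  rewrite capmx_compl submx0 mulmx_free_eq0 ?row_base_free //.
  by move/eqP.
pose w0 (_ _ : G) : F := 0.
have cw0 : cocycle_on K w0 by move=> *; rewrite /w0.
have nw0 : normalized_on K w0 by [].
have ex (i : 'I_r) : exists f : G -> G -> F, [/\ cocycle_on (@whole G) f,
    forall x y, K x -> K y -> f x y = 0 &
    forall k, K k -> slant f t k = \sum_j D i j * phi j k].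
  have wb x y : K x -> K y -> \sum_j D i j * phi j (x * y)%g + w0 x y =
    \sum_j D i j * phi j x + \sum_j D i j * phi j y + w0 (cj t x) (cj t y).
    move=> Kx Ky; rewrite /w0 !addr0 -big_split; apply: eq_bigr => j _.
    by rewrite aphi // mulrDr.
  have [f [cf _ fw fs]] := extend_cocycleP (@whole_subgroup G) dM I dt cw0 nw0 wb.
  by exists f; split.
pose c i := sval (cid (ex i)).
pose fs (i : 'I_(r + 2)) : G -> G -> F := match split i with
  inl a => c a | inr b => if b == 0 then f1 else f2 end.
have cfs i : cocycle_on (@whole G) (fs i).
  rewrite /fs; case: (split i) => [a|b]; last by case: ifP.
  by have [] := svalP (cid (ex a)).
have lt_m : (b2 < r + 2)%N.
  rewrite addn2 ltnS; apply: leq_trans le_b _; apply: leq_trans rX _.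
  by rewrite /r mxrank_compl.
(* With [f1] and [f2] there are too many cocycles. If the relation involved
   neither of the two, [u] would be a homomorphism on [K] and the relation
   would hold in the cokernel of [t - 1]. *)
have [x [x0 [u ux]]] := cocycles_dependent p_pr Hb2 lt_m cfs.
pose y := lsubmx x; pose z := rsubmx x.
have E g h : \sum_i y 0 i * c i g h + (z 0 0 * f1 g h + z 0 1 * f2 g h)
    = delta u g h.
  rewrite -ux big_split_ord /=; congr (_ + _).
    apply: eq_bigr => i _; rewrite mxE /fs.
    by case: splitP => j /= ij; [rewrite (ord_inj ij)|have := ltn_ord i; rewrite ij ltnNge leq_addr].
  rewrite big_ord_recl big_ord1 !mxE /fs.
  case: splitP => j /= ij; first by have := ltn_ord j; rewrite -ij ltnNge leq_addr.
  case: splitP => k /= ik; first by have := ltn_ord k; rewrite -ik ltnNge leq_addr.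
  move/addnI: ij => ij; move/addnI: ik => ik.
  have -> : j = 0 by apply: val_inj.
  have -> : k = 1 by apply: val_inj.
  by congr (_ * _ + _ * _); congr (x 0 _); apply: val_inj.
have cK i g h : K g -> K h -> c i g h = 0.
  by move=> Kg Kh; have [_ + _] := svalP (cid (ex i)); apply.
have EK g h : K g -> K h -> z 0 0 * f1 g h + z 0 1 * f2 g h = delta u g h.
  move=> Kg Kh; rewrite -E big1 ?add0r // => i _.
  by rewrite cK // mulr0.
exists (z 0 0), (z 0 1); split; last by exists u.
apply: contraT; rewrite negb_or !negbK => /andP[/eqP z0 /eqP z1].
have au : additive_on K u.
  move=> g h Kg Kh; have := EK g h Kg Kh; rewrite z0 z1 !mul0r addr0 /delta.
  by move=> e; apply: (eq_lincomb e); ring.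
have [U UE] := sphi u au.
case/eqP: x0; rewrite -[x]hsubmxK -/y -/z.
have -> : z = 0.
  apply/rowP => i; rewrite [RHS]mxE; case: (unliftP 0 i) => [j|] -> //.
  by rewrite (ord1 j) -[RHS]z1; congr (z 0 _); apply: val_inj.
have -> : y = 0.
  apply: Dinj; have -> : y *m D = (- U) *m X; last exact: submxMl.
  apply/eqP; rewrite -subr_eq0; apply/eqP; apply: iphi => k Kk.
  have e1 := E t k; have e2 := E (cj t k) t; have e3 := combX U k Kk.
  rewrite z0 z1 !mul0r !addr0 in e1 e2; rewrite /delta cj_comm in e1 e2.
  have e4 : \sum_i y 0 i * c i t k - \sum_i y 0 i * c i (cj t k) t
      = \sum_j (y *m D) 0 j * phi j k.
    rewrite -sumrB; under eq_bigr => i _.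
      rewrite -mulrBr; have [_ _ sl] := svalP (cid (ex i)).
      rewrite -[_ - _]/(slant (c i) t k) sl // mulr_sumr; over.
    rewrite exchange_big; apply: eq_bigr => j _; rewrite [in RHS]mxE mulr_suml.
    by apply: eq_bigr => i _; rewrite mulrA.
  rewrite -!UE // in e3; last exact: K_cj.
  have -> : \sum_i (y *m D - (- U) *m X) 0 i * phi i k
     = \sum_i (y *m D) 0 i * phi i k + \sum_i (U *m X) 0 i * phi i k.
    rewrite -big_split; apply: eq_bigr => i _.
    by rewrite mulNmx opprK mxE mulrDl.
  by apply: (eq_lincomb (subeq (subeq (subeq e1 e2) e4) e3)); ring.
by rewrite row_mx0.
Qed.

End Restriction.

(** * Classes of the group and homomorphisms on the abelian kernel *)

(** The restriction of two-dimensional classes to the kernel of [dy] has rank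
    at most one. *)
Definition rank_le1 (G : groupType) (p : nat) (dy : G -> int) : Prop :=
  forall f1 f2 : G -> G -> 'F_p,
  cocycle_on (@whole G) f1 -> cocycle_on (@whole G) f2 ->
  exists l1 l2 : 'F_p, (l1 != 0) || (l2 != 0) /\
    exists u, forall g h, fker2 dy g -> fker2 dy h ->
      l1 * f1 g h + l2 * f2 g h = delta u g h.

Definition shift (G : groupType) (g a : G) : G := (cj g a * a^-1)%g.

Definition nil_action (G : groupType) (A : set G) : Prop :=
  exists N, forall g a, A a -> iter N (shift g) a = 1%g.

Section OneFrame.
Variables (G : groupType) (dx dy : G -> int) (s t : G) (p : nat).
Hypotheses (fr : frame dx dy s t) (p_pr : prime p).
Local Notation F := 'F_p.
Local Notation A := (fker dx dy).
Local Notation hom := (additive_on A).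
Local Notation c := (fcomm s t).
Implicit Types phi psi al be eta : G -> F.

Hypothesis nilA : nil_action A.

Let sA : is_subgroup A. Proof. exact: fker_subgroup fr. Qed.
Let Acj g a : A a -> A (cj g a). Proof. exact: (fker_cj fr). Qed.

(** [dif g phi] is [(g - 1) phi] for the action of the group on
    homomorphisms. *)
Definition dif g phi a : F := phi (cj g a) - phi a.

Lemma shift_A g a : A a -> A (shift g a).
Proof. by move=> Aa; apply: (subM sA); [exact: Acj|exact: (subV sA)]. Qed.

Lemma hom1 phi : hom phi -> phi 1%g = 0.
Proof.
move=> h; have A1 := sub1 sA; apply: (addrI (phi 1%g)).
by rewrite -h // mulg1 addr0.
Qed.

Lemma homV phi a : hom phi -> A a -> phi a^-1%g = - phi a.
Proof.
move=> h Aa; apply/eqP; rewrite -addr_eq0 -h //; last exact: (subV sA).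
by rewrite mulVg hom1.
Qed.

Lemma hom_cj g phi : hom phi -> hom (fun a => phi (cj g a)).
Proof. by move=> h a b Aa Ab; rewrite cjM h //; exact: Acj. Qed.

Lemma hom_dif g phi : hom phi -> hom (dif g phi).
Proof. by move=> h; apply: additiveB => //; exact: hom_cj. Qed.

Lemma hom_scale (k : F) phi : hom phi -> hom (fun a => k * phi a).
Proof. by move=> h a b Aa Ab; rewrite h // mulrDr. Qed.

Lemma hom_add phi psi : hom phi -> hom psi -> hom (fun a => phi a + psi a).
Proof. by move=> h h' a b Aa Ab; rewrite h // h' // addrACA. Qed.

Lemma hom_opp phi : hom phi -> hom (fun a => - phi a).
Proof. by move=> h a b Aa Ab; rewrite h // opprD. Qed.

Lemma hom0 : hom (fun=> 0 : F).
Proof. by move=> a b _ _; rewrite addr0. Qed.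

Lemma difE g phi a : hom phi -> A a -> dif g phi a = phi (shift g a).
Proof. by move=> h Aa; rewrite /shift h ?homV //; [exact: Acj|exact: (subV sA)]. Qed.

Lemma iter_dif_hom g n phi : hom phi -> hom (iter n (dif g) phi).
Proof. by move=> h; elim: n => //= n IH; exact: hom_dif. Qed.

Lemma iter_difE g n phi a : hom phi -> A a ->
  iter n (dif g) phi a = phi (iter n (shift g) a).
Proof.
move=> h; elim: n a => // n IH a Aa.
rewrite iterS difE //; last exact: iter_dif_hom.
by rewrite IH ?iterSr //; exact: shift_A.
Qed.

(** Unipotence: a homomorphism outside a property [Z] can be moved by powers
    of [g - 1] to one that is outside [Z] while its image lies inside. *)
Lemma dif_last g (Z : (G -> F) -> Prop) phi :
  hom phi -> ~ Z phi -> (forall psi, (forall a, A a -> psi a = 0) -> Z psi) ->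
  exists n, ~ Z (iter n (dif g) phi) /\ Z (iter n.+1 (dif g) phi).
Proof.
move=> h nZ Z0; have [N NE] := nilA.
have ZN : Z (iter N (dif g) phi).
  by apply: Z0 => a Aa; rewrite iter_difE // NE // hom1.
elim: N ZN {NE} => [//|N IH] ZN.
by have [/IH //|nZN] := pselect (Z (iter N (dif g) phi)); exists N.
Qed.

Definition in_im g phi := exists2 eta, hom eta & forall a, A a -> phi a = dif g eta a.

(** The image of the augmentation ideal of the quotient group. *)
Definition in_aug phi := exists al be, [/\ hom al, hom be &
  forall a, A a -> phi a = dif s al a + dif t be a].

Lemma dif_comm phi a : hom phi -> A a -> dif s (dif t phi) a = dif t (dif s phi) a.
Proof. by move=> h Aa; rewrite /dif (cj_s_t fr Aa); ring. Qed.

(** A class that vanishes on the kernel amounts to its slants by [s] and by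
    [t], two homomorphisms; the obstruction to its existence reduces to the
    displayed equation. *)
Lemma hom_class phi eta : hom phi -> hom eta ->
  (forall a, A a -> dif t phi a = dif s eta a) ->
  exists f, [/\ cocycle_on (@whole G) f, forall x y, A x -> A y -> f x y = 0 &
    forall a, A a -> slant f s a = phi a].
Proof.
move=> hp he e; pose w0 (_ _ : G) : F := 0.
have cw : cocycle_on A w0 by [].
have nw : normalized_on A w0 by [].
have wb psi g : hom psi -> forall x y, A x -> A y ->
    psi (x * y)%g + w0 x y = psi x + psi y + w0 (cj g x) (cj g y).
  by move=> h x y Ax Ay; rewrite /w0 !addr0 h.
apply: (extend_two_steps fr cw nw (wb _ s hp) (wb _ t he)) => a Aa.
rewrite /w0 subrr addr0 -addrA; have := e a Aa; rewrite /dif => e'.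
by apply: (eq_lincomb e'); ring.
Qed.

Section Bounded.
Hypothesis rk : rank_le1 p dy.

Lemma slant_delta (u : G -> F) (f : G -> G -> F) (l : F) : cocycle_on (@whole G) f ->
  (forall g h, fker2 dy g -> fker2 dy h -> l * f g h = delta u g h) ->
  forall a, A a -> l * slant f s a = u a - u (cj s a).
Proof.
move=> cf fu a Aa; have Ks := fker2_s fr; have Ka := fker_fker2 Aa.
have Ksa := fker_fker2 (Acj s Aa).
rewrite /slant mulrBr !fu // /delta cj_comm; ring.
Qed.

(** On [fker2 dy] a class vanishing on the kernel is trivial exactly when its
    slant by [s] is in the image of [s - 1]; the bound on the rank therefore
    bounds the invariants of [t] in the cokernel of [s - 1]. *)
Lemma coker_inv_dim_le1 phi1 phi2 eta1 eta2 :
  hom phi1 -> hom phi2 -> hom eta1 -> hom eta2 ->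
  (forall a, A a -> dif t phi1 a = dif s eta1 a) ->
  (forall a, A a -> dif t phi2 a = dif s eta2 a) ->
  exists l1 l2 : F, (l1 != 0) || (l2 != 0) /\
    in_im s (fun a => l1 * phi1 a + l2 * phi2 a).
Proof.
move=> h1 h2 k1 k2 e1 e2.
have [f1 [cf1 f10 f1s]] := hom_class h1 k1 e1.
have [f2 [cf2 f20 f2s]] := hom_class h2 k2 e2.
have [l1 [l2 [l0 [u fu]]]] := rk cf1 cf2.
exists l1, l2; split=> //.
have hu : hom u.
  move=> x y Ax Ay; have := fu x y (fker_fker2 Ax) (fker_fker2 Ay).
  rewrite f10 // f20 // !mulr0 addr0 /delta => e.
  by apply: (eq_lincomb e); ring.
exists (fun a => - u a); first exact: hom_opp.
move=> a Aa; have Ks := fker2_s fr; have Ka := fker_fker2 Aa.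
have Ksa := fker_fker2 (Acj s Aa).
have e3 := fu s a Ks Ka; have e4 := fu _ s Ksa Ks.
rewrite -f1s // -f2s // /slant /dif; rewrite /delta cj_comm in e3 e4.
by apply: (eq_lincomb (subeq e3 e4)); ring.
Qed.

(** As [s - 1] is nilpotent, its cokernel is nonzero as soon as there are
    nonzero homomorphisms; by nilpotency of [t - 1] it then contains a nonzero
    invariant vector of [t]. *)
Lemma aug_proper phi e : hom phi -> A e -> phi e != 0 ->
  exists psi eta, [/\ hom psi, hom eta, ~ in_im s psi &
    forall a, A a -> dif t psi a = dif s eta a].
Proof.
move=> h Ae pe; have [psi hpsi nim] : exists2 psi, hom psi & ~ in_im s psi.
  apply: contrapT => no; have all_im psi : hom psi -> in_im s psi.
    by move=> hp; apply: contrapT => ni; apply: no; exists psi.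
  have [N NE] := nilA.
  have [psi hpsi ps] : exists2 psi, hom psi &
      forall a, A a -> phi a = iter N (dif s) psi a.
    elim: N {NE} => [|N [psi hpsi ps]]; first by exists phi.
    have [eta heta es] := all_im psi hpsi; exists eta => // a Aa.
    rewrite ps // iterSr !iter_difE //; last exact: hom_dif.
    by apply: es; elim: N {ps} => //= N IH; exact: shift_A.
  by move: pe; rewrite ps // iter_difE // NE // hom1 // eqxx.
have [|n [nZ [eta heta es]]] := @dif_last t (in_im s) psi hpsi nim.
  by move=> chi c0; exists (fun=> 0); [exact: hom0|move=> a Aa; rewrite c0 // /dif subrr].
exists (iter n (dif t) psi), eta; split=> //; exact: iter_dif_hom.
Qed.

(** The classes vanishing on the kernel already account for the one dimension
    allowed on [fker2 dy], so every class of the group restricts trivially to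
    the kernel. *)
Lemma cocycle_trivial_on_fker phi e (f : G -> G -> F) : hom phi -> A e -> phi e != 0 ->
  cocycle_on (@whole G) f ->
  exists u, forall x y, A x -> A y -> f x y = delta u x y.
Proof.
move=> h Ae pe cf; have [psi [eta [hpsi heta nim ee]]] := aug_proper h Ae pe.
have [f1 [cf1 f10 f1s]] := hom_class hpsi heta ee.
have [l1 [l2 [l0 [u fu]]]] := rk cf1 cf.
have [l20|l2n] := eqVneq l2 0.
  rewrite l20 eqxx orbF in l0; case: nim.
  exists (fun a => - l1^-1 * u a).
    apply: hom_scale => x y Ax Ay; have := fu x y (fker_fker2 Ax) (fker_fker2 Ay).
    rewrite f10 // l20 mulr0 mul0r addr0 /delta => e'.
    by apply: (eq_lincomb e'); ring.
  move=> a Aa; have fu1 g h' : fker2 dy g -> fker2 dy h' -> l1 * f1 g h' = delta u g h'.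
    by move=> Kg Kh; rewrite -fu // l20 mul0r addr0.
  have := slant_delta cf1 fu1 Aa; rewrite f1s // => e'.
  rewrite -[LHS](mulKf l0) e' /dif; ring.
exists (fun a => l2^-1 * u a) => x y Ax Ay.
have := fu x y (fker_fker2 Ax) (fker_fker2 Ay); rewrite f10 // mulr0 add0r => e'.
by rewrite -[LHS](mulKf l2n) e' /delta; ring.
Qed.

(** For an invariant [phi] and [psi] invariant modulo [phi], the form
    [phi * psi + z * psi * psi] on the kernel is a cocycle whose class is
    invariant in every characteristic: for [z = 1] it is the product of [psi]
    with its translate under [t]. Its alternation is [phi /\ psi], so it cannot
    come from the group, and the obstruction to that is the displayed
    combination of [phi] and [psi]. *)
Lemma pair_obstruction phi psi (z : F) e :
  hom phi -> hom psi -> A e -> phi e != 0 ->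
  ~ (exists k : F, forall a, A a -> psi a = k * phi a) ->
  z * z = z ->
  (forall a, A a -> dif s phi a = 0) -> (forall a, A a -> dif t phi a = 0) ->
  (forall a, A a -> dif s psi a = 0) -> (forall a, A a -> dif t psi a = z * phi a) ->
  ~ in_aug (fun a => (phi c * z - psi c) * phi a + phi c * psi a).
Proof.
move=> hp hq Ae pe ind zz sp tp sq tq [al [be [hal hbe chi]]].
have e_sp a : A a -> phi (cj s a) = phi a by move=> Aa; apply/subr0_eq/sp.
have e_tp a : A a -> phi (cj t a) = phi a by move=> Aa; apply/subr0_eq/tp.
have e_sq a : A a -> psi (cj s a) = psi a by move=> Aa; apply/subr0_eq/sq.
have e_tq a : A a -> psi (cj t a) = psi a + z * phi a.
  by move=> Aa; rewrite -tq // /dif addrC subrK.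
pose w a b := phi a * psi b + z * psi a * psi b.
have cw : cocycle_on A w.
  move=> x y k Ax Ay Ak; rewrite /w !hp // !hq //; ring.
have nw : normalized_on A w.
  by move=> x Ax; rewrite /w !hom1 // !(mulr0, mul0r, addr0).
pose bs a := - be a; pose bt a := z * (phi a * phi a + phi a * psi a) + al a.
have ws x y : A x -> A y ->
    bs (x * y)%g + w x y = bs x + bs y + w (cj s x) (cj s y).
  by move=> Ax Ay; rewrite /bs /w !e_sp // !e_sq // hbe //; ring.
have wt x y : A x -> A y ->
    bt (x * y)%g + w x y = bt x + bt y + w (cj t x) (cj t y).
  move=> Ax Ay; rewrite /bt /w !e_tp // !e_tq // !hp // !hq // hal //.
  rewrite (_ : z * (psi x + z * phi x) * (psi y + z * phi y) = z * psi x * psi y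
    + (z * z) * (phi x * psi y + psi x * phi y) + (z * z) * z * (phi x * phi y)).
    by rewrite !zz; ring.
  ring.
have Ac : A c := fcomm_fker fr.
have ob a : A a -> bs (cj t a) - bs a + bt a - bt (cj s a)
    + (w c (cj s (cj t a)) - w (cj s (cj t a)) c) = 0.
  move=> Aa; have Ata := Acj t Aa; rewrite /bs /bt /w.
  rewrite !e_sp // !e_sq // !e_tp // !e_tq //.
  have := chi a Aa; rewrite /dif => e'.
  by apply: (eq_lincomb e'); ring.
have [f [cf fw _]] := extend_two_steps fr cw nw ws wt ob.
have [u fu] := cocycle_trivial_on_fker hp Ae pe cf.
apply: ind; exists (psi e / phi e) => a Aa.
have := fw a e Aa Ae; have := fw e a Ae Aa; rewrite !fu // /delta.
rewrite (fker_comm fr Aa Ae) /w => e1 e2.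
have e3 : phi e * psi a = phi a * psi e.
  by apply: (eq_lincomb (subeq e2 e1)); ring.
by apply: (mulfI pe); rewrite e3; field.
Qed.

End Bounded.
End OneFrame.

(** * The space of homomorphisms modulo a prime *)

Section ChangeOfBasis.
Variables (G : groupType) (dx dy : G -> int) (s t : G).
Hypothesis fr : frame dx dy s t.

Let dx_sub g := dx g - dy g.
Let dy_sub g := dy g - dx g.

Lemma frame_st : frame dx dy_sub (s * t)%g t.
Proof.
case: fr => xM yM xs ys xt yt ab; split; rewrite /dy_sub ?xM ?yM ?xs ?ys ?xt ?yt //.
  by move=> g h; rewrite xM yM opprD addrACA.
by move=> a b xa ya xb yb; apply: ab => //; [move: ya|move: yb]; rewrite ?xa ?xb subr0.
Qed.

Lemma frame_ts : frame dx_sub dy s (t * s)%g.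
Proof.
case: fr => xM yM xs ys xt yt ab; split; rewrite /dx_sub ?xM ?yM ?xs ?ys ?xt ?yt //.
  by move=> g h; rewrite xM yM opprD addrACA.
by move=> a b xa ya xb yb; apply: ab => //; [move: xa|move: xb]; rewrite ?ya ?yb subr0.
Qed.

Lemma fker_st : fker dx dy_sub = fker dx dy.
Proof.
apply/seteqP; split=> a /fkerP[xa ya]; apply/fkerP; split=> //; move: ya;
  by rewrite /dy_sub xa subr0.
Qed.

Lemma fker_ts : fker dx_sub dy = fker dx dy.
Proof.
apply/seteqP; split=> a /fkerP[xa ya]; apply/fkerP; split=> //; move: xa;
  by rewrite /dx_sub ya subr0.
Qed.

Lemma fcomm_st : fcomm (s * t) t = fcomm s t.
Proof. by rewrite /fcomm /cj; gsimp. Qed.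

Lemma fcomm_ts : fcomm s (t * s) = fcomm s t.
Proof. by rewrite /fcomm /cj; gsimp. Qed.

Variable p : nat.
Implicit Type phi : G -> 'F_p.

Lemma dif_mul g h phi a : dif (g * h)%g phi a = dif g phi (cj h a) + dif h phi a.
Proof. by rewrite /dif -cj_cj addrA subrK. Qed.

Lemma in_aug_st phi : in_aug dx dy s t phi -> in_aug dx dy_sub (s * t)%g t phi.
Proof.
case=> al [be [hal hbe e]]; rewrite /in_aug fker_st.
have h1 := hom_cj fr t^-1 hal.
exists (fun a => al (cj t^-1 a)), (fun a => be a - al (cj t^-1 a)); split=> //.
  exact: additiveB.
move=> a Aa; rewrite e // /dif -cj_cj (cj_s_t fr) // !cjK; ring.
Qed.

Lemma in_aug_ts phi : in_aug dx dy s t phi -> in_aug dx_sub dy s (t * s)%g phi.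
Proof.
case=> al [be [hal hbe e]]; rewrite /in_aug fker_ts.
have h1 := hom_cj fr s^-1 hbe.
exists (fun a => al a - be (cj s^-1 a)), (fun a => be (cj s^-1 a)); split=> //.
  exact: additiveB.
move=> a Aa; rewrite e // /dif -cj_cj -(cj_s_t fr) // !cjK; ring.
Qed.

Lemma in_aug_lin (k l : 'F_p) phi psi : in_aug dx dy s t phi ->
  in_aug dx dy s t psi -> in_aug dx dy s t (fun a => k * phi a + l * psi a).
Proof.
case=> a1 [b1 [ha1 hb1 e1]] [a2 [b2 [ha2 hb2 e2]]].
exists (fun a => k * a1 a + l * a2 a), (fun a => k * b1 a + l * b2 a); split.
- by apply: hom_add; apply: hom_scale.
- by apply: hom_add; apply: hom_scale.
by move=> a Aa; rewrite e1 // e2 // /dif; ring.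
Qed.

Lemma in_aug_ext phi psi : (forall a, fker dx dy a -> phi a = psi a) ->
  in_aug dx dy s t phi -> in_aug dx dy s t psi.
Proof.
by move=> e [al [be [h1 h2 e']]]; exists al, be; split=> // a Aa; rewrite -e // e'.
Qed.

End ChangeOfBasis.

Section ModP.
Variables (G : groupType) (p : nat).
Hypothesis p_pr : prime p.
Local Notation F := 'F_p.
Implicit Types (phi psi : G -> F) (dx dy : G -> int) (s t : G).
Hypothesis rk : forall dx dy s t, frame dx dy s t -> rank_le1 (G := G) p dy.

Section Pair.
Variable A : set G.
(** Replacing [s] by [s * t] changes [x] to [x + y]; after [m] steps it is
    zero, and [pair_obstruction] applies to [y * phi] and [psi] with [z = 1]. *)
Lemma pair_contradiction_nat m dx dy s t phi psi (x y : F) e :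
  nil_action A -> frame dx dy s t -> fker dx dy = A ->
  additive_on A phi -> additive_on A psi -> A e -> phi e != 0 ->
  ~ (exists k : F, forall a, A a -> psi a = k * phi a) ->
  (forall a, A a -> dif s phi a = 0) -> (forall a, A a -> dif t phi a = 0) ->
  (forall a, A a -> dif s psi a = x * phi a) ->
  (forall a, A a -> dif t psi a = y * phi a) ->
  y != 0 -> x + m%:R * y = 0 -> in_aug dx dy s t phi ->
  in_aug dx dy s t psi \/ phi (fcomm s t) = 0 -> False.
Proof.
move=> nilA; elim: m dx dy s t x => [|m IH] dx dy s t x fr EA hp hq Ae pe ind.
all: move=> sp tp sq tq y0 xy wp wq.
  move: xy; rewrite mul0r addr0 => x0; rewrite -EA in hp hq Ae ind sp tp sq tq nilA.
  have hp' := hom_scale y hp.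
  have zz : 1 * 1 = 1 :> F by rewrite mulr1.
  apply: (pair_obstruction fr nilA (rk fr) hp' hq Ae _ _ zz _ _ _ _ _).
  - by rewrite mulf_neq0.
  - by case=> l e'; apply: ind; exists (l * y) => a Aa; rewrite e' // mulrA.
  - by move=> a Aa; have := sp a Aa; rewrite /dif -mulrBr => ->; rewrite mulr0.
  - by move=> a Aa; have := tp a Aa; rewrite /dif -mulrBr => ->; rewrite mulr0.
  - by move=> a Aa; rewrite sq // x0 mul0r.
  - by move=> a Aa; rewrite tq // mul1r.
  case: wq => [wq|c0].
    apply: in_aug_ext (in_aug_lin ((y * phi (fcomm s t) * 1 - psi (fcomm s t)) * y)
      (y * phi (fcomm s t)) wp wq) => a Aa; ring.
  apply: in_aug_ext (in_aug_lin (- psi (fcomm s t) * y) 0 wp wp) => a Aa.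
  by rewrite c0; ring.
have fr' := frame_st fr; have EA' := fker_st dx dy; rewrite EA in EA'.
have hA g a : A a -> A (cj g a) by rewrite -EA; exact: (fker_cj fr).
apply: (IH _ _ _ _ (x + y) fr' EA') => //.
- by move=> a Aa; rewrite dif_mul sp ?tp ?addr0 //; exact: hA.
- move=> a Aa; rewrite dif_mul sq ?tq //; last exact: hA.
  by have /subr0_eq -> := tp a Aa; rewrite mulrDl.
- by rewrite -xy -natr1; ring.
- exact: (in_aug_st fr).
by rewrite fcomm_st; case: wq => [wq|]; [left; exact: (in_aug_st fr)|right].
Qed.

(** All configurations of a pair reduce to the one treated in
    [pair_obstruction] by changing the basis of the quotient. *)
Lemma pair_contradiction dx dy s t phi psi (x y : F) e :
  nil_action A -> frame dx dy s t -> fker dx dy = A ->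
  additive_on A phi -> additive_on A psi -> A e -> phi e != 0 ->
  ~ (exists k : F, forall a, A a -> psi a = k * phi a) ->
  (forall a, A a -> dif s phi a = 0) -> (forall a, A a -> dif t phi a = 0) ->
  (forall a, A a -> dif s psi a = x * phi a) ->
  (forall a, A a -> dif t psi a = y * phi a) ->
  in_aug dx dy s t phi ->
  in_aug dx dy s t psi \/ phi (fcomm s t) = 0 -> False.
Proof.
move=> nilA fr EA hp hq Ae pe ind sp tp sq tq wp wq.
have solve (u v : F) : v != 0 -> exists m : nat, u + m%:R * v = 0.
  by move=> v0; exists (- u / v : F); rewrite natr_Zp divfK // addrN.
have [y0|y0] := eqVneq y 0; last first.
  have [m xy] := solve x y y0.
  exact: (pair_contradiction_nat nilA fr EA hp hq Ae pe ind sp tp sq tq y0 xy).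
have [x0|x0] := eqVneq x 0.
  rewrite -EA in hp hq Ae ind sp tp sq tq nilA.
  have zz : 0 * 0 = 0 :> F by rewrite mulr0.
  apply: (pair_obstruction fr nilA (rk fr) hp hq Ae pe ind zz sp tp _ _ _).
  - by move=> a Aa; rewrite sq // x0 mul0r.
  - by move=> a Aa; rewrite tq // y0 mul0r.
  case: wq => [wq|c0].
    apply: in_aug_ext (in_aug_lin (- psi (fcomm s t)) (phi (fcomm s t)) wp wq) => a Aa.
    ring.
  apply: in_aug_ext (in_aug_lin (- psi (fcomm s t)) 0 wp wp) => a Aa.
  by rewrite c0; ring.
have hA g a : A a -> A (cj g a) by rewrite -EA; exact: (fker_cj fr).
have fr' := frame_ts fr; have EA' := fker_ts dx dy; rewrite EA in EA'.
have [m xy] := solve x x x0.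
apply: (pair_contradiction_nat nilA fr' EA' hp hq Ae pe ind sp _ sq _ x0 xy).
- by move=> a Aa; rewrite dif_mul tp ?sp ?addr0 //; exact: hA.
- by move=> a Aa; rewrite dif_mul tq ?sq // ?y0 ?mul0r ?add0r //; exact: hA.
- exact: (in_aug_ts fr).
by rewrite fcomm_ts; case: wq => [wq|]; [left; exact: (in_aug_ts fr)|right].
Qed.

End Pair.

Section Classification.
Variables (dx dy : G -> int) (s t : G).
Hypothesis fr : frame dx dy s t.
Local Notation A := (fker dx dy).
Local Notation hom := (additive_on A).
Local Notation c := (fcomm s t).
Hypothesis nilA : nil_action A.

Let Acj g a : A a -> A (cj g a). Proof. exact: (fker_cj fr). Qed.

Definition proportional phi psi := exists k : F, forall a, A a -> psi a = k * phi a.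

Lemma in_aug_s phi : hom phi -> in_aug dx dy s t (dif s phi).
Proof.
move=> h; exists phi, (fun=> 0); split=> //; first exact: hom0.
by move=> a Aa; rewrite /dif subrr addr0.
Qed.

Lemma in_aug_t phi : hom phi -> in_aug dx dy s t (dif t phi).
Proof.
move=> h; exists (fun=> 0), phi; split=> //; first exact: hom0.
by move=> a Aa; rewrite /dif subrr add0r.
Qed.

Lemma hom_in_aug phi : in_aug dx dy s t phi -> hom phi.
Proof.
case=> al [be [h1 h2 e]] a b Aa Ab; rewrite !e //; last first.
  exact: (subM (fker_subgroup fr)).
by rewrite (hom_dif fr s h1) // (hom_dif fr t h2) // addrACA.
Qed.

(** A nonzero vector fixed modulo an invariant submodule, reached by
    successive applications of [s - 1] and [t - 1]. *)
Lemma aug_fixed_vector (Z : (G -> F) -> Prop) chi :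
  (forall phi psi, (forall a, A a -> phi a = psi a) -> Z phi -> Z psi) ->
  (forall phi, (forall a, A a -> phi a = 0) -> Z phi) ->
  (forall phi, Z phi -> Z (dif t phi)) ->
  in_aug dx dy s t chi -> ~ Z chi ->
  exists psi, [/\ in_aug dx dy s t psi, ~ Z psi, Z (dif s psi) & Z (dif t psi)].
Proof.
move=> Ze Z0 Zt wc nZ; have hc := hom_in_aug wc.
have [n [n1 n2]] := dif_last fr nilA s hc nZ Z0.
set psi1 := iter n (dif s) chi in n1.
have h1 : hom psi1 by exact: (iter_dif_hom fr).
have w1 : in_aug dx dy s t psi1.
  by rewrite /psi1; case: (n) => // k; apply: in_aug_s; exact: (iter_dif_hom fr).
have [m [m1 m2]] := dif_last fr nilA t h1 n1 Z0.
exists (iter m (dif t) psi1); split=> //.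
  by case: (m) => // k; apply: in_aug_t; exact: (iter_dif_hom fr).
elim: (m) => [//|k IH] /=; apply: Ze (Zt _ IH) => a Aa.
by rewrite (dif_comm fr) //; exact: (iter_dif_hom fr).
Qed.

(** A vector of the augmentation image outside the line of [phi] could be moved
    to one invariant modulo that line, against [pair_contradiction]. *)
Lemma aug_line phi e chi : hom phi -> A e -> phi e != 0 ->
  (forall a, A a -> dif s phi a = 0) -> (forall a, A a -> dif t phi a = 0) ->
  in_aug dx dy s t phi -> in_aug dx dy s t chi -> proportional phi chi.
Proof.
move=> hp Ae pe sp tp wp wc; apply: contrapT => nZ.
have [|||psi [wq nq sq tq]] := aug_fixed_vector (Z := proportional phi) _ _ _ wc nZ.
- by move=> f g fg [k fE]; exists k => a Aa; rewrite -fg // fE.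
- by move=> f f0; exists 0 => a Aa; rewrite f0 // mul0r.
- move=> f [k fE]; exists 0 => a Aa; rewrite mul0r /dif !fE //; last exact: Acj.
  by have := tp a Aa; rewrite /dif -mulrBr => ->; rewrite mulr0.
case: sq => x sq; case: tq => y tq.
exact: (pair_contradiction nilA fr erefl hp (hom_in_aug wq) Ae pe nq sp tp sq tq wp
  (or_introl wq)).
Qed.

(** The possible spaces of homomorphisms from the kernel to the prime field:
    a line, or a plane on which the action is nontrivial and whose fixed line
    does not vanish on the commutator of [s] and [t]. *)
Lemma homs_mod_p :
  (exists2 phi : G -> F, hom phi & forall psi, hom psi -> proportional phi psi) \/
  (exists (phi psi : G -> F) (x y : F), [/\ hom phi /\ hom psi,
    forall a, A a -> dif s phi a = 0 /\ dif t phi a = 0,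
    forall a, A a -> dif s psi a = x * phi a /\ dif t psi a = y * phi a,
    ((x != 0) || (y != 0)) /\ phi c != 0 &
    forall eta, hom eta -> exists k l : F, forall a, A a ->
      eta a = k * phi a + l * psi a]).
Proof.
(* If the action is trivial, all homomorphisms are invariants of [t] in the
   cokernel of [s - 1], and there is at most a line of them. *)
have [[chi [wc nc]]|triv] := pselect
  (exists chi : G -> F, in_aug dx dy s t chi /\ ~ (forall a, A a -> chi a = 0)); last first.
  have triv' (chi : G -> F) a : in_aug dx dy s t chi -> A a -> chi a = 0.
    move=> wc Aa; apply: contrapT => n0; apply: triv; exists chi.
    by split=> // /(_ a Aa).
  left; have [[phi [hp [e Ae pe]]]|no] := pselect
    (exists phi : G -> F, hom phi /\ exists2 e, A e & phi e <> 0); last first.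
    exists (fun=> 0); first exact: hom0.
    move=> psi hq; exists 0 => a Aa; rewrite mul0r; apply: contrapT => n0.
    by apply: no; exists psi; split=> //; exists a.
  exists phi => // psi hq.
  have z (f : G -> F) : hom f -> forall a, A a -> dif t f a = dif s (fun=> 0) a.
    by move=> h a Aa; rewrite [RHS]/dif subrr (triv' _ _ (in_aug_t h)).
  have [l1 [l2 [l0 [eta heta el]]]] :=
    coker_inv_dim_le1 fr (rk fr) hp hq (@hom0 _ dx dy p) (@hom0 _ dx dy p) (z _ hp) (z _ hq).
  have el' a : A a -> l1 * phi a + l2 * psi a = 0.
    by move=> Aa; rewrite el // (triv' _ _ (in_aug_s heta)).
  have [l20|l2n] := eqVneq l2 0.
    rewrite l20 eqxx orbF in l0; have := el' e Ae; rewrite l20 mul0r addr0 => /eqP.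
    by rewrite mulf_eq0 (negPf l0) => /eqP.
  exists (- l1 / l2) => a Aa; apply: (mulfI l2n).
  by apply: (eq_lincomb (el' a Aa)); field.
(* Otherwise the augmentation image is the line of an invariant [phi]. *)
right; pose Z (f : G -> F) := forall a, A a -> f a = 0.
have [|||phi [wp nphi sp tp]] := @aug_fixed_vector Z chi _ _ _ wc nc.
- by move=> f g fg f0 a Aa; rewrite -fg // f0.
- by [].
- by move=> f f0 a Aa; rewrite /dif !f0 ?subrr //; exact: Acj.
have hp := hom_in_aug wp.
have [e [Ae /eqP pe]] : exists e, A e /\ phi e <> 0.
  apply: contrapT => no; apply: nphi => a Aa; apply: contrapT => n0.
  by apply: no; exists a.
have line (f : G -> F) : in_aug dx dy s t f -> proportional phi f.
  by move=> wf; exact: (aug_line hp Ae pe sp tp wp wf).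
suff [psi [x [y [hq sq tq xy sp2]]]] : exists (psi : G -> F) (x y : F), [/\ hom psi,
    forall a, A a -> dif s psi a = x * phi a,
    forall a, A a -> dif t psi a = y * phi a, (x != 0) || (y != 0) &
    forall eta, hom eta -> exists k l : F, forall a, A a ->
      eta a = k * phi a + l * psi a].
  exists phi, psi, x, y; split=> //.
  - by move=> a Aa; rewrite sp // tp.
  - by move=> a Aa; rewrite sq // tq.
  split=> //; apply/eqP => c0.
  apply: (pair_contradiction nilA fr erefl hp hq Ae pe _ sp tp sq tq wp (or_intror c0)).
  case=> k qk; have [z z0 zq] : exists2 z : F, z != 0 &
      forall a, A a -> dif s psi a = z * phi a \/ dif t psi a = z * phi a.
    by case/orP: xy => n; [exists x|exists y] => // a Aa; [left|right]; auto.
  have d0 g : (forall a, A a -> dif g phi a = 0) -> dif g psi e = 0.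
    move=> g0; rewrite /dif !qk //; last exact: Acj.
    by rewrite -mulrBr -/(dif g phi e) g0 // mulr0.
  by case: (zq e Ae) => eq; move: (mulf_neq0 z0 pe); rewrite -eq d0 ?eqxx.
(* If [s - 1] is nonzero, its image is the line of [phi], and every
   homomorphism is an invariant of [t] in the cokernel. *)
have [[eta [heta [b [Ab nb]]]]|noS] := pselect
  (exists eta : G -> F, hom eta /\ exists b, A b /\ dif s eta b <> 0).
  have [x sx] := line _ (in_aug_s heta); have [y ty] := line _ (in_aug_t heta).
  have x0 : x != 0 by apply/eqP => x0; apply: nb; rewrite sx // x0 mul0r.
  exists eta, x, y; rewrite x0; split=> // psi hq.
  have imS (f : G -> F) (z : F) : (forall a, A a -> dif t f a = z * phi a) ->
      forall a, A a -> dif t f a = dif s (fun a => (z / x) * eta a) a.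
    move=> fz a Aa; rewrite fz // [RHS]/dif -mulrBr -/(dif s eta a) sx //.
    by field.
  have [z tz] := line _ (in_aug_t hq).
  have [l1 [l2 [l0 [zeta hz el]]]] := coker_inv_dim_le1 fr (rk fr) heta hq
    (hom_scale _ heta) (hom_scale _ heta) (imS _ _ ty) (imS _ _ tz).
  have [w zw] := line _ (in_aug_s hz).
  have el' a : A a -> l1 * eta a + l2 * psi a = w * phi a by move=> Aa; rewrite el // zw.
  have [l20|l2n] := eqVneq l2 0.
    rewrite l20 eqxx orbF in l0; case: nb; apply: (mulfI l0).
    have := el' _ (Acj s Ab); have := el' b Ab; have := sp b Ab.
    rewrite l20 !mul0r !addr0 /dif => e1 e2 e3; rewrite mulr0 mulrBr e3 e2 -mulrBr e1.
    by rewrite mulr0.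
  exists (w / l2), (- l1 / l2) => a Aa; apply: (mulfI l2n).
  by apply: (eq_lincomb (el' a Aa)); field.
(* If [s - 1] vanishes, [phi] is in the image of [t - 1], and the invariants of
   [t] are at most a line. *)
have S0 (eta : G -> F) a : hom eta -> A a -> dif s eta a = 0.
  by move=> h Aa; apply: contrapT => n0; apply: noS; exists eta; split=> //; exists a.
have [al [be [hal hbe ab]]] := wp.
have tbe a : A a -> dif t be a = 1 * phi a.
  by move=> Aa; rewrite ab // S0 // add0r mul1r.
exists be, 0, 1; rewrite oner_eq0 orbT; split=> //.
  by move=> a Aa; rewrite S0 // mul0r.
move=> psi hq; have [k tk] := line _ (in_aug_t hq).
have hd : hom (fun a => psi a - k * be a) by apply: additiveB => //; exact: hom_scale.
have z1 a : A a -> dif t phi a = dif s (fun=> 0) a.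
  by move=> Aa; rewrite tp // /dif subrr.
have z2 a : A a -> dif t (fun a => psi a - k * be a) a = dif s (fun=> 0) a.
  move=> Aa; have := tk a Aa; have := tbe a Aa; rewrite /dif subrr => e1 e2.
  have e3 := addeq e2 (esym (congr1 (fun v => k * v) e1)).
  by apply: (eq_lincomb e3); ring.
have [l1 [l2 [l0 [zeta hz el]]]] := coker_inv_dim_le1 fr (rk fr) hp hd
  (@hom0 _ dx dy p) (@hom0 _ dx dy p) z1 z2.
have el' a : A a -> l1 * phi a + l2 * (psi a - k * be a) = 0.
  by move=> Aa; rewrite el // S0.
have [l20|l2n] := eqVneq l2 0.
  rewrite l20 eqxx orbF in l0; have := el' e Ae; rewrite l20 mul0r addr0 => /eqP.
  by rewrite mulf_eq0 (negPf l0) (negPf pe).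
exists (- l1 / l2), k => a Aa; apply: (mulfI l2n).
by apply: (eq_lincomb (el' a Aa)); field.
Qed.

End Classification.
End ModP.

(** * Finitely generated abelian groups *)

Lemma Fp_int_eq0 p (k : int) : prime p -> (k%:~R == 0 :> 'F_p) = (p %| `|k|)%N.
Proof.
move=> pp; case: k => n; rewrite ?NegzE ?mulrNz ?oppr_eq0 -?pmulrn.
  by rewrite (dvdn_pcharf (pchar_Fp pp)).
by rewrite abszN (dvdn_pcharf (pchar_Fp pp)).
Qed.

Section FinGen.
Variable V : zmodType.
Implicit Types (v e : V) (es : seq V) (H : set V).

Fixpoint zspan es v : Prop :=
  if es is e :: es' then exists k : int, zspan es' (v - e *~ k) else v = 0.

Lemma subclosedMz H e k : subclosed H -> H e -> H (e *~ k).
Proof.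
move=> sH He; case: k => n; first exact: subclosedMn.
by rewrite NegzE mulrNz; apply: subclosedN => //; exact: subclosedMn.
Qed.

Lemma zspan_sub H es v : subclosed H -> (forall e, e \in es -> H e) ->
  zspan es v -> H v.
Proof.
move=> sH; elim: es v => [|e es IH] v He /=; first by move=> ->; exact: (proj1 sH).
case=> k /IH h; rewrite -(subrK (e *~ k) v); apply: subclosedD => //.
  by apply: h => x xes; apply: He; rewrite inE xes orbT.
by apply: subclosedMz => //; apply: He; rewrite inE eqxx.
Qed.

Definition addcyc H e : set V := [set v | exists k : int, H (v - e *~ k)].

Lemma addcyc_subclosed H e : subclosed H -> subclosed (addcyc H e).
Proof.
move=> sH; split; first by exists 0; rewrite subr0; exact: (proj1 sH).
move=> a b [k Ha] [l Hb]; exists (k - l).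
have -> : a - b - e *~ (k - l) = (a - e *~ k) - (b - e *~ l).
  by rewrite mulrzBr !opprB addrACA [RHS]addrACA; congr (_ + _); rewrite addrC.
exact: (proj2 sH).
Qed.

Lemma addcyc_sub H e v : H v -> addcyc H e v.
Proof. by exists 0; rewrite subr0. Qed.

Lemma int_subgroup_order H e : subclosed H ->
  (forall k : int, H (e *~ k) -> k = 0) \/
  exists2 d : nat, (0 < d)%N & forall k : int, H (e *~ k) <-> (d %| `|k|)%N.
Proof.
move=> sH; have [[n [n0 Hn]]|no] := pselect (exists n, (0 < n)%N /\ H (e *+ n)); last first.
  left=> k Hk; apply/eqP; rewrite -absz_eq0 -leqn0 leqNgt; apply/negP => k0.
  apply: no; exists `|k|%N; split=> //.
  case: k Hk {k0} => m //; rewrite NegzE mulrNz => /(subclosedN sH).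
  by rewrite opprK abszN.
right; have ex : exists n, (0 < n)%N && `[< H (e *+ n) >].
  by exists n; rewrite n0; apply/asboolP.
case: (ex_minnP ex) => d /andP[d0 /asboolP Hd] dmin; exists d => // k.
have red m : H (e *+ m) <-> (d %| m)%N.
  split=> [Hm|/dvdnP[q ->]]; last first.
    by rewrite mulnC mulrnA; exact: subclosedMn.
  rewrite /dvdn; apply: contraT => r0; have : (d <= m %% d)%N.
    apply: dmin; rewrite lt0n r0 /=; apply/asboolP.
    have := (proj2 sH) _ _ Hm (subclosedMn (m %/ d) sH Hd).
    by rewrite -mulrnA mulnC {1}(divn_eq m d) mulrnDr addrC addKr.
  by rewrite leqNgt ltn_mod d0.
case: k => m; first exact: red.
rewrite NegzE mulrNz abszN /= -red; split=> h; last exact: subclosedN.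
by rewrite -[_ *+ _]opprK; exact: subclosedN.
Qed.

(** A proper subgroup of a finitely generated abelian group lies in the kernel
    of a nonzero homomorphism to some prime field. Adding the generators one
    at a time, it suffices to treat the last proper step, which has a
    nontrivial cyclic quotient. *)
Lemma fg_separate es H : (forall v, zspan es v) -> subclosed H ->
  ~ (forall v, H v) ->
  exists p : nat, prime p /\ exists phi : V -> 'F_p,
    [/\ {morph phi : a b / a + b >-> a + b}, forall v, H v -> phi v = 0 &
        exists v, phi v != 0].
Proof.
move=> gen sH pH; have {}gen : forall v, exists2 h, H h & zspan es (v - h).
  by move=> v; exists 0; [exact: (proj1 sH)|rewrite subr0].
elim: es H sH pH gen => [|e es IH] H sH pH gen.
  case: pH => v; have [h Hh /eqP] := gen v.
  by rewrite subr_eq0 => /eqP ->.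
have sH1 := addcyc_subclosed e sH.
have [all1|pH1] := pselect (forall v, addcyc H e v); last first.
  have [|p [pp [phi [ph1 ph2 ph3]]]] := IH _ sH1 pH1.
    move=> v; have [h Hh [k zk]] := gen v; exists (h + e *~ k).
      by exists k; rewrite addrK.
    by rewrite opprD addrA.
  exists p; split=> //; exists phi; split=> // v Hv.
  by apply: ph2; exact: addcyc_sub.
have [p [pp pk]] : exists p, prime p /\ forall k, H (e *~ k) -> (p %| `|k|)%N.
  case: (int_subgroup_order e sH) => [k0|[d d0 dk]].
    by exists 2%N; split=> // k /k0 ->.
  exists (pdiv d); split; last by move=> k /dk; apply: dvdn_trans; exact: pdiv_dvd.
  apply: pdiv_prime; rewrite ltn_neqAle d0 andbT; apply/eqP => d1; apply: pH => v.
  have [k Hk] := all1 v; rewrite -(subrK (e *~ k) v); apply: subclosedD => //.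
  by apply/dk; rewrite -d1 dvd1n.
exists p; split=> //; pose phi v : 'F_p := (sval (cid (all1 v)))%:~R.
have phiE v k : H (v - e *~ k) -> phi v = k%:~R.
  move=> Hk; rewrite /phi; case: cid => l /= Hl.
  have : H (e *~ (k - l)).
    have := (proj2 sH) _ _ Hl Hk; rewrite mulrzBr.
    by rewrite opprB addrC addrA subrK.
  by move=> /pk; rewrite -Fp_int_eq0 // intrB subr_eq0 => /eqP.
exists phi; split.
- move=> a b; have [k Hk] := all1 a; have [l Hl] := all1 b.
  rewrite (phiE a k) // (phiE b l) // -intrD; apply: phiE.
  by rewrite mulrzDr opprD addrACA; exact: subclosedD.
- by move=> v Hv; rewrite (phiE v 0) // subr0.
exists e; rewrite (phiE e 1) ?oner_eq0 //.
by rewrite mulr1z subrr; exact: (proj1 sH).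
Qed.

Lemma mulrn_gcd v m n : (0 < m)%N -> v *+ m = 0 -> v *+ n = 0 -> v *+ gcdn m n = 0.
Proof.
move=> m0 vm vn; case: (egcdnP n m0) => a b e _.
have : v *+ (a * m) = v *+ (b * n + gcdn m n) by rewrite e.
by rewrite mulnC mulrnA vm mul0rn mulrnDr mulnC mulrnA vn mul0rn add0r.
Qed.

(** Adding the generators one at a time: a generator of order [d] modulo the
    subgroup spanned so far raises the exponent of the [p]-torsion at most by
    the [p]-part of [d], and a generator of infinite order leaves it. *)
Lemma fg_torsion_bound es p : prime p -> (forall v, zspan es v) ->
  exists E, forall v m, v *+ p ^ m = 0 -> v *+ p ^ E = 0.
Proof.
move=> pp gen; pose bounded H := exists E, forall v m, H v ->
  v *+ p ^ m = 0 -> v *+ p ^ E = 0.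
suff key H : subclosed H -> bounded H ->
    (forall v, exists2 h, H h & zspan es (v - h)) -> bounded setT.
  have [|||E hE] := key [set 0]; last by exists E => v m; exact: hE.
  - by split=> // _ _ -> ->; rewrite subrr.
  - by exists 0%N => v m ->; rewrite mul0rn.
  - by move=> v; exists 0 => //; rewrite subr0.
elim: es H {gen} => [|e es IH] H sH [E bH] gen.
  exists E => v m _; apply: bH; have [h Hh /eqP] := gen v.
  by rewrite subr_eq0 => /eqP ->.
apply: (IH (addcyc H e)); first exact: addcyc_subclosed.
  case: (int_subgroup_order e sH) => [k0|[d d0 dk]].
    exists E => v m [k Hk] vm; apply: (bH _ m) => //.
    have : H (e *~ (k * (p ^ m)%:Z)).
      have := subclosedN sH (subclosedMn (p ^ m) sH Hk).
      by rewrite mulrnBl vm sub0r opprK mulrzA.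
    move=> /k0/eqP; rewrite mulf_eq0 => /orP[/eqP kk|].
      by rewrite kk subr0 in Hk.
    by rewrite eqz_nat expn_eq0 (gtn_eqF (prime_gt0 pp)).
  exists (logn p d + E)%N => v m [k Hk] vm.
  have Hd : H (v *+ d).
    rewrite -(subrK (e *~ k *+ d) (v *+ d)) -mulrnBl; apply: subclosedD => //.
      exact: subclosedMn.
    by rewrite pmulrn -mulrzA; apply/dk; rewrite abszM dvdn_mull.
  have vdE : v *+ (d * p ^ E) = 0.
    by rewrite mulrnA; apply: (bH _ m) => //; rewrite -mulrnA mulnC mulrnA vm mul0rn.
  have := mulrn_gcd _ vm vdE; rewrite expn_gt0 prime_gt0 // => /(_ isT).
  case/(dvdn_pfactor _ _ pp): (dvdn_gcdl (p ^ m) (d * p ^ E)) => j _ gj.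
  have : (p ^ j %| d * p ^ E)%N by rewrite -gj dvdn_gcdr.
  have lg : logn p (d * p ^ E) = (logn p d + E)%N.
    by rewrite lognM ?pfactorK // expn_gt0 prime_gt0.
  rewrite pfactor_dvdn ?muln_gt0 ?d0 ?expn_gt0 ?prime_gt0 // lg => le.
  by rewrite gj => v0; rewrite -(subnKC le) expnD mulrnA v0 mul0rn.
move=> v; have [h Hh [k zk]] := gen v; exists (h + e *~ k).
  by exists k; rewrite addrK.
by rewrite opprD addrA.
Qed.

Definition torsion_free := forall v (k : int), v *~ k = 0 -> v = 0 \/ k = 0.

Definition spanning n (e : 'I_n -> V) :=
  forall v, exists x : 'I_n -> int, v = \sum_i e i *~ x i.

Lemma zspan_spanning es : (forall v, zspan es v) ->
  exists n (e : 'I_n -> V), spanning e.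
Proof.
move=> gen; exists (size es), (fun i => tnth (in_tuple es) i) => v.
have {gen} := gen v; elim: es v => [|e es IH] v /=.
  by move=> ->; exists (fun=> 0); rewrite big_ord0.
case=> k /IH[x xE]; exists (fun i => if unlift ord0 i is Some j then x j else k).
rewrite big_ord_recl unlift_none -(subrK (e *~ k) v) addrC {1}xE; congr (_ + _).
by apply: eq_bigr => i _; rewrite liftK !(tnth_nth 0).
Qed.

(** A generating family of least size is a basis: among its relations and the
    relations of families obtained from it by elementary operations, one of
    least total size involves a single generator, which is then zero. *)
Lemma torsion_free_basis es : torsion_free -> (forall v, zspan es v) ->
  exists n (e : 'I_n -> V), spanning e /\
    forall x : 'I_n -> int, \sum_i e i *~ x i = 0 -> forall i, x i = 0.
Proof.
move=> tf /zspan_spanning[n0 [e0 sp0]].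
have ex : exists n, `[< exists e : 'I_n -> V, spanning e >].
  by exists n0; apply/asboolP; exists e0.
case: (ex_minnP ex) => n /asboolP[e sp] nmin; exists n, e; split=> // x xr.
apply: contrapT => nz.
pose R m := `[< exists (e : 'I_n -> V) (x : 'I_n -> int), [/\ spanning e,
  \sum_i e i *~ x i = 0, exists i, x i <> 0 & (\sum_i `|x i| = m)%N] >].
have exR : exists m, R m.
  exists (\sum_i `|x i|)%N; apply/asboolP; exists e, x; split=> //.
  by apply: contrapT => no; apply: nz => i; apply: contrapT => ni; apply: no; exists i.
case: (ex_minnP exR) => m /asboolP[{}e [{}x [{}sp {}xr [i ni] sm]]] mmin {nz exR ex e0 sp0}.
have [[j [ji nj]]|single] := pselect (exists j, j != i /\ x j <> 0).
  wlog le : i j ni nj ji / (`|x j| <= `|x i|)%N.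
    move=> W; case: (leqP `|x j| `|x i|) => [|/ltnW] h; first exact: (W i j).
    by apply: (W j i) => //; rewrite eq_sym.
  pose sg : int := if (0 <= x i) == (0 <= x j) then 1 else -1.
  have sg2 : sg * sg = 1 by rewrite /sg; case: ifP.
  pose e' k := if k == j then e j + e i *~ sg else e k.
  pose x' k : int := if k == i then x i - sg * x j else x k.
  have lt : (absz (x i - sg * x j)%R < `|x i|)%N.
    by move: le ni nj; rewrite /sg; case: (x i) => u; case: (x j) => v; rewrite /=; lia.
  have split2 (f : 'I_n -> V) : \sum_k f k = f i + (f j + \sum_(k | (k != i) && (k != j)) f k).
    by rewrite (bigD1 i) //= (bigD1 j).
  have same (y z : 'I_n -> int) (g h : 'I_n -> V) :
      (forall k, k != i -> k != j -> g k *~ y k = h k *~ z k) ->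
      g i *~ y i + g j *~ y j = h i *~ z i + h j *~ z j ->
      \sum_k g k *~ y k = \sum_k h k *~ z k.
    move=> e1 e2; rewrite !split2 !addrA e2; congr (_ + _).
    by apply: eq_bigr => k /andP[]; exact: e1.
  have elem (a b : V) (u v : int) :
      a *~ u + b *~ v = a *~ (u - sg * v) + (b + a *~ sg) *~ v.
    by rewrite mulrzBr mulrzDl -mulrzA [b *~ v + _]addrC addrA subrK.
  have ij : (i == j) = false by rewrite eq_sym (negPf ji).
  have : (m <= \sum_k `|x' k|)%N.
    apply: mmin; apply/asboolP; exists e', x'; split=> //.
    - move=> v; have [y yE] := sp v.
      exists (fun k => if k == i then y i - sg * y j else y k); rewrite yE.
      apply: same; rewrite /e'.
        by move=> k /negPf -> /negPf ->.
      by rewrite !eqxx ij (negPf ji); exact: elem.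
    - rewrite -[RHS]xr; apply/esym; apply: same; rewrite /e' /x'.
        by move=> k /negPf -> /negPf ->.
      by rewrite !eqxx ij (negPf ji); exact: elem.
    - by exists j; rewrite /x' (negPf ji).
  have -> : (\sum_k `|x' k| = absz (x i - sg * x j)%R + \sum_(k | k != i) `|x k|)%N.
    rewrite (bigD1 i) //= {1}/x' eqxx; congr (_ + _)%N.
    by apply: eq_bigr => k /negPf ki; rewrite /x' ki.
  by rewrite -sm (bigD1 i) //= leq_add2r leqNgt lt.
have x0 k : k != i -> x k = 0.
  by move=> ki; apply: contrapT => nk; apply: single; exists k.
have : e i *~ x i = 0.
  rewrite -xr (bigD1 i) //= big1 ?addr0 // => k ki.
  by rewrite x0.
move=> /tf[ei|//]; case: n e x i sp xr ni ei x0 nmin {mmin sm single R} => [|n] e x i.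
  by case: i.
move=> sp _ _ ei _ nmin; have : (n.+1 <= n)%N; last by rewrite ltnn.
apply: nmin; apply/asboolP; exists (fun k => e (lift i k)) => v.
have [y yE] := sp v; exists (fun k => y (lift i k)).
by rewrite yE (bigD1_ord i) //= ei mul0rz add0r.
Qed.

End FinGen.

(** * Extensions of a cyclic unipotent module with torsion *)

Section MorphZ.
Variables (V W : zmodType) (f : V -> W).
Hypothesis fD : {morph f : a b / a + b}.
Lemma morph0 : f 0 = 0.
Proof. by apply: (addrI (f 0)); rewrite -fD !addr0. Qed.
Lemma morphN a : f (- a) = - f a.
Proof. by apply/eqP; rewrite -addr_eq0 -fD addNr morph0. Qed.
Lemma morphB a b : f (a - b) = f a - f b.
Proof. by rewrite fD morphN. Qed.
Lemma morphMn a n : f (a *+ n) = f a *+ n.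
Proof. by elim: n => [|n IH]; rewrite ?morph0 // !mulrS fD IH. Qed.
Lemma morphMz a k : f (a *~ k) = f a *~ k.
Proof. by case: k => n; rewrite ?NegzE ?mulrNz ?morphN -?pmulrn morphMn. Qed.
End MorphZ.

Section CyclicModule.
Variables (V : zmodType) (U : V -> V) (e0 : V).
Hypothesis UD : {morph U : a b / a + b}.

(** The map from polynomials onto the module generated by [e0] under [U]. *)
Definition poly_act (f : {poly int}) : V := \sum_(i < size f) iter i U e0 *~ f`_i.

Lemma poly_actE n (f : {poly int}) : (size f <= n)%N ->
  poly_act f = \sum_(i < n) iter i U e0 *~ f`_i.
Proof.
move=> le; rewrite /poly_act (big_ord_widen n (fun i => iter i U e0 *~ f`_i)) //.
rewrite big_mkcond; apply: eq_bigr => i _; case: ltnP => // h.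
by rewrite nth_default // mulr0z.
Qed.

Lemma poly_actD : {morph poly_act : f g / f + g}.
Proof.
move=> f g; pose n := maxn (size f) (size g).
rewrite (@poly_actE n f) ?leq_maxl // (@poly_actE n g) ?leq_maxr //.
rewrite (@poly_actE n) ?size_polyD // -big_split; apply: eq_bigr => i _.
by rewrite coefD mulrzDr.
Qed.

Lemma poly_actX f : poly_act ('X * f) = U (poly_act f).
Proof.
rewrite (@poly_actE (size f).+1); last first.
  by rewrite mulrC; apply: leq_trans (size_polyMleq _ _) _; rewrite size_polyX addn2.
rewrite big_ord_recl coefXM eqxx mulr0z add0r /poly_act.
rewrite (big_morph U UD (morph0 UD)); apply: eq_bigr => i _.
by rewrite coefXM /= (morphMz UD).
Qed.

Lemma poly_actC c : poly_act c%:P = e0 *~ c.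
Proof.
by rewrite (@poly_actE 1) ?size_polyC ?leq_b1 // big_ord1 coefC eqxx.
Qed.

Lemma poly_act_monom i : poly_act 'X^i = iter i U e0.
Proof.
elim: i => [|i IH]; first by rewrite expr0 -polyC1 poly_actC mulr1z.
by rewrite exprS poly_actX IH.
Qed.

End CyclicModule.

Lemma poly_int_divn (p : nat) (f g h : {poly int}) : (0 < p)%N ->
  f *+ p = 'X * g + h *+ p -> exists g', g = g' *+ p.
Proof.
move=> p0 e; exists (\poly_(i < size g) (g`_i %/ p)%Z); apply/polyP => i.
rewrite coefMn coef_poly; case: ltnP => h1; last by rewrite mul0rn nth_default.
have := congr1 (fun q : {poly int} => q`_i.+1) e.
rewrite /= coefD coefXM /= !coefMn => ei.
have pg : (p %| g`_i)%Z.
  have -> : g`_i = (f`_i.+1 - h`_i.+1) * p%:Z.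
    by rewrite -natz mulr_natr mulrnBl ei addrK.
  exact: dvdz_mull.
by rewrite -mulr_natr natz divzK.
Qed.

Section TorsionExtension.
Variables (V : zmodType) (p : nat) (es : seq V) (U sV tV : V -> V) (e0 : V).
Hypotheses (p_pr : prime p) (gen : forall v, zspan es v).
Hypotheses (UD : {morph U : a b / a + b}) (sD : {morph sV : a b / a + b})
  (tD : {morph tV : a b / a + b}).
Hypotheses (Us : forall v, U (sV v) = sV (U v)) (Ut : forall v, U (tV v) = tV (U v)).
Hypothesis st : forall v, sV (tV v) = tV (sV v).
Variables (ms mt : int).
Hypotheses (sU : exists w, sV e0 = e0 + U e0 *~ ms + w *+ p)
           (tU : exists w, tV e0 = e0 + U e0 *~ mt + w *+ p).
Hypothesis nilU : exists N, forall v, iter N U v = 0.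
Hypothesis cyc : forall phi : V -> 'F_p, {morph phi : a b / a + b} ->
  (forall i, phi (iter i U e0) = 0) -> forall v, phi v = 0.
Variable v0 : V.
Hypotheses (v0p : v0 *+ p = 0) (v0n : v0 != 0).

Local Notation act := (poly_act U e0).
Let aD := poly_actD U e0.

Let act_onto1 v : exists f w, v = act f + w *+ p.
Proof.
pose H0 : set V := [set v | exists f w, v = act f + w *+ p].
have sH : subclosed H0.
  split; first by exists 0, 0; rewrite (morph0 aD) mul0rn addr0.
  move=> _ _ [f [w ->]] [g [w' ->]]; exists (f - g), (w - w').
  by rewrite (morphB aD) mulrnBl opprD addrACA.
apply: contrapT => nv.
have sT : subclosed (setT : set V) by [].
have pT (l : V) : setT l -> H0 (l *+ p).
  by exists 0, l; rewrite (morph0 aD) add0r.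
have [th [thD th0 th1]] := modp_functional p_pr sT sH (fun _ _ => I) pT (I : setT v) nv.
have := cyc (fun a b => thD a b I I) _ v; rewrite th1 => /(_ _)/eqP.
rewrite oner_eq0 => h; suff : false by [].
apply: h => i; apply: th0; exists 'X^i, 0.
by rewrite (poly_act_monom e0 UD) mul0rn addr0.
Qed.

Let act_onto k v : exists f w, v = act f + w *+ p ^ k.
Proof.
elim: k v => [|k IH] v; first by exists 0, v; rewrite (morph0 aD) add0r expn0 mulr1n.
have [f [w ->]] := IH v; have [g [w' wE]] := act_onto1 w.
exists (f + g *+ p ^ k), w'; rewrite aD (morphMn aD) -addrA; congr (_ + _).
by rewrite {1}wE mulrnDl -mulrnA -expnS.
Qed.

(** Let [k] be so large that no element of order [p] is a multiple of
    [p ^ (k - 1)]. Modulo [p ^ k] the module is a quotient of the polynomial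
    ring in [U] by an ideal [L]. A functional on [L] killing [X L + p L]
    defines an extension of the quotient by the prime field, which carries the
    action because [sV - 1] and [tV - 1] act as polynomials in [U] that lie in
    the ideal [(X, p)]. The functional is chosen nonzero at [p b] for some [b]
    representing an element of order [p] outside the image of [U] on such
    elements, so that the extension is not split over that element. *)
Lemma torsion_extension : exists (w : V -> V -> 'F_p) (bs bt : V -> 'F_p) (a : V),
  [/\ [/\ forall x y z, w x y + w (x + y) z = w y z + w x (y + z),
          forall x, w 0 x = 0 & forall x y, w x y = w y x],
      forall x y, bs (x + y) + w x y = bs x + bs y + w (sV x) (sV y),
      forall x y, bt (x + y) + w x y = bt x + bt y + w (tV x) (tV y),
      forall x, bs (tV x) - bs x + bt x - bt (sV x) = 0 &
      a *+ p = 0 /\ \sum_(i < p) w (a *+ i) a = 1].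
Proof.
have p0 := prime_gt0 p_pr.
have [E hE] := fg_torsion_bound p_pr gen; pose q := (p ^ E.+1)%N.
have pE (x y : V) : x *+ p = 0 -> x = y *+ p ^ E -> x = 0.
  move=> xp xy; rewrite xy; apply: (hE y E.+1).
  by rewrite expnSr mulrnA -xy.
pose L : set {poly int} := [set f | exists y, act f = y *+ q].
have sL : subclosed L.
  split; first by exists 0; rewrite (morph0 aD) mul0rn.
  by move=> f g [x fx] [y gy]; exists (x - y); rewrite (morphB aD) fx gy mulrnBl.
have LX f : L f -> L ('X * f).
  by case=> y fy; exists (U y); rewrite (poly_actX e0 UD) fy (morphMn UD).
have Lz f (k : int) : L f -> L (f *~ k) by exact: subclosedMz.
have LM g f : L f -> L (g * f).
  move=> Lf; elim/poly_ind: g => [|g c IH]; first by rewrite mul0r; exact: (proj1 sL).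
  rewrite mulrDl; apply: subclosedD => //; first by rewrite mulrAC mulrC; exact: LX.
  by rewrite mul_polyC -[c]intz scaler_int; exact: Lz.
(* As [U] is nilpotent, it does not map the elements of order [p] onto
   themselves. *)
have [b0 [b0p b0n]] : exists a, a *+ p = 0 /\ forall y, y *+ p = 0 -> a <> U y.
  apply: contrapT => no; have [N NE] := nilU.
  have all_im x : x *+ p = 0 -> exists2 y, y *+ p = 0 & x = U y.
    move=> xp; apply: contrapT => nx; apply: no; exists x; split=> // y yp xy.
    by apply: nx; exists y.
  have [y _ yE] : exists2 y, y *+ p = 0 & v0 = iter N U y.
    elim: N {NE} => [|N [y yp ->]]; first by exists v0.
    have [z zp ->] := all_im y yp; exists z => //.
    by rewrite -iterSr.
  by move: v0n; rewrite yE NE eqxx.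
have [b [w0 bw]] := act_onto E.+1 b0.
have Lb : L (b *+ p).
  exists (- (w0 *+ p)); rewrite (morphMn aD).
  have -> : act b = b0 - w0 *+ q by rewrite bw addrK.
  by rewrite mulrnBl b0p sub0r mulNrn mulrnAC.
pose H0 : set {poly int} := [set f | exists g h, [/\ L g, L h & f = 'X * g + h *+ p]].
have sH : subclosed H0.
  split; first by exists 0, 0; rewrite mulr0 mul0rn addr0; split=> //; exact: (proj1 sL).
  move=> _ _ [g [h [Lg Lh ->]]] [g' [h' [Lg' Lh' ->]]]; exists (g - g'), (h - h').
  by split; [exact: (proj2 sL)|exact: (proj2 sL)|rewrite mulrBr mulrnBl opprD addrACA].
have HL : H0 `<=` L.
  move=> _ [g [h [Lg Lh ->]]]; apply: subclosedD => //; first exact: LX.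
  exact: subclosedMn.
have pL f : L f -> H0 (f *+ p).
  by move=> Lf; exists 0, f; split=> //; [exact: (proj1 sL)|rewrite mulr0 add0r].
(* Cancelling [p] in a relation [p * b = X * g + p * h] between polynomials
   would express the element of order [p] as an image under [U]. *)
have nb : ~ H0 (b *+ p).
  move=> [g [h [[y gy] [z hz] e]]]; have [g' gE] := poly_int_divn p0 e.
  have bE : b = 'X * g' + h.
    apply/eqP; rewrite -subr_eq0; apply/eqP/polyP => i; rewrite coef0.
    have := congr1 (fun f : {poly int} => f`_i) e.
    rewrite gE /= mulrnAr -mulrnDl !coefMn coefB => ei.
    have : (b`_i - ('X * g' + h)`_i) *+ p == 0 by rewrite mulrnBl ei subrr.
    by rewrite mulrn_eq0 eqn0Ngt p0 => /eqP.
  pose x := act g' - y *+ p ^ E.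
  have xp : x *+ p = 0.
    by rewrite mulrnBl -(morphMn aD) -gE gy -mulrnA -expnSr subrr.
  apply: (b0n x xp); apply/eqP; rewrite -subr_eq0; apply/eqP.
  apply: (pE _ (z *+ p + w0 *+ p + U y)).
    by rewrite mulrnBl b0p -(morphMn UD) xp (morph0 UD) subrr.
  rewrite bw bE aD (poly_actX e0 UD) hz /x (morphB UD) (morphMn UD) /q expnS !mulrnDl.
  by rewrite -!mulrnA opprB addrC !addrA subrK -addrA addrC.
have [th [thD th0 th1]] := modp_functional p_pr sL sH HL pL Lb nb.
pose C f v := exists y, v = act f + y *+ q.
have CD f g v x : C f v -> C g x -> C (f + g) (v + x).
  by move=> [y ->] [z ->]; exists (y + z); rewrite aD mulrnDl addrACA.
have CL f g v : C f v -> C g v -> L (f - g).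
  move=> [y vy] [z vz]; exists (z - y); rewrite (morphB aD) mulrnBl.
  have -> : act f = act g + z *+ q - y *+ q by rewrite -vz vy addrK.
  by rewrite addrAC [act g + _]addrC addrK.
have actC f : C f (act f) by exists 0; rewrite mul0rn addr0.
(* A polynomial [P] that represents the operator [xV]; it is congruent to 1
   modulo [(X, p)], so it preserves the functional [th]. *)
have lift (xV : V -> V) (m : int) : {morph xV : a b / a + b} ->
    (forall v, U (xV v) = xV (U v)) ->
    (exists w, xV e0 = e0 + U e0 *~ m + w *+ p) ->
    exists P : {poly int}, (forall f v, C f v -> C (P * f) (xV v)) /\
      forall f, L f -> th (P * f) = th f.
  move=> xD Ux [w wE]; have [g [w' w'E]] := act_onto E w.
  exists (1 + ('X *~ m + g *+ p)); set P := 1 + _; split; last first.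
    move=> f Lf; rewrite mulrDl mul1r thD //; last by exact: LM.
    rewrite [X in _ + X]th0 ?addr0 //; exists (f *~ m), (g * f); split=> //.
    - exact: Lz.
    - exact: LM.
    by rewrite mulrDl mulrzAl mulrzAr mulrnAl.
  have CP : C P (xV e0).
    exists w'; rewrite wE w'E !aD (morphMz aD) (morphMn aD) -['X]mulr1 (poly_actX e0 UD).
    rewrite -polyC1 (poly_actC U e0) mulr1z mulrnDl -mulrnA -expnSr !addrA //.
  have Cact f : C (P * f) (xV (act f)).
    elim/poly_ind: f => [|f c [y IH]].
      by exists 0; rewrite mulr0 (morph0 aD) (morph0 xD) mul0rn addr0.
    case: CP => z zE; exists (U y + z *~ c).
    have -> : P * (f * 'X + c%:P) = 'X * (P * f) + P *~ c.
      rewrite mulrDr; congr (_ + _); first by ring.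
      by rewrite mulrC mul_polyC -{1}[c]intz scaler_int.
    rewrite [f * 'X]mulrC !aD !(poly_actX e0 UD) (poly_actC U e0) xD (morphMz xD).
    rewrite zE -Ux IH UD (morphMn UD) (morphMz aD) mulrzDl mulrnDl addrACA.
    by congr (_ + (_ + _)); rewrite !pmulrn -!mulrzA mulrC.
  move=> f v [y ->]; rewrite xD (morphMn xD); case: (Cact f) => z ->.
  by exists (z + xV y); rewrite mulrnDl addrA.
have [sP [sC sth]] := lift sV ms sD Us sU.
have [tP [tC tth]] := lift tV mt tD Ut tU.
(* A section of the map from polynomials, normalized at zero. *)
pose tau v := if v == 0 then 0 else sval (cid (act_onto E.+1 v)).
have tauC v : C (tau v) v.
  rewrite /tau; case: eqP => [->|_]; first by exists 0; rewrite (morph0 aD) mul0rn addr0.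
  exact: svalP (cid (act_onto E.+1 v)).
have tau0 : tau 0 = 0 by rewrite /tau eqxx.
have Lw x y : L (tau x + tau y - tau (x + y)).
  by apply: (CL _ _ (x + y)); [exact: CD|exact: tauC].
have Ls x : L (sP * tau x - tau (sV x)).
  by apply: (CL _ _ (sV x)); [exact: sC|exact: tauC].
have Lt x : L (tP * tau x - tau (tV x)).
  by apply: (CL _ _ (tV x)); [exact: tC|exact: tauC].
pose w x y := th (tau x + tau y - tau (x + y)).
have wb (xV : V -> V) (P : {poly int}) : {morph xV : a b / a + b} ->
    (forall x, L (P * tau x - tau (xV x))) -> (forall f, L f -> th (P * f) = th f) ->
    forall x y, th (P * tau (x + y) - tau (xV (x + y))) + w x y
      = th (P * tau x - tau (xV x)) + th (P * tau y - tau (xV y)) + w (xV x) (xV y).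
  move=> xD Lx Px x y; rewrite /w -(Px _ (Lw x y)) xD.
  have Lxy := Lx (x + y); rewrite xD in Lxy.
  rewrite -!thD //; try exact: LM; try exact: subclosedD.
  by congr th; ring.
exists w, (fun x => th (sP * tau x - tau (sV x))), (fun x => th (tP * tau x - tau (tV x))), b0.
split.
- split=> [x y z|x|x y].
  + rewrite /w -!thD; try exact: Lw.
    by congr th; rewrite (addrA x y z); ring.
  + by rewrite /w add0r tau0 add0r subrr th0 //; exact: (proj1 sH).
  + by rewrite /w [x + y]addrC [tau x + _]addrC.
- exact: wb sD Ls sth.
- exact: wb tD Lt tth.
- move=> x; have e1 := sth _ (Lt x); have e2 := tth _ (Ls x).
  have e3 : th (sP * tau (tV x) - tau (sV (tV x))) + th (sP * (tP * tau x - tau (tV x)))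
      + th (tP * tau x - tau (tV x)) + th (sP * tau x - tau (sV x))
    = th (tP * tau (sV x) - tau (tV (sV x))) + th (tP * (sP * tau x - tau (sV x)))
      + th (sP * tau x - tau (sV x)) + th (tP * tau x - tau (tV x)).
    have L1 := LM sP _ (Lt x); have L2 := LM tP _ (Ls x).
    have L3 := Ls (tV x); have L4 := Lt (sV x); have L5 := Lt x; have L6 := Ls x.
    rewrite -!thD //; do ?[apply: subclosedD => //].
    by congr th; rewrite st; ring.
  rewrite e1 e2 in e3.
  by apply: (eq_lincomb e3); ring.
split=> //.
have sumE n : \sum_(i < n) w (b0 *+ i) b0 = th (tau b0 *+ n - tau (b0 *+ n)).
  elim: n => [|n IH]; first by rewrite big_ord0 !mulr0n tau0 subr0 th0 //; exact: (proj1 sH).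
  rewrite big_ord_recr IH /= /w -mulrSr -thD //; first by congr th; rewrite mulrSr; ring.
  + apply: (CL _ _ (b0 *+ n)); last exact: tauC.
    elim: n {IH} => [|n IH]; first by rewrite !mulr0n -tau0; exact: tauC.
    by rewrite !mulrS; apply: CD.
  + by rewrite mulrSr; exact: Lw.
rewrite sumE b0p tau0 subr0.
have Ld : L (tau b0 - b) by apply: CL (tauC b0) _; exists w0.
have -> : tau b0 *+ p = b *+ p + (tau b0 - b) *+ p by rewrite -mulrnDl addrC subrK.
rewrite thD //; last exact: subclosedMn.
by rewrite th1 th0 ?addr0 //; exact: pL.
Qed.

End TorsionExtension.

(** * The kernel has no torsion *)

(** A commutative subgroup, written additively. *)
Definition abz (G : groupType) (A : set G) (_ : is_subgroup A)
  (_ : forall a b, A a -> A b -> commute a b) : Type := {x : G | `[< A x >]}.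

Section Abz.
Variables (G : groupType) (A : set G) (sA : is_subgroup A).
Hypothesis cA : forall a b, A a -> A b -> commute a b.
Local Notation V := (abz sA cA).

HB.instance Definition _ := Choice.copy V {x : G | `[< A x >]}.

Definition gval (v : V) : G := sval v.
Lemma gvalP v : A (gval v). Proof. exact/asboolP/(svalP v). Qed.
Definition mkV g (Ag : A g) : V := exist _ g (asboolT Ag).
Lemma gval_inj : injective gval.
Proof. by move=> u v e; exact: val_inj. Qed.

Definition abz_add (u v : V) : V := mkV (subM sA (gvalP u) (gvalP v)).
Definition abz_opp (u : V) : V := mkV (subV sA (gvalP u)).
Definition abz_zero : V := mkV (sub1 sA).

Fact abz_addA : associative abz_add.
Proof. by move=> u v w; apply: gval_inj; rewrite /= mulgA. Qed.
Fact abz_addC : commutative abz_add.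
Proof. by move=> u v; apply: gval_inj; apply: cA; exact: gvalP. Qed.
Fact abz_add0 : left_id abz_zero abz_add.
Proof. by move=> u; apply: gval_inj; rewrite /= mul1g. Qed.
Fact abz_addN : left_inverse abz_zero abz_opp abz_add.
Proof. by move=> u; apply: gval_inj; rewrite /= mulVg. Qed.

HB.instance Definition _ := GRing.isZmodule.Build V abz_addA abz_addC abz_add0 abz_addN.

Lemma gvalD (u v : V) : gval (u + v) = (gval u * gval v)%g. Proof. by []. Qed.
Lemma gval0 : gval 0 = 1%g. Proof. by []. Qed.
Lemma gvalN (u : V) : gval (- u) = (gval u)^-1%g. Proof. by []. Qed.
Lemma gvalMn (u : V) n : gval (u *+ n) = (gval u ^+ n)%g.
Proof. by elim: n => // n IH; rewrite mulrS gvalD IH expgS. Qed.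
Lemma gvalMz (u : V) k : gval (u *~ k) = zpow (gval u) k.
Proof. by case: k => n; rewrite ?NegzE ?mulrNz ?gvalN -?pmulrn gvalMn. Qed.

Definition toV g : V := if pselect (A g) is left Ag then mkV Ag else 0.
Lemma toVK g : A g -> gval (toV g) = g.
Proof. by rewrite /toV; case: pselect. Qed.
Lemma gvalK v : toV (gval v) = v.
Proof. by apply: gval_inj; rewrite toVK //; exact: gvalP. Qed.
Lemma toVM g h : A g -> A h -> toV (g * h)%g = toV g + toV h.
Proof. by move=> Ag Ah; apply: gval_inj; rewrite gvalD !toVK //; exact: (subM sA). Qed.
Lemma toV1 : toV 1%g = 0.
Proof. by apply: gval_inj; rewrite toVK //; exact: (sub1 sA). Qed.

End Abz.

Section KernelModule.
Variables (G : groupType) (dx dy : G -> int) (s t : G).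
Hypothesis fr : frame dx dy s t.
Local Notation A := (fker dx dy).
Local Notation V := (abz (fker_subgroup fr) (fker_comm fr)).
Local Notation hom := (additive_on A).
Local Notation toV := (toV (fker_subgroup fr) (fker_comm fr)).

Let Acj g a : A a -> A (cj g a). Proof. exact: (fker_cj fr). Qed.

Lemma cj_cj_comm g h a : A a -> cj g (cj h a) = cj h (cj g a).
Proof.
move=> Aa; have e : (g * h = (g * h * g^-1 * h^-1) * (h * g))%g by gsimp.
have Ac : A (g * h * g^-1 * h^-1)%g.
  have [xM yM _ _ _ _ _] := fr.
  by apply/fkerP; rewrite !xM !yM !int_charV //; split; ring.
rewrite !cj_cj e -[LHS]cj_cj; apply: (fker_cj_id fr) => //; exact: Acj.
Qed.

Definition actV g (v : V) : V := toV (cj g (gval v)).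
Lemma gval_actV g v : gval (actV g v) = cj g (gval v).
Proof. by rewrite toVK //; apply: Acj; exact: gvalP. Qed.
Lemma actVD g : {morph actV g : u v / u + v}.
Proof. by move=> u v; apply: gval_inj; rewrite gvalD !gval_actV gvalD cjM. Qed.
Lemma actV_comm g h v : actV g (actV h v) = actV h (actV g v).
Proof. by apply: gval_inj; rewrite !gval_actV; apply: cj_cj_comm; exact: gvalP. Qed.

Definition shV g (v : V) : V := actV g v - v.
Lemma gval_shV g v : gval (shV g v) = shift g (gval v).
Proof. by rewrite gvalD gvalN gval_actV. Qed.
Lemma shVD g : {morph shV g : u v / u + v}.
Proof. by move=> u v; rewrite /shV actVD opprD addrACA. Qed.
Lemma actV_sh g v : actV g v = v + shV g v.
Proof. by rewrite addrC subrK. Qed.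
Lemma shV_act g h v : shV g (actV h v) = actV h (shV g v).
Proof. by rewrite /shV (morphB (actVD h)) actV_comm. Qed.
Lemma gval_iter_shV g n v : gval (iter n (shV g) v) = iter n (shift g) (gval v).
Proof. by elim: n => // n IH; rewrite !iterS gval_shV IH. Qed.

Section AtPrime.
Variables (p : nat) (es : seq V).
Hypotheses (p_pr : prime p) (gen : forall v, zspan es v).
Hypothesis nilA : nil_action A.
Hypothesis rk : forall dx dy s t, frame dx dy s t -> rank_le1 (G := G) p dy.
Local Notation F := 'F_p.

Lemma homV_additive (phi : G -> F) : hom phi -> {morph (fun v : V => phi (gval v)) : u v / u + v}.
Proof. by move=> h u v; rewrite gvalD h //; exact: gvalP. Qed.

Lemma hom_toV (phi : V -> F) : {morph phi : u v / u + v} -> hom (fun g => phi (toV g)).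
Proof. by move=> h g k Ag Ak; rewrite toVM. Qed.

Lemma separate_p (v : V) : (forall phi : G -> F, hom phi -> phi (gval v) = 0) ->
  exists w, v = w *+ p.
Proof.
move=> kill; apply: contrapT => nv.
pose H0 : set V := [set v | exists w, v = w *+ p].
have sH : subclosed H0.
  split; first by exists 0; rewrite mul0rn.
  by move=> _ _ [a ->] [b ->]; exists (a - b); rewrite mulrnBl.
have sT : subclosed (setT : set V) by [].
have pT (l : V) : setT l -> H0 (l *+ p) by exists l.
have [th [thD th0 th1]] := modp_functional p_pr sT sH (fun _ _ => I) pT (I : setT v) nv.
have := kill _ (hom_toV (fun a b => thD a b I I)); rewrite gvalK th1 => /eqP.
by rewrite oner_eq0.
Qed.

Lemma divisible_no_torsion (v : V) : (forall phi : G -> F, hom phi ->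
  forall a, A a -> phi a = 0) -> v *+ p = 0 -> v = 0.
Proof.
move=> kill vp; have [E hE] := fg_torsion_bound p_pr gen.
have [w wE] : exists w, v = w *+ p ^ E.
  elim: (E) => [|n [w wE]]; first by exists v; rewrite expn0 mulr1n.
  have [|w' w'E] := @separate_p w; first by move=> phi h; apply: kill => //; exact: gvalP.
  by exists w'; rewrite wE w'E -mulrnA -expnS.
by rewrite wE; apply: (hE w E.+1); rewrite expnSr mulrnA -wE.
Qed.

(** Torsion would give an extension of the kernel by the prime field, extending
    to the whole group, in which an element of order [p] lifts to one of order
    [p ^ 2]; but classes of the group are trivial on the kernel. *)
Lemma no_torsion_core (u e0 : G) (ms mt : int) : A e0 ->
  (forall phi : G -> F, hom phi -> (forall i, phi (iter i (shift u) e0) = 0) ->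
     forall a, A a -> phi a = 0) ->
  (forall phi : G -> F, hom phi -> phi (shift s e0) = ms%:~R * phi (shift u e0)) ->
  (forall phi : G -> F, hom phi -> phi (shift t e0) = mt%:~R * phi (shift u e0)) ->
  forall v : V, v *+ p = 0 -> v = 0.
Proof.
move=> Ae cyc hs ht v vp; apply/eqP; apply: contraT => vn.
have [[phi hp [e Ae' pe]]|nohom] := pselect
  (exists2 phi : G -> F, hom phi & exists2 e, A e & phi e != 0); last first.
  rewrite -(negPf vn); apply/eqP/divisible_no_torsion => // phi hp a Aa.
  by apply/eqP; apply: contraT => n0; case: nohom; exists phi => //; exists a.
pose e0' : V := toV e0; have ge0 : gval e0' = e0 by exact: toVK.
have approx g (m : int) : (forall phi : G -> F, hom phi ->
    phi (shift g e0) = m%:~R * phi (shift u e0)) ->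
    exists w, actV g e0' = e0' + shV u e0' *~ m + w *+ p.
  move=> hg; have [|w wE] := @separate_p (shV g e0' - shV u e0' *~ m).
    move=> f hf; rewrite (morphB (homV_additive hf)) (morphMz (homV_additive hf)).
    by rewrite !gval_shV ge0 hg // mulrzl subrr.
  by exists w; rewrite -wE -addrA [X in _ = _ + X]addrC subrK actV_sh.
have cycV (f : V -> F) : {morph f : a b / a + b} ->
    (forall i, f (iter i (shV u) e0') = 0) -> forall v, f v = 0.
  move=> fD f0 x; rewrite -[x]gvalK; apply: (cyc _ (hom_toV fD)); last exact: gvalP.
  move=> i; rewrite -(f0 i); congr f; apply: gval_inj.
  by rewrite gval_iter_shV ge0 toVK //; elim: i => //= i IH; exact: (shift_A fr _ IH).
have nilU : exists N, forall v, iter N (shV u) v = 0.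
  have [N NE] := nilA; exists N => x; apply: gval_inj.
  by rewrite gval_iter_shV NE //; exact: gvalP.
have [w [bs [bt [a [[wc w0 wC] ws wt ob [ap wsum]]]]]] :=
  torsion_extension p_pr gen (shVD u) (actVD s) (actVD t) (shV_act u s) (shV_act u t)
    (actV_comm s t) (approx _ _ hs) (approx _ _ ht) nilU cycV vp vn.
pose w' g h : F := w (toV g) (toV h).
have toVcj g x : A x -> toV (cj g x) = actV g (toV x).
  by move=> Ax; rewrite /actV toVK.
have sA := fker_subgroup fr.
have cw : cocycle_on A w' by move=> x y z Ax Ay Az; rewrite /w' !toVM.
have nw : normalized_on A w'.
  by move=> x Ax; rewrite /w' toV1 [X in _ /\ X = _]wC w0.
have wb g (b : V -> F) : (forall x y, b (x + y) + w x y
    = b x + b y + w (actV g x) (actV g y)) -> forall x y, A x -> A y ->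
    b (toV (x * y)%g) + w' x y = b (toV x) + b (toV y) + w' (cj g x) (cj g y).
  by move=> e1 x y Ax Ay; rewrite /w' !toVcj // toVM.
have obs x : A x -> bs (toV (cj t x)) - bs (toV x) + bt (toV x) - bt (toV (cj s x))
    + (w' (fcomm s t) (cj s (cj t x)) - w' (cj s (cj t x)) (fcomm s t)) = 0.
  by move=> Ax; rewrite /w' wC subrr addr0 !toVcj.
have [f [cf fw _]] := extend_two_steps fr cw nw (wb s bs ws) (wb t bt wt) obs.
have [d fd] := cocycle_trivial_on_fker fr nilA (rk fr) hp Ae' pe cf.
have wd x y : w x y = d (gval x) + d (gval y) - d (gval (x + y)).
  have Ax := gvalP x; have Ay := gvalP y.
  by have := fw _ _ Ax Ay; rewrite fd // /w' !gvalK => <-.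
(* The sum of [w (i * a, a)] is the [p]-th power of a lift of [a]; for a
   coboundary it telescopes to zero. *)
have sumE n : \sum_(i < n) w (a *+ i) a
    = d 1%g - d (gval (a *+ n)) + n%:R * d (gval a).
  elim: n => [|n IH]; first by rewrite big_ord0 mulr0n gval0 subrr mul0r addr0.
  by rewrite big_ord_recr IH /= wd -mulrSr -natr1; ring.
by move: wsum; rewrite sumE ap gval0 pchar_Fp_0 // mul0r subrr addr0 => /eqP;
  rewrite eq_sym oner_eq0.
Qed.

(** Modulo [p] the kernel is a cyclic module under a single operator: in the
    case of a line it is a cyclic group with trivial action, and in the case of
    a plane it is generated by the commutator of [s] and [t] under whichever of
    the two moves [psi]. *)
Lemma no_torsion (v : V) : v *+ p = 0 -> v = 0.
Proof.
have hsh (f : G -> F) g a : hom f -> A a -> f (shift g a) = dif g f a.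
  by move=> h Aa; rewrite (difE fr).
have lift_int (k : F) : exists m : int, m%:~R = k.
  by exists (k : nat)%:Z; rewrite -[RHS]natr_Zp.
case: (homs_mod_p rk fr nilA) => [[phi hp line]|].
  have d0 g a : A a -> dif g phi a = 0.
    have [k kE] := line _ (hom_dif fr g hp); have [N NE] := nilA.
    have itE n b : A b -> iter n (dif g) phi b = k ^+ n * phi b.
      elim: n b => [|n IH] b Ab; first by rewrite expr0 mul1r.
      rewrite iterS /dif !IH //; last exact: Acj.
      by rewrite -mulrBr -/(dif g phi b) kE // mulrA -exprSr.
    move=> Aa; rewrite kE //; have := itE N a Aa.
    rewrite (iter_difE fr) // NE // (hom1 fr) // => /esym/eqP.
    rewrite mulf_eq0 expf_eq0 => /orP[/andP[_ /eqP ->]|/eqP ->].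
      by rewrite mul0r.
    by rewrite mulr0.
  have dh (f : G -> F) g a : hom f -> A a -> f (shift g a) = 0.
    move=> h Aa; rewrite hsh // /dif; have [k kE] := line f h.
    rewrite !kE //; last exact: Acj.
    by rewrite -mulrBr -/(dif g phi a) d0 // mulr0.
  have [e Ae eP] : exists2 e, A e & forall f : G -> F, hom f -> f e = 0 ->
      forall a, A a -> f a = 0.
    have [[e Ae /eqP pe]|no] := pselect (exists2 e, A e & phi e <> 0).
      exists e => // f h fe a Aa; have [k kE] := line f h.
      have := fe; rewrite kE // => /eqP; rewrite mulf_eq0 (negPf pe) orbF => /eqP k0.
      by rewrite kE // k0 mul0r.
    exists 1%g; first exact: (sub1 (fker_subgroup fr)).
    move=> f h _ a Aa; have [k ->] // := line f h.
    apply/eqP; apply: contraT => n0; case: no; exists a => // p0.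
    by rewrite p0 mulr0 eqxx in n0.
  apply: (@no_torsion_core t e 0 0) => //.
  - by move=> f h f0; apply: eP => //; exact: (f0 0%N).
  - by move=> f h; rewrite !dh // mul0r.
  - by move=> f h; rewrite !dh // mul0r.
case=> phi [psi [x [y [[hp hq] dp dq [xy pc] span]]]].
have Ac := fcomm_fker fr; set c := fcomm s t in Ac pc.
have cyc u (z : F) : z != 0 -> (forall a, A a -> dif u phi a = 0) ->
    (forall a, A a -> dif u psi a = z * phi a) ->
    forall f : G -> F, hom f -> (forall i, f (iter i (shift u) c) = 0) ->
    forall a, A a -> f a = 0.
  move=> z0 up uq f h f0 a Aa; have [k [l fE]] := span f h.
  have As := shift_A fr u Ac.
  have := f0 1%N; rewrite /= fE // (hsh phi) // (hsh psi) // up // uq // mulr0 add0r => /eqP.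
  rewrite !mulf_eq0 (negPf z0) (negPf pc) !orbF => /eqP l0.
  have := f0 0%N; rewrite /= fE // l0 mul0r addr0 => /eqP.
  rewrite mulf_eq0 (negPf pc) orbF => /eqP k0.
  by rewrite fE // k0 l0 !mul0r addr0.
have ap g g' (z z' : F) m : (forall a, A a -> dif g phi a = 0) ->
    (forall a, A a -> dif g psi a = z * phi a) ->
    (forall a, A a -> dif g' phi a = 0) ->
    (forall a, A a -> dif g' psi a = z' * phi a) -> z = m%:~R * z' ->
    forall f : G -> F, hom f -> f (shift g c) = m%:~R * f (shift g' c).
  move=> gp gq g'p g'q zE f h; have [k [l fE]] := span f h.
  have As := shift_A fr g Ac; have As' := shift_A fr g' Ac.
  rewrite !fE // !(hsh phi) // !(hsh psi) // gp // gq // g'p // g'q // zE; ring.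
have sp a : A a -> dif s phi a = 0 by move=> /dp[].
have tp a : A a -> dif t phi a = 0 by move=> /dp[].
have sq a : A a -> dif s psi a = x * phi a by move=> /dq[].
have tq a : A a -> dif t psi a = y * phi a by move=> /dq[].
have [y0|y0] := eqVneq y 0.
  rewrite y0 eqxx orbF in xy; apply: (no_torsion_core Ac (cyc s x xy sp sq)).
    by apply: (ap s s x x 1 sp sq sp sq); rewrite mul1r.
  by apply: (ap t s y x 0 tp tq sp sq); rewrite y0 mul0r.
have [m mE] := lift_int (x / y).
apply: (no_torsion_core Ac (cyc t y y0 tp tq)).
  by apply: (ap s t x y m sp sq tp tq); rewrite mE divfK.
by apply: (ap t t y y 1 tp tq tp tq); rewrite mul1r.
Qed.

End AtPrime.
End KernelModule.

(** * Finite generation of the kernel *)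

Lemma nilpotent_nil_action (G : groupType) (A : set G) :
  nilpotent_group G -> nil_action A.
Proof.
case=> N NE; exists N => g a _; apply: NE.
have lcV n x : @lower_central G n x -> @lower_central G n x^-1%g.
  by case: n => //= n; exact: generated_V.
elim: N => [//|N IH]; rewrite iterS /=; apply: generated_incl.
exists g^-1%g, (iter N (shift g) a)^-1%g; split; first exact: lcV.
by rewrite /shift /cj /commg /conjg; gsimp.
Qed.

Section ZspanMore.
Variable V : zmodType.
Implicit Types (es : seq V).

Lemma zspan_subclosed es : subclosed (zspan es).
Proof.
elim: es => [|e es IH]; first by split=> // _ _ -> ->; rewrite subrr.
exact: addcyc_subclosed.
Qed.

Lemma zspan_mem es e : e \in es -> zspan es e.
Proof.
elim: es => //= x es IH; rewrite inE => /orP[/eqP ->|/IH h].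
  by exists 1; rewrite mulr1z subrr; exact: (proj1 (zspan_subclosed es)).
by exists 0; rewrite subr0.
Qed.
End ZspanMore.

Section KernelFG.
Variables (G : groupType) (dx dy : G -> int) (s t : G).
Hypothesis fr : frame dx dy s t.
Local Notation A := (fker dx dy).
Local Notation V := (abz (fker_subgroup fr) (fker_comm fr)).
Local Notation toV := (toV (fker_subgroup fr) (fker_comm fr)).

Let xM := frame_xM fr.
Let yM := frame_yM fr.

Definition frame_word (i j : int) : G := (zpow s i * zpow t j)%g.
Definition kpart g : G := (g * (frame_word (dx g) (dy g))^-1)%g.

Lemma dx_word i j : dx (frame_word i j) = i.
Proof. by rewrite xM !int_char_zpow // (frame_xs fr) (frame_xt fr) mulr1 mulr0 addr0. Qed.
Lemma dy_word i j : dy (frame_word i j) = j.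
Proof. by rewrite yM !int_char_zpow // (frame_ys fr) (frame_yt fr) mulr1 mulr0 add0r. Qed.

Lemma kpart_fker g : A (kpart g).
Proof.
by apply/fkerP; rewrite /kpart xM yM !int_charV // dx_word dy_word !addrN.
Qed.

Lemma kpartE g : g = (kpart g * frame_word (dx g) (dy g))%g.
Proof. by rewrite /kpart mulgVK. Qed.

Lemma kpart_id a : A a -> kpart a = a.
Proof. by move=> /fkerP[xa ya]; rewrite /kpart xa ya /frame_word !zpow0 mulg1 invg1 mulg1. Qed.

Section Normal.
Variable B : set V.
Hypotheses (sB : subclosed B) (Bs : forall v, B v -> B (shV s v))
  (Bt : forall v, B v -> B (shV t v)) (Bc : B (toV (fcomm s t))).
Hypothesis nilA : nil_action A.

Lemma actV_mul g h (v : V) : actV (g * h)%g v = actV g (actV h v).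
Proof. by apply: gval_inj; rewrite !gval_actV cj_cj. Qed.

Lemma actV1 (v : V) : actV 1%g v = v.
Proof. by apply: gval_inj; rewrite gval_actV cj1g. Qed.

Let stable g : (forall v, B v -> B (shV g v)) ->
  forall i v, B v -> B (actV (zpow g i) v).
Proof.
move=> Bg; have Bp v : B v -> B (actV g v).
  by move=> Bv; rewrite actV_sh; apply: subclosedD => //; exact: Bg.
have Bm v : B v -> B (actV g^-1%g v).
  have [N NE] := nilA; have : iter N (shV g) v = 0.
    by apply: gval_inj; rewrite gval_iter_shV NE //; exact: gvalP.
  elim: (N) v => [|n IH] v; first by move=> /= ->; rewrite (morph0 (actVD (fr := fr) _)).
  rewrite iterSr => vn Bv; have := IH _ vn (Bg _ Bv).
  rewrite /shV (morphB (actVD (fr := fr) _)) -actV_mul mulVg actV1 => h.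
  by have := (proj2 sB) _ _ Bv h; rewrite opprB addrC subrK.
elim/int_ind_pm => [|i IH|i IH] v Bv; first by rewrite zpow0 actV1.
  by rewrite zpowS actV_mul; apply/IH/Bp.
by rewrite zpowB actV_mul; apply/IH/Bm.
Qed.

Let act_all g v : B v -> B (actV g v).
Proof.
move=> Bv; rewrite (kpartE g) actV_mul.
have -> (w : V) : actV (kpart g) w = w.
  apply: gval_inj; rewrite gval_actV; apply: (fker_cj_id fr); last exact: gvalP.
  exact: kpart_fker.
by rewrite /frame_word actV_mul; apply: stable => //; apply: stable.
Qed.

Let BB g := A g /\ B (toV g).

Let BBM g h : BB g -> BB h -> BB (g * h)%g.
Proof.
move=> [Ag Bg] [Ah Bh]; split; first exact: (subM (fker_subgroup fr)).
by rewrite toVM //; exact: subclosedD.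
Qed.

Let BBV g : BB g -> BB g^-1%g.
Proof.
move=> [Ag Bg]; split; first exact: (subV (fker_subgroup fr)).
have -> : toV g^-1%g = - toV g.
  by apply: gval_inj; rewrite gvalN !toVK //; exact: (subV (fker_subgroup fr)).
exact: subclosedN.
Qed.

Let BBJ g h : BB h -> BB (cj g h).
Proof.
move=> [Ah Bh]; split; first exact: (fker_cj fr).
have -> : toV (cj g h) = actV g (toV h).
  by apply: gval_inj; rewrite gval_actV !toVK //; exact: (fker_cj fr).
exact: act_all.
Qed.

Let BB1 : BB 1%g.
Proof. by split; [exact: (sub1 (fker_subgroup fr))|rewrite toV1; exact: (proj1 sB)]. Qed.

(** Modulo an invariant subgroup of the kernel containing their commutator,
    [s] and [t] commute, so that the kernel part is multiplicative there. *)
Let comm_word i j : BB (cj (zpow t j) (zpow s i) * (zpow s i)^-1)%g.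
Proof.
have right g h i' : BB (cj g h * h^-1)%g -> BB (cj g (zpow h i') * (zpow h i')^-1)%g.
  move=> gh; elim/int_ind_pm: i' => [|k IH|k IH].
  - by rewrite zpow0 cj1 mulgV.
  - have := BBM IH (BBJ (zpow h k) gh); congr BB; rewrite zpowS /cj.
    by gsimp.
  - have := BBM IH (BBV (BBJ (zpow h (k - 1)) gh)); congr BB; rewrite zpowB /cj.
    by gsimp.
apply: right; have left g h j' : BB (cj g h * h^-1)%g -> BB (cj (zpow g j') h * h^-1)%g.
  move=> gh; elim/int_ind_pm: j' => [|k IH|k IH].
  - by rewrite zpow0 cj1g mulgV.
  - have := BBM (BBJ (zpow g k) gh) IH; congr BB; rewrite zpowS /cj.
    by gsimp.
  - have := BBM (BBV (BBJ (zpow g (k - 1)) gh)) IH; congr BB; rewrite zpowB /cj.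
    by gsimp.
apply: left; split; [exact: (fcomm_fker fr)|exact: Bc].
Qed.

Let kpartM g h : BB (kpart g) -> BB (kpart h) -> BB (kpart (g * h)%g).
Proof.
move=> Bg Bh; set x := dx g; set y := dy g; set x' := dx h; set y' := dy h.
have := BBM (BBM Bg (BBJ (frame_word x y) Bh)) (BBJ (zpow s x) (comm_word x' y)).
by congr BB; rewrite /kpart /frame_word xM yM !zpowD /cj -/x -/y -/x' -/y'; gsimp.
Qed.

Let kpartV g : BB (kpart g) -> BB (kpart g^-1%g).
Proof.
move=> Bg; set x := dx g; set y := dy g.
have := BBM (BBJ (frame_word x y)^-1%g (BBV Bg)) (comm_word (- x) (- y)).
congr BB; rewrite /kpart /frame_word !int_charV // -/x -/y !zpowN /cj.
by gsimp.
Qed.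

Lemma kernel_in_normal (gs : seq G) :
  (forall g, generated [set` gs] g) -> (forall g, g \in gs -> B (toV (kpart g))) ->
  forall v, B v.
Proof.
move=> gen Bgs v; have all_g g : BB (kpart g).
  elim: (gen g) => [x xg||x y _ IHx _ IHy|x _ IH].
  - by split; [exact: kpart_fker|exact: Bgs].
  - by rewrite /kpart !int_char1 // /frame_word !zpow0; gsimp; exact: BB1.
  - exact: kpartM.
  - exact: kpartV.
by have [_] := all_g (gval v); rewrite kpart_id ?gvalK //; exact: gvalP.
Qed.

End Normal.

(** As a module the kernel is generated by the commutator of [s] and [t] and
    by the kernel parts of the generators of the group; since [s - 1] and
    [t - 1] are nilpotent, it is finitely generated as an abelian group. *)
Lemma kernel_fg : finitely_generated G -> nil_action A ->
  exists es : seq V, forall v, zspan es v.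
Proof.
case=> gs gen nilA; have [N NE] := nilA.
pose E0 := toV (fcomm s t) :: [seq toV (kpart g) | g <- gs].
pose es := [seq iter ij.1 (shV s) (iter ij.2 (shV t) e) |
  e <- E0, ij <- [seq (i, j) | i <- iota 0 N.+1, j <- iota 0 N.+1]].
have nil0 g (v : V) : iter N (shV g) v = 0.
  by apply: gval_inj; rewrite gval_iter_shV NE //; exact: gvalP.
have iter0 g n : iter n (shV g) (0 : V) = 0.
  by elim: n => //= n ->; rewrite (morph0 (shVD (fr := fr) g)).
have mem e i j : e \in E0 -> zspan es (iter i (shV s) (iter j (shV t) e)).
  move=> eE; have [iN|iN] := ltnP i N.+1; last first.
    rewrite -(subnK (ltnW iN)) iterD nil0 iter0; exact: (proj1 (zspan_subclosed es)).
  have [jN|jN] := ltnP j N.+1; last first.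
    rewrite -(subnK (ltnW jN)) [iter (j - N + N) _ _]iterD nil0 !iter0.
    exact: (proj1 (zspan_subclosed es)).
  apply: zspan_mem; apply/allpairsPdep; exists e, (i, j); split=> //.
  by apply/allpairsPdep; exists i, j; rewrite !mem_iota.
have mem0 e : e \in E0 -> zspan es e by exact: (mem e 0%N 0%N).
have sub g (P : forall e i j, e \in E0 ->
    zspan es (shV g (iter i (shV s) (iter j (shV t) e)))) v :
    zspan es v -> zspan es (shV g v).
  move=> Bv; apply: (zspan_sub (H := [set v | zspan es (shV g v)]) _ _ Bv).
    have [B0 BB] := zspan_subclosed es.
    split; first by rewrite /= (morph0 (shVD (fr := fr) g)).
    by move=> a b Ba Bb; rewrite /= (morphB (shVD (fr := fr) g)); exact: BB.
  by move=> _ /allpairsPdep[e [ij [eE _ ->]]]; exact: P.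
have comm (v : V) i : shV t (iter i (shV s) v) = iter i (shV s) (shV t v).
  elim: i => //= i IH; rewrite -IH /shV (morphB (actVD (fr := fr) t)) actV_comm.
  rewrite (morphB (actVD (fr := fr) s)) !opprB addrACA [RHS]addrACA.
  by congr (_ + _); rewrite addrC.
exists es; apply: (kernel_in_normal (zspan_subclosed es) _ _ _ nilA gen).
- by apply: sub => e i j eE; rewrite -iterS; exact: mem.
- by apply: sub => e i j eE; rewrite comm -iterS; exact: mem.
- by apply: mem0; rewrite inE eqxx.
- by move=> g gg; apply: mem0; rewrite inE; apply/orP; right; apply/mapP; exists g.
Qed.

Lemma kernel2_separated (F : fieldType) (es : seq V) : (forall v, zspan es v) ->
  fin_separated F (fker2 dy) (s :: [seq gval v | v <- es]).
Proof.
move=> gen; have Ks := fker2_s fr; have sK := fker2_subgroup fr; split.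
  move=> k; rewrite inE => /orP[/eqP -> //|/mapP[v _ ->]].
  exact: (fker_fker2 (gvalP v)).
move=> phi h h0 k Kk; have ps : phi s = 0 by apply: h0; rewrite inE eqxx.
have psz i : phi (zpow s i) = 0 by rewrite (additive_zpow _ sK h Ks) ps mul0rz.
have phi1 : phi 1%g = 0 := psz 0.
have pA a : A a -> phi a = 0.
  move=> Aa; rewrite -(toVK (fker_subgroup fr) (fker_comm fr) Aa).
  pose H : set V := [set v | phi (gval v) = 0].
  apply: (zspan_sub (H := H) _ _ (gen _)).
    split; first exact: phi1.
    move=> u v Hu Hv; rewrite /H /=; have Ku := fker_fker2 (gvalP u).
    have Kv := fker_fker2 (gvalP (u - v)); have Kv' := fker_fker2 (gvalP v).
    by have := h _ _ Kv Kv'; rewrite -gvalD subrK Hu Hv addr0.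
  by move=> e ees; apply: h0; rewrite inE map_f ?orbT.
rewrite (kpartE k); have ky : dy k = 0 by case: Kk.
rewrite ky /frame_word zpow0 mulg1 h; first last.
- exact: sub_zpow.
- exact: (fker_fker2 (kpart_fker k)).
by rewrite pA ?psz ?addr0 //; exact: kpart_fker.
Qed.

End KernelFG.

(** * The rank of the kernel *)

Definition all_rank_le1 (G : groupType) := forall p (dx dy : G -> int) (s t : G),
  prime p -> frame dx dy s t -> rank_le1 p dy.

Lemma prime_torsion_free (V : zmodType) :
  (forall p (v : V), prime p -> v *+ p = 0 -> v = 0) -> torsion_free V.
Proof.
move=> tf; have nat_tf n (v : V) : (0 < n)%N -> v *+ n = 0 -> v = 0.
  elim/ltn_ind: n v => n IH v n0 vn; have [n1|n1] := leqP n 1.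
    by move: vn; have -> : n = 1%N by apply/eqP; rewrite eqn_leq n1.
  have pp := pdiv_prime n1; set p := pdiv n in pp.
  have pn : (p %| n)%N := pdiv_dvd n.
  apply: (IH (n %/ p)%N); first by rewrite ltn_Pdiv // prime_gt1.
    by rewrite divn_gt0 ?prime_gt0 // dvdn_leq.
  by apply: (tf p) => //; rewrite -mulrnA divnK.
move=> v k vk; have [->|k0] := eqVneq k 0; first by right.
left; apply: (nat_tf `|k|%N); first by rewrite absz_gt0.
case: k vk {k0} => n //; rewrite NegzE mulrNz => /eqP; rewrite oppr_eq0 abszN.
by move/eqP.
Qed.

Section Coordinates.
Variables (G : groupType) (dx dy : G -> int) (s t : G).
Hypothesis fr : frame dx dy s t.
Local Notation A := (fker dx dy).
Local Notation V := (abz (fker_subgroup fr) (fker_comm fr)).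
Local Notation toV := (toV (fker_subgroup fr) (fker_comm fr)).
Hypothesis rk : all_rank_le1 G.
Hypothesis nilA : nil_action A.
Hypothesis fgG : finitely_generated G.

(** [X] identifies the subgroup with the free abelian group of rank [n]. *)
Definition coords (B : set G) n (X : 'I_n -> G -> int) := [/\
  forall i, additive_on B (X i),
  forall a, B a -> (forall i, X i a = 0) -> a = 1%g &
  forall i, exists2 e, B e & forall j, X j e = (i == j)%:R].

Lemma kernel_coords : exists n (X : 'I_n -> G -> int), coords A X.
Proof.
have [es gen] := kernel_fg fr fgG nilA.
have tf : torsion_free V.
  apply: prime_torsion_free => p v pp; apply: (no_torsion pp gen nilA).
  by move=> dx' dy' s' t'; exact: rk.
have [n [e [sp ind]]] := torsion_free_basis tf gen.
pose x v := sval (cid (sp v)); have xE v : v = \sum_i e i *~ x v i := svalP (cid (sp v)).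
have xu v y : v = \sum_i e i *~ y i -> forall i, x v i = y i.
  move=> vE i; apply/eqP; rewrite -subr_eq0; apply/eqP.
  apply: (ind (fun i => x v i - y i)); under eq_bigr => j _ do rewrite mulrzBr.
  by rewrite sumrB -xE -vE subrr.
have xD u v i : x (u + v) i = x u i + x v i.
  apply: (xu _ (fun i => x u i + x v i)); rewrite {1}(xE u) {1}(xE v) -big_split.
  by apply: eq_bigr => j _; rewrite mulrzDr.
exists n, (fun i g => x (toV g) i); split.
- by move=> i a b Aa Ab; rewrite toVM.
- move=> a Aa x0; rewrite -(toVK (fker_subgroup fr) (fker_comm fr) Aa) (xE (toV a)).
  by rewrite big1 // => i _; rewrite x0 mulr0z.
move=> i; exists (gval (e i)); first exact: gvalP.
move=> j; rewrite gvalK; apply: (xu _ (fun j => (i == j)%:R)); rewrite (bigD1 i) //= eqxx.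
rewrite mulr1z big1 ?addr0 // => k ki.
by rewrite eq_sym (negPf ki) mulr0z.
Qed.

Section WithCoords.
Variables (n : nat) (X : 'I_n -> G -> int).
Hypothesis cX : coords A X.

Lemma coord_hom p i : additive_on A (fun a => (X i a)%:~R : 'F_p).
Proof. by case: cX => a _ _ g h Ag Ah; rewrite a // intrD. Qed.

Lemma coords_factor (F : fieldType) m (K : 'I_n -> 'I_m -> F) (phi : 'I_m -> G -> F) :
  (forall i a, A a -> (X i a)%:~R = \sum_j K i j * phi j a) -> (n <= m)%N.
Proof.
case: cX => aX _ eX KE; pose e i := s2val (cid2 (eX i)).
have Ae i : A (e i) := s2valP (cid2 (eX i)).
have eE i j : X j (e i) = (i == j)%:R := s2valP' (cid2 (eX i)) j.
have : \matrix_(i < n, j < m) K i j *m \matrix_(j < m, k < n) phi j (e k) = 1%:M.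
  apply/matrixP => i k; rewrite !mxE.
  under eq_bigr => j _ do rewrite !mxE.
  by rewrite -KE // eE eq_sym; case: eqP.
move=> /(congr1 (@mxrank F n n)); rewrite mxrank1 => <-.
exact: leq_trans (mxrankM_maxl _ _) (rank_leq_col _).
Qed.

Lemma coords_le2 : (n <= 2)%N.
Proof.
have p2 : prime 2 by [].
case: (homs_mod_p (fun dx dy s t => rk (dx := dx) (dy := dy) (s := s) (t := t) p2) fr nilA).
  move=> [phi hp line]; apply: leq_trans (_ : 1 <= 2)%N => //.
  have ex i : exists k : 'F_2, forall a, A a -> (X i a)%:~R = k * phi a.
    exact: line (coord_hom 2 i).
  apply: (@coords_factor _ 1 (fun i _ => sval (cid (ex i))) (fun=> phi)) => i a Aa.
  by rewrite big_ord1 (svalP (cid (ex i))).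
move=> [phi [psi [x [y [_ _ _ _ span]]]]].
have ex i : exists kl : 'F_2 * 'F_2, forall a, A a ->
    (X i a)%:~R = kl.1 * phi a + kl.2 * psi a.
  by have [k [l kl]] := span _ (coord_hom 2 i); exists (k, l).
pose K i (j : 'I_2) := if j == 0 then (sval (cid (ex i))).1 else (sval (cid (ex i))).2.
apply: (@coords_factor _ 2 K (fun j => if j == 0 then phi else psi)) => i a Aa.
by rewrite big_ord_recl big_ord1 /= (svalP (cid (ex i))).
Qed.

(** A line of homomorphisms modulo [p] is too small for two coordinates, so only
    the second alternative of [homs_mod_p] remains. *)
Lemma coords2_plane p : prime p -> (1 < n)%N ->
  exists (phi psi : G -> 'F_p) (x y : 'F_p),
    [/\ additive_on A phi /\ additive_on A psi,
    forall a, A a -> dif s phi a = 0 /\ dif t phi a = 0,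
    forall a, A a -> dif s psi a = x * phi a /\ dif t psi a = y * phi a,
    ((x != 0) || (y != 0)) /\ phi (fcomm s t) != 0 &
    forall eta, additive_on A eta -> exists k l : 'F_p, forall a, A a ->
      eta a = k * phi a + l * psi a].
Proof.
move=> pp n1.
case: (homs_mod_p (fun dx dy s t => rk (dx := dx) (dy := dy) (s := s) (t := t) pp) fr nilA) => //.
move=> [phi hp line]; move: n1; rewrite ltnNge => /negP[].
have ex i : exists k : 'F_p, forall a, A a -> (X i a)%:~R = k * phi a.
  exact: line (coord_hom p i).
apply: (@coords_factor _ 1 (fun i _ => sval (cid (ex i))) (fun=> phi)) => i a Aa.
by rewrite big_ord1 (svalP (cid (ex i))).
Qed.

Lemma int_all_primes (z : int) : (forall p, prime p -> z%:~R = 0 :> 'F_p) -> z = 0.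
Proof.
move=> z0; have [p lt pp] := prime_above `|z|%N.
apply/eqP; rewrite -absz_eq0 -leqn0 leqNgt; apply/negP => zp.
have /eqP := z0 p pp; rewrite Fp_int_eq0 // => /(dvdn_leq zp).
by rewrite leqNgt lt.
Qed.

Hypothesis n1 : (1 < n)%N.

Let hshift p (phi : G -> 'F_p) g a : additive_on A phi -> A a ->
  phi (shift g a) = dif g phi a.
Proof. by move=> h Aa; rewrite (difE fr). Qed.

(** Modulo every prime the operators [s - 1] and [t - 1] map to the kernel of
    [phi], which they annihilate. *)
Lemma shift_shift g h a : (g = s \/ g = t) -> (h = s \/ h = t) -> A a ->
  shift g (shift h a) = 1%g.
Proof.
move=> gst hst Aa; have [aX iX _] := cX; have Ah := shift_A fr h Aa.
have Agh := shift_A fr g Ah.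
apply: iX => // i; apply: int_all_primes => p pp.
have [phi [psi [x [y [[hp hq] dp dq _ span]]]]] := coords2_plane pp n1.
have [k [l ->]] := span _ (coord_hom p i); last exact: Agh.
have p0 g' b : (g' = s \/ g' = t) -> A b -> phi (shift g' b) = 0.
  by move=> g'st Ab; rewrite hshift //; case: (dp b Ab); case: g'st => ->.
have qg : exists z : 'F_p, forall b, A b -> psi (shift g b) = z * phi b.
  by case: gst => ->; [exists x|exists y] => b Ab; rewrite hshift //; case: (dq b Ab).
by case: qg => z ->; rewrite // !p0 // !mulr0 addr0.
Qed.

(** Otherwise a nonzero homomorphism modulo some prime would vanish on the
    commutator and on the images of [s - 1] and [t - 1]. In the plane spanned
    by [phi] and [psi] this is impossible, as [phi] is nonzero on the commutator
    and [psi] on its image under the operator that moves [psi]. *)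
Lemma kernel_gen_comm a : A a -> exists k b b', [/\ A b, A b' &
  a = (zpow (fcomm s t) k * shift s b * shift t b')%g].
Proof.
move=> Aa; have [es gen] := kernel_fg fr fgG nilA.
pose c : V := toV (fcomm s t).
pose H : set V := [set v | exists (k : int) (u u' : V), v = c *~ k + shV s u + shV t u'].
have sH : subclosed H.
  split; first by exists 0, 0, 0; rewrite mulr0z !(morph0 (shVD _)) !addr0.
  move=> _ _ [k [u [u' ->]]] [l [v [v' ->]]]; exists (k - l), (u - v), (u' - v').
  by rewrite mulrzBr !(morphB (shVD _)) !opprD addrACA [X in X + _]addrACA.
have [allH|pH] := pselect (forall v, H v).
  have [k [u [u' e]]] := allH (toV a); exists k, (gval u), (gval u').
  split; try exact: gvalP; rewrite -!gval_shV.
  rewrite -(toVK (fker_subgroup fr) (fker_comm fr) (fcomm_fker fr)) -/c -gvalMz.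
  by rewrite -!gvalD -e toVK.
have [p [pp [eta [etaD eta0 [v ev]]]]] := fg_separate gen sH pH.
have [phi [psi [x [y [[hp hq] dp dq [xy pc] span]]]]] := coords2_plane pp n1.
have [k [l kl]] := span _ (hom_toV etaD).
have kill w : H w -> k * phi (gval w) + l * psi (gval w) = 0.
  by move=> Hw; rewrite -kl ?gvalK ?eta0 //; exact: gvalP.
have Ac := fcomm_fker fr.
have fit g : (g = s \/ g = t) -> l * psi (shift g (fcomm s t)) = 0.
  move=> gst; have Hg : H (shV g c).
    case: gst => ->; [exists 0, c, 0|exists 0, 0, c];
      by rewrite mulr0z (morph0 (shVD _)) ?addr0 ?add0r.
  have := kill _ Hg; rewrite gval_shV toVK // (hshift _ hp) //.
  have [p1 p2] := dp _ Ac.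
  by case: gst => ->; rewrite ?p1 ?p2 mulr0 add0r.
have l0 : l = 0.
  have [q1 q2] := dq _ Ac.
  case/orP: xy => z0.
    have /eqP := fit s (or_introl erefl); rewrite hshift // q1 !mulf_eq0.
    by rewrite (negPf z0) (negPf pc) !orbF => /eqP.
  have /eqP := fit t (or_intror erefl); rewrite hshift // q2 !mulf_eq0.
  by rewrite (negPf z0) (negPf pc) !orbF => /eqP.
have k0 : k = 0.
  have Hc : H c by exists 1, 0, 0; rewrite mulr1z !(morph0 (shVD _)) !addr0.
  have /eqP := kill _ Hc; rewrite toVK // l0 mul0r addr0 mulf_eq0 (negPf pc) orbF.
  by move/eqP.
case/eqP: ev; rewrite -[v]gvalK kl; last exact: gvalP.
by rewrite k0 l0 !mul0r addr0.
Qed.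

Let toVK' := @toVK _ _ (fker_subgroup fr) (fker_comm fr).

Lemma shiftM g a b : A a -> A b -> shift g (a * b)%g = (shift g a * shift g b)%g.
Proof.
by move=> /toVK' <- /toVK' <-; rewrite -gvalD -!gval_shV shVD.
Qed.

Lemma shift_zpow g a k : A a -> shift g (zpow a k) = zpow (shift g a) k.
Proof.
by move=> /toVK' <-; rewrite -gvalMz -!gval_shV -gvalMz (morphMz (shVD g)).
Qed.

Lemma kernel_gen3 a : A a -> exists i j k, a = (zpow (fcomm s t) i
  * zpow (shift s (fcomm s t)) j * zpow (shift t (fcomm s t)) k)%g.
Proof.
have Ac := fcomm_fker fr; have sA := fker_subgroup fr.
have red g b : (g = s \/ g = t) -> A b -> exists k, shift g b = zpow (shift g (fcomm s t)) k.
  move=> gst Ab; have [k [u [u' [Au Au' ->]]]] := kernel_gen_comm Ab; exists k.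
  have A1 := sub_zpow k sA Ac; have A2 := shift_A fr s Au; have A3 := shift_A fr t Au'.
  rewrite (shiftM _ (subM sA A1 A2) A3) (shiftM _ A1 A2).
  rewrite (shift_shift gst (or_introl erefl) Au) (shift_shift gst (or_intror erefl) Au').
  by rewrite !mulg1 shift_zpow.
move=> Aa; have [i [b [b' [Ab Ab' ->]]]] := kernel_gen_comm Aa.
have [j ->] := red s b (or_introl erefl) Ab; have [k ->] := red t b' (or_intror erefl) Ab'.
by exists i, j, k.
Qed.

End WithCoords.
End Coordinates.

Section RankTwo.
Variables (G : groupType) (dx dy : G -> int) (s t : G).
Hypothesis fr : frame dx dy s t.
Local Notation A := (fker dx dy).
Hypothesis rk : all_rank_le1 G.
Hypothesis nilA : nil_action A.
Hypothesis fgG : finitely_generated G.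
Variable X : 'I_2 -> G -> int.
Hypothesis cX : coords A X.

Let sA : is_subgroup A. Proof. exact: fker_subgroup fr. Qed.
Let aX i : additive_on A (X i). Proof. by case: cX. Qed.
Let Xz i a k : A a -> X i (zpow a k) = k * X i a.
Proof. by move=> Aa; rewrite (additive_zpow _ sA) // mulrzz mulrC. Qed.

Definition xdet a b : int := X 0 a * X 1 b - X 1 a * X 0 b.

Let inj2 a : A a -> X 0 a = 0 -> X 1 a = 0 -> a = 1%g.
Proof.
case: cX => _ iX _ Aa x0 x1; apply: iX => // i.
by case: (unliftP 0 i) => [j ->|-> //]; rewrite (ord1 j) -[RHS]x1; congr (X _ a); apply: val_inj.
Qed.

Let X1 i : X i 1%g = 0.
Proof. by rewrite -(zpow0 1%g) Xz ?mul0r //; exact: (sub1 sA). Qed.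

Let X_cj g i a : A a -> X i (cj g a) = X i a + X i (shift g a).
Proof.
move=> Aa; have As := shift_A fr g Aa.
by rewrite addrC -aX // /shift mulgVK.
Qed.

Let X_cj_zpow g i k a : (g = s \/ g = t) -> A a ->
  X i (cj (zpow g k) a) = X i a + k * X i (shift g a).
Proof.
move=> gst; have step b : A b -> X i (shift g (cj g b)) = X i (shift g b).
  move=> Ab; have As := shift_A fr g Ab; have Ass := shift_A fr g As.
  have -> : cj g b = (shift g b * b)%g by rewrite /shift mulgVK.
  rewrite (shiftM fr _ As Ab) (aX _ Ass As).
  by rewrite (shift_shift fr rk nilA cX) // X1 add0r.
elim/int_ind_pm: k a => [|k IH|k IH] a Aa; first by rewrite zpow0 cj1g mul0r addr0.
  rewrite zpowS -cj_cj IH; last exact: (fker_cj fr).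
  rewrite step // (X_cj g i Aa); ring.
have Ab := fker_cj fr g^-1%g Aa.
rewrite zpowB -cj_cj IH // -[in RHS](cjVK g a) (X_cj g i Ab) (step _ Ab); ring.
Qed.

(** In rank two the action is by transvections along a line, hence trivial for
    a suitable basis element of the quotient, and the kernel is generated by
    the commutator and its image under [t - 1]. *)
Lemma omega_frame : exists (dx' dy' : G -> int) (s' t' : G), [/\ frame dx' dy' s' t',
  forall a, fker dx' dy' a -> cj s' a = a,
  shift t' (shift t' (fcomm s' t')) = 1%g,
  forall a, fker dx' dy' a -> exists k l,
    a = (zpow (fcomm s' t') k * zpow (shift t' (fcomm s' t')) l)%g &
  forall k l, (zpow (fcomm s' t') k * zpow (shift t' (fcomm s' t')) l = 1)%g ->
    k = 0 /\ l = 0].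
Proof.
have n1 : (1 < 2)%N by [].
have [e0 Ae0 e0E] : exists2 e, A e & forall j, X j e = (0 == j)%:R by case: cX.
have [e1 Ae1 e1E] : exists2 e, A e & forall j, X j e = (1 == j)%:R by case: cX.
have det1 : xdet e0 e1 = 1 by rewrite /xdet !e0E !e1E.
set c := fcomm s t; set f := shift s c; set g := shift t c.
have Ac : A c := fcomm_fker fr; have Af : A f := shift_A fr s Ac.
have Ag : A g := shift_A fr t Ac.
have gen3 := kernel_gen3 fr rk nilA fgG cX n1.
have ss := shift_shift fr rk nilA cX n1.
have Az a k : A a -> A (zpow a k) by exact: sub_zpow.
have gen3X a : A a -> exists i j k, forall m, X m a = i * X m c + j * X m f + k * X m g.
  move=> /gen3[i [j [k ->]]]; exists i, j, k => m.
  have h1 := Az c i Ac; have h2 := Az f j Af; have h3 := Az g k Ag.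
  by rewrite (aX m (subM sA h1 h2) h3) (aX m h1 h2) !Xz.
(* By Cramer's rule the three generators satisfy the relation [r = 1]; applied
   to it, [s - 1] leaves only the first term. *)
have k0 : xdet f g = 0.
  apply/eqP; apply: contraT => n0; pose r := (zpow c (xdet f g)
    * zpow f (xdet g c) * zpow g (xdet c f))%g.
  have h1 := Az c (xdet f g) Ac; have h2 := Az f (xdet g c) Af.
  have h3 := Az g (xdet c f) Ag; have h12 := subM sA h1 h2.
  have r1 : r = 1%g.
    apply: inj2; first exact: (subM sA).
      by rewrite (aX 0 h12 h3) (aX 0 h1 h2) !Xz // /xdet; ring.
    by rewrite (aX 1 h12 h3) (aX 1 h1 h2) !Xz // /xdet; ring.
  have : shift s r = 1%g by rewrite r1 /shift cj1 mulgV.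
  rewrite /r (shiftM fr _ h12 h3) (shiftM fr _ h1 h2) !(shift_zpow fr) // -/f.
  have sf : shift s f = 1%g by apply: ss => //; left.
  have sg : shift s g = 1%g by apply: ss => //; [left|right].
  rewrite sf sg.
  rewrite !zpow1g !mulg1 => fz.
  have Xf m : X m f = 0.
    have /eqP := Xz m (xdet f g) Af; rewrite fz X1 eq_sym mulf_eq0 (negPf n0).
    by move/eqP.
  by case/eqP: n0; rewrite /xdet !Xf !mul0r subrr.
pose al := xdet g c; pose be := xdet c f.
have rel m : al * X m f + be * X m g = 0.
  have : xdet f g * X m c + al * X m f + be * X m g = 0.
    rewrite /al /be /xdet; have [->|->] : m = 0 \/ m = 1.
    - case: (unliftP 0 m) => [j ->|->]; [right|by left].
      by rewrite (ord1 j); apply: val_inj.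
    - by ring.
    - by ring.
  by rewrite k0 mul0r add0r.
have nz : (al != 0) || (be != 0).
  apply: contraT; rewrite negb_or !negbK => /andP[/eqP a0 /eqP b0].
  have [i [j [k E0]]] := gen3X _ Ae0; have [i' [j' [k' E1]]] := gen3X _ Ae1.
  have : xdet e0 e1 = (i * j' - j * i') * be - (i * k' - k * i') * al
      + (j * k' - k * j') * xdet f g.
    by rewrite /xdet !E0 !E1 /al /be /xdet; ring.
  by rewrite det1 a0 b0 k0 !mulr0 ?oppr0 ?addr0 => /eqP.
(* The primitive relation between the two shifts of [c] gives the element [s']
   acting trivially; a Bezout relation completes it to a basis. *)
pose d := gcdz al be; have d0 : d != 0 by rewrite /d gcdz_eq0 negb_and.
pose a' := (al %/ d)%Z; pose b' := (be %/ d)%Z.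
have alE : al = a' * d by rewrite divzK // dvdz_gcdl.
have beE : be = b' * d by rewrite divzK // dvdz_gcdr.
have [u [v uv]] := Bezoutz al be.
have uv1 : a' * u + b' * v = 1.
  by apply: (mulIf d0); rewrite mul1r -[RHS]uv alE beE; ring.
have rel' m : a' * X m f + b' * X m g = 0.
  apply: (mulIf d0); rewrite mul0r -[RHS](rel m) alE beE; ring.
pose s' := (zpow s a' * zpow t b')%g; pose t' := (zpow s (- v) * zpow t u)%g.
pose dx' h := u * dx h + v * dy h; pose dy' h := a' * dy h - b' * dx h.
have [xM yM xs ys xt yt ab] := fr.
have xw i j : dx (zpow s i * zpow t j)%g = i.
  by rewrite xM !int_char_zpow // xs xt mulr1 mulr0 addr0.
have yw i j : dy (zpow s i * zpow t j)%g = j.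
  by rewrite yM !int_char_zpow // ys yt mulr1 mulr0 add0r.
have EA : fker dx' dy' = A.
  apply/seteqP; split=> h /fkerP[hx hy]; apply/fkerP; last first.
    by rewrite /dx' /dy' hx hy !mulr0 oppr0 addr0.
  have ex : dx h = a' * dx' h - v * dy' h.
    by rewrite -[LHS]mul1r -uv1 /dx' /dy'; ring.
  have ey : dy h = b' * dx' h + u * dy' h.
    by rewrite -[LHS]mul1r -uv1 /dx' /dy'; ring.
  by rewrite ex ey hx hy !mulr0 oppr0 addr0.
have fr' : frame dx' dy' s' t'.
  split.
  - by move=> h k; rewrite /dx' xM yM; ring.
  - by move=> h k; rewrite /dy' xM yM; ring.
  - by rewrite /dx' xw yw -uv1; ring.
  - by rewrite /dy' xw yw; ring.
  - by rewrite /dx' xw yw; ring.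
  - by rewrite /dy' xw yw -uv1; ring.
  move=> h k hx hy kx ky.
  have Ah : A h by rewrite -EA; apply/fkerP.
  have Ak : A k by rewrite -EA; apply/fkerP.
  exact: (fker_comm fr).
(* The shift of any element is the same power of the shift of [c]. *)
have s'id a : A a -> cj s' a = a.
  move=> Aa; have At := fker_cj fr (zpow t b') Aa; have As' := fker_cj fr s' Aa.
  have Ast := shift_A fr s Aa; have Att := shift_A fr t Aa.
  suff E m : X m (cj s' a) = X m a.
    have Ai := subM sA As' (subV sA Aa); have Aia := subV sA Aa.
    have Xi m : X m (cj s' a * a^-1)%g = 0.
      by rewrite aX // E -aX // mulgV X1.
    by have := inj2 Ai (Xi 0) (Xi 1) => h; apply: (mulIg a^-1%g); rewrite h mulgV.
  rewrite -cj_cj !X_cj_zpow; auto.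
  have -> : shift s (cj (zpow t b') a) = shift s a.
    have tsa : commute t (shift s a).
      have e := ss t s a (or_intror erefl) (or_introl erefl) Aa.
      by apply: cj_idP; rewrite -[RHS]mul1g -{}e [shift t _]/shift mulgVK.
    have tz := commute_sym (commute_zpow b' (commute_sym tsa)).
    by rewrite -(cj_id tz) /shift cjM cjV (cj_cj_comm fr s).
  have [i [j [k E]]] := gen3 _ Aa.
  have h1 := Az c i Ac; have h2 := Az f j Af; have h3 := Az g k Ag.
  have h12 := subM sA h1 h2.
  have sE h : (h = s \/ h = t) -> shift h a = zpow (shift h c) i.
    move=> hst; rewrite {1}E (shiftM fr _ h12 h3) (shiftM fr _ h1 h2) !(shift_zpow fr) //.
    have hf : shift h f = 1%g by apply: ss => //; left.
    have hg : shift h g = 1%g by apply: ss => //; right.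
    rewrite hf hg.
    by rewrite !zpow1g !mulg1.
  rewrite !sE; auto; rewrite -/f -/g !Xz //.
  by apply: (eq_lincomb (congr1 (fun z => i * z) (rel' m))); ring.
have nilA' : nil_action (fker dx' dy') by rewrite EA.
have cX' : coords (fker dx' dy') X by rewrite EA.
set c' := fcomm s' t'; set w := shift t' c'.
have Ac' : A c' by rewrite -EA; exact: (fcomm_fker fr').
have Aw : A w := shift_A fr t' Ac'.
have f'1 : shift s' c' = 1%g by rewrite /shift s'id // mulgV.
have gen2 a : A a -> exists k l, a = (zpow c' k * zpow w l)%g.
  rewrite -EA => Aa; have [k [j [l E]]] := kernel_gen3 fr' rk nilA' fgG cX' n1 Aa.
  by exists k, l; rewrite E f'1 zpow1g mulg1.
exists dx', dy', s', t'; split=> //.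
- by rewrite EA.
- by apply: (shift_shift fr' rk nilA' cX' n1); [right|right|rewrite EA].
- by rewrite EA.
move=> k l kl.
have X2 a : A a -> exists i j, forall m, X m a = i * X m c' + j * X m w.
  move=> /gen2[i [j ->]]; exists i, j => m.
  by rewrite aX ?Xz //; exact: Az.
(* Two generators of a group of rank two are independent. *)
have nd : xdet c' w != 0.
  apply/eqP => z; have [i [j E0]] := X2 _ Ae0; have [i' [j' E1]] := X2 _ Ae1.
  have : xdet e0 e1 = (i * j' - j * i') * xdet c' w.
    by rewrite /xdet !E0 !E1; ring.
  by rewrite det1 z mulr0 => /eqP.
have Xkl m : k * X m c' + l * X m w = 0.
  have := congr1 (X m) kl; rewrite X1 aX ?Xz //; exact: Az.
have Xz' z m : (k * X m c' + l * X m w) * z = 0 * z by rewrite Xkl.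
split; apply: (mulIf nd); rewrite mul0r /xdet.
  by apply: (eq_lincomb (subeq (Xz' (X 1 w) 0) (Xz' (X 0 w) 1))); ring.
by apply: (eq_lincomb (subeq (Xz' (X 0 c') 1) (Xz' (X 1 c') 0))); ring.
Qed.

End RankTwo.

Local Close Scope ring_scope.

(** * Isomorphisms and presentations *)

Section Isomorphic.
Variables G H : groupType.

Lemma isomorphic_hom (f : G -> H) : {morph f : x y / x * y} -> injective f ->
  (forall y, exists x, f x = y) -> isomorphic G H.
Proof.
move=> fM fI fS; pose fm : {multiplicative G -> H} :=
  HB.pack_for {multiplicative G -> H} f (monoid.isMultiplicative.Build G H f fM).
exists fm; exists (fun y => sval (cid (fS y))) => x /=; last exact: svalP (cid (fS x)).
by apply: fI; exact: svalP (cid (fS (f x))).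
Qed.

Lemma isomorphic_inv (f : H -> G) : {morph f : x y / x * y} ->
  (forall x, f x = 1 -> x = 1) -> (forall y, exists x, f x = y) -> isomorphic G H.
Proof.
move=> fM fker fS.
have f1 : f 1 = 1 by apply: (mulgI (f 1)); rewrite -fM !mulg1.
have fV x : f x^-1 = (f x)^-1.
  by apply: (mulgI (f x)); rewrite -fM !mulgV f1.
have fI : injective f.
  move=> x y e; apply: (mulIg y^-1); rewrite mulgV; apply: fker.
  by rewrite fM fV e mulgV.
apply: (@isomorphic_hom (fun y => sval (cid (fS y)))) => [x y|x y e|x].
- apply: fI; rewrite fM; do 3?[case: cid => ? /= ->]; by [].
- by rewrite -(svalP (cid (fS x))) e (svalP (cid (fS y))).
exists (f x); apply: fI; exact: svalP (cid (fS (f x))).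
Qed.

End Isomorphic.

Section Presented.
Variables (X : choiceType) (rels : seq (free_group X)).
Local Notation P := (presented_group rels).
Local Notation FG := (free_group X).

Definition pres_proj (w : FG) : P := \pi_P w.

Lemma pres_projM : {morph pres_proj : x y / x * y}.
Proof. by move=> x y; exact: quotient_mulE. Qed.
Lemma pres_projV x : pres_proj x^-1 = (pres_proj x)^-1.
Proof. exact: quotient_invE. Qed.
Lemma pres_projX x n : pres_proj (x ^+ n) = pres_proj x ^+ n.
Proof. by elim: n => [|n IH]; rewrite ?expg0 // !expgS pres_projM IH. Qed.
Lemma pres_projR x y : pres_proj [~ x, y] = [~ pres_proj x, pres_proj y].
Proof. by rewrite /commg /conjg !pres_projM !pres_projV. Qed.

Lemma pres_rel r : r \in rels -> pres_proj r = 1.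
Proof.
move=> rr; apply/eqP; rewrite eq_sym; apply/(quotient_eqP (normal_closure [set` rels]) 1 r).
rewrite invg1 mul1g; apply: generated_incl; exists r, 1; split=> //.
by rewrite conjg1.
Qed.

Definition pgen (x : X) : P := pres_proj (free_gen x).

(** The induction by which a set of normal forms is shown to be everything. *)
Lemma pres_ind_left (M : set P) : M 1 ->
  (forall x p, M p -> M (pgen x * p)) -> (forall x p, M p -> M ((pgen x)^-1 * p)) ->
  forall p, M p.
Proof.
move=> M1 Mg MV p; elim/quotW: p => w; elim/quotW: w => u.
elim: u => [|[x b] u IH]; first exact: M1.
have e : \pi_FG ((x, b) :: u) = (if b then free_gen x else (free_gen x)^-1) * \pi_FG u.
  case: b; first exact: (free_mulE [:: (x, true)] u).
  by rewrite -[(free_gen x)^-1](free_invE [:: (x, true)]); exact: (free_mulE [:: (x, false)] u).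
rewrite e; have := pres_projM; rewrite /pres_proj => ->.
case: b {e}; first exact: Mg.
by have := pres_projV (free_gen x); rewrite /pres_proj => ->; exact: MV.
Qed.

Section Lift.
Variables (H : groupType) (im : X -> H).

Definition ev_word (u : seq (X * bool)) : H :=
  foldr (fun a h => (if a.2 then im a.1 else (im a.1)^-1) * h) 1 u.

Lemma ev_word_cat u v : ev_word (u ++ v) = ev_word u * ev_word v.
Proof. by elim: u => [|a u IH] /=; rewrite ?mul1g // IH mulgA. Qed.

Lemma ev_word_equiv u v : word_equiv u v -> ev_word u = ev_word v.
Proof.
elim=> {u v} [u v [x b]|//|u v _ -> //|u v w _ -> _ -> //].
by rewrite !ev_word_cat; case: b => /=; rewrite ?mulKg ?mulVKg.
Qed.

Definition ev_free (w : FG) : H := ev_word (repr w).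

Lemma ev_free_pi u : ev_free (\pi u) = ev_word u.
Proof. by apply/esym/ev_word_equiv/word_equiv_repr. Qed.

Lemma ev_freeM : {morph ev_free : x y / x * y}.
Proof.
move=> a b; elim/quotW: a => u; elim/quotW: b => v.
by rewrite -[\pi_FG u * \pi_FG v](free_mulE u v) !ev_free_pi ev_word_cat.
Qed.

Lemma ev_free_gen x : ev_free (free_gen x) = im x.
Proof. by rewrite ev_free_pi /= mulg1. Qed.

Lemma ev_free1 : ev_free 1 = 1.
Proof. by apply: (mulgI (ev_free 1)); rewrite -ev_freeM !mulg1. Qed.

Lemma ev_freeV x : ev_free x^-1 = (ev_free x)^-1.
Proof. by apply: (mulgI (ev_free x)); rewrite -ev_freeM !mulgV ev_free1. Qed.

Lemma ev_freeX x n : ev_free (x ^+ n) = ev_free x ^+ n.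
Proof. by elim: n => [|n IH]; rewrite ?expg0 ?ev_free1 // !expgS ev_freeM IH. Qed.

Lemma ev_freeR x y : ev_free [~ x, y] = [~ ev_free x, ev_free y].
Proof. by rewrite /commg /conjg !ev_freeM !ev_freeV. Qed.

Hypothesis im_rel : forall r, r \in rels -> ev_free r = 1.

Definition ev_pres (p : P) : H := ev_free (repr p).

Lemma ev_pres_pi w : ev_pres (\pi w) = ev_free w.
Proof.
have ker x : normal_closure_set [set` rels] x -> ev_free x = 1.
  elim=> [_ [r [g [rr ->]]]||a b _ ea _ eb|a _ ea].
  - by rewrite /conjg !ev_freeM ev_freeV (im_rel rr) mul1g mulVg.
  - exact: ev_free1.
  - by rewrite ev_freeM ea eb mulg1.
  - by rewrite ev_freeV ea invg1.
have := ker _ (quotient_repr (normal_closure [set` rels]) w).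
rewrite ev_freeM ev_freeV => e; apply: (mulgI (ev_free w)^-1).
by rewrite mulVg -e.
Qed.

Lemma ev_presM : {morph ev_pres : x y / x * y}.
Proof.
move=> a b; elim/quotW: a => u; elim/quotW: b => v.
rewrite -[\pi_P u * \pi_P v](quotient_mulE (normal_closure [set` rels]) u v).
by rewrite !ev_pres_pi ev_freeM.
Qed.

Lemma ev_pgen x : ev_pres (pgen x) = im x.
Proof. by rewrite ev_pres_pi ev_free_gen. Qed.

Lemma ev_presV p : ev_pres p^-1 = (ev_pres p)^-1.
Proof.
have e1 : ev_pres 1 = 1 by apply: (mulgI (ev_pres 1)); rewrite -ev_presM !mulg1.
by apply: (mulgI (ev_pres p)); rewrite -ev_presM !mulgV.
Qed.

Lemma ev_presR p q : ev_pres [~ p, q] = [~ ev_pres p, ev_pres q].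
Proof. by rewrite /commg /conjg !ev_presM !ev_presV. Qed.

Lemma ev_pres_zpow p k : ev_pres (zpow p k) = zpow (ev_pres p) k.
Proof.
elim/int_ind_pm: k => [|k IH|k IH]; last by rewrite !zpowB ev_presM ev_presV IH.
  by apply: (mulgI (ev_pres 1)); rewrite !zpow0 -ev_presM !mulg1.
by rewrite !zpowS ev_presM IH.
Qed.

End Lift.
End Presented.

(** * The groups with kernel of rank at most one *)

(** Left multiplication of a normal form by an element acting on its factors
    by conjugation. *)
Lemma mulg_cj (G : groupType) (g a b : G) : g * (a * b) = cj g a * (g * b).
Proof. by rewrite /cj; gsimp. Qed.

Lemma ord3_neq : [/\ (inord 1 == 0 :> 'I_3)%R = false,
  (inord 2 == 0 :> 'I_3)%R = false & (inord 2 == inord 1 :> 'I_3)%R = false].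
Proof. by split; rewrite -val_eqE /= !inordK. Qed.

Lemma ord3_cases (i : 'I_3) : [\/ i = inord 0, i = inord 1 | i = inord 2].
Proof.
by case: i => [[|[|[|//]]] lt]; [constructor 1|constructor 2|constructor 3];
  apply: val_inj; rewrite /= inordK.
Qed.

Section FrameIso.
Variables (G : groupType) (dx dy : G -> int) (s t : G).
Hypothesis fr : frame dx dy s t.
Local Notation A := (fker dx dy).
Local Notation c := (fcomm s t).

Lemma frame_form g : g = kpart dx dy s t g * (zpow s (dx g) * zpow t (dy g)).
Proof. exact: kpartE. Qed.

Let dxw a i j : A a -> dx (a * (zpow s i * zpow t j)) = i.
Proof. by move=> /fkerP[xa _]; rewrite (frame_xM fr) xa add0r (dx_word fr). Qed.
Let dyw a i j : A a -> dy (a * (zpow s i * zpow t j)) = j.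
Proof. by move=> /fkerP[_ ya]; rewrite (frame_yM fr) ya add0r (dy_word fr). Qed.

Lemma iso_free_abelian2 : (forall a, A a -> a = 1) -> isomorphic G (free_abelian 2).
Proof.
move=> A1; pose f g : free_abelian 2 :=
  (\row_(i < 2) if i == 0 then dx g else dy g)%R.
apply: (isomorphic_hom (f := f)).
- move=> g h; apply/rowP => i; rewrite !mxE.
  by case: ifP => _; rewrite ?(frame_xM fr) ?(frame_yM fr).
- move=> g h /rowP e; have ex := e 0%R; have ey := e ord_max; rewrite !mxE /= in ex ey.
  have Ak := kpart_fker fr; rewrite (frame_form g) (frame_form h) ex ey.
  by rewrite (A1 _ (Ak g)) (A1 _ (Ak h)).
move=> v; exists (1 * (zpow s (v 0%R 0%R) * zpow t (v 0%R ord_max))).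
have A1' : A 1 by exact: (sub1 (fker_subgroup fr)).
apply/rowP => i; rewrite mxE dxw // dyw //.
case: (unliftP 0%R i) => [j|] -> //=; rewrite (ord1 j).
by congr (v _ _); apply: val_inj.
Qed.

Section RankOne.
Variables (e : G).
Hypotheses (Ae : A e) (Agen : forall a, A a -> exists k, a = zpow e k)
  (efree : forall k, zpow e k = 1 -> k = 0%R) (ecent : forall g, commute g e).

Let zpow_inj k l : zpow e k = zpow e l -> k = l.
Proof.
move=> kl; apply/eqP; rewrite -GRing.subr_eq0; apply/eqP/efree.
by rewrite zpowD zpowN kl mulgV.
Qed.

Lemma iso_free_abelian3 : c = 1 -> isomorphic G (free_abelian 3).
Proof.
move=> c1; have st : commute t s by apply: cj_idP; rewrite cj_t_s c1 mul1g.
pose k g := sval (cid (Agen (kpart_fker fr g))).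
have kE g : kpart dx dy s t g = zpow e (k g) := svalP (cid (Agen (kpart_fker fr g))).
have form g : g = zpow e (k g) * (zpow s (dx g) * zpow t (dy g)).
  by rewrite -kE; exact: frame_form.
have ku g m i j : g = zpow e m * (zpow s i * zpow t j) -> [/\ k g = m, dx g = i & dy g = j].
  move=> gE; have Am : A (zpow e m) by apply: sub_zpow => //; exact: (fker_subgroup fr).
  have xi : dx g = i by rewrite gE dxw.
  have yj : dy g = j by rewrite gE dyw.
  split=> //; apply: zpow_inj; apply: (mulIg (zpow s i * zpow t j)).
  by rewrite -gE -xi -yj -form.
pose f g : free_abelian 3 := (\row_(i < 3) if i == 0 then k g else
  if i == inord 1 then dx g else dy g)%R.
have [n10 n20 n21] := ord3_neq.
have e0 : inord 0 = 0%R :> 'I_3 by apply: val_inj; rewrite /= inordK.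
apply: (isomorphic_hom (f := f)).
- move=> g h; have [] := @ku (g * h) (k g + k h)%R (dx g + dx h)%R (dy g + dy h)%R.
    rewrite {1}(form g) {1}(form h) !zpowD -!mulgA; congr (_ * _).
    rewrite !mulgA -[in LHS](mulgA _ (zpow t (dy g))) -[in LHS](mulgA (zpow s _)).
    have ew i : commute (zpow s (dx g) * zpow t (dy g)) (zpow e i).
      exact/commute_zpow/ecent.
    rewrite -!mulgA [zpow s (dx g) * (zpow t (dy g) * _)]mulgA.
    rewrite [zpow s (dx g) * zpow t (dy g) * (zpow e _ * _)]mulgA ew -!mulgA.
    congr (_ * (_ * _)); rewrite !mulgA; congr (_ * _).
    by apply: commute_zpow; apply/commute_sym/commute_zpow/commute_sym.
  move=> kk xx yy; apply/rowP => i; rewrite !mxE kk xx yy.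
  by case: ifP => // _; case: ifP.
- move=> g h /rowP eq; have := eq 0%R; have := eq (inord 1); have := eq (inord 2).
  rewrite !mxE !eqxx n10 n20 n21 => y x z.
  by rewrite (form g) (form h) x y z.
move=> v; pose g0 := zpow e (v 0 0)%R * (zpow s (v 0 (inord 1))%R * zpow t (v 0 (inord 2))%R).
exists g0; have [kk xx yy] := ku g0 _ _ _ erefl.
apply/rowP => i; rewrite mxE kk xx yy.
by case: (ord3_cases i) => ->; rewrite ?e0 ?eqxx ?n10 ?n20 ?n21.
Qed.

(** As [c = t * s * t^-1 * s^-1] is central, it is also [[~ t, s]], so [x] can
    be sent to [t] and [y] to [s]. The relations bring every element of the
    presented group to the form [z ^ k * x ^ i * y ^ j], on which the map to
    the group is injective. *)
Lemma iso_gamma (q : nat) : c = e ^+ q -> isomorphic G (Gamma q).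
Proof.
move=> cq; pose im (i : 'I_3) : G :=
  if i == 0%R then t else if i == inord 1 then s else e.
have [n10 n20 n21] := ord3_neq.
have im0 : im (inord 0) = t by rewrite /im -val_eqE /= inordK.
have im1 : im (inord 1) = s by rewrite /im n10 eqxx.
have im2 : im (inord 2) = e by rewrite /im n20 n21.
set rels := [:: [~ free_gen (inord 0 : 'I_3), free_gen (inord 1)] / free_gen (inord 2) ^+ q;
  (free_gen (inord 0) * free_gen (inord 2)) / (free_gen (inord 2) * free_gen (inord 0));
  (free_gen (inord 1) * free_gen (inord 2)) / (free_gen (inord 2) * free_gen (inord 1))].
have st : [~ t, s] = c.
  have tsE : t * s = c * (s * t) by rewrite -(cj_comm t s) cj_t_s mulgA.
  have cst : commute (s * t) c.
    by rewrite cq; apply: commuteX; exact: ecent.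
  have -> : [~ t, s] = (s * t)^-1 * (t * s) by rewrite /commg /conjg invgM !mulgA.
  by rewrite tsE -cst mulKg.
have imr r : r \in rels -> ev_free im r = 1.
  rewrite !inE => /or3P[] /eqP ->; rewrite ev_freeM ev_freeV.
  - by rewrite ev_freeR ev_freeX !ev_free_gen im0 im1 im2 st cq mulgV.
  - by rewrite !ev_freeM !ev_free_gen im0 im2 (ecent t) mulgV.
  - by rewrite !ev_freeM !ev_free_gen im1 im2 (ecent s) mulgV.
pose x : presented_group rels := pgen rels (inord 0).
pose y : presented_group rels := pgen rels (inord 1).
pose z : presented_group rels := pgen rels (inord 2).
have r1 : [~ x, y] = z ^+ q.
  have := @pres_rel _ rels _ (mem_head _ _); rewrite pres_projM pres_projV pres_projR pres_projX.
  exact: divg1_eq.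
have r2 : commute x z.
  have : pres_proj rels (free_gen (inord 0) * free_gen (inord 2)
    / (free_gen (inord 2) * free_gen (inord 0))) = 1.
    by apply: pres_rel; rewrite !inE eqxx orbT.
  by rewrite pres_projM pres_projV !pres_projM => /divg1_eq.
have r3 : commute y z.
  have : pres_proj rels (free_gen (inord 1) * free_gen (inord 2)
    / (free_gen (inord 2) * free_gen (inord 1))) = 1.
    by apply: pres_rel; rewrite !inE eqxx !orbT.
  by rewrite pres_projM pres_projV !pres_projM => /divg1_eq.
have yx : cj y^-1 x = x * zpow z q%:Z.
  by rewrite zpow_nat -r1 /cj /commg /conjg; gsimp.
have yx' : cj y x = x * zpow z (- q%:Z).
  apply: (cj_inj (g := y^-1)); rewrite cjK cjM yx -mulgA cj_zpow.
  rewrite (cj_id (commute_sym (commuteV (commute_sym r3)))) -zpowD GRing.addrN.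
  by rewrite mulg1.
pose M p := exists k i j, p = zpow z k * (zpow x i * zpow y j).
have Mstep g (m k i j : int) : commute g z -> cj g x = x * zpow z m ->
    g * (zpow z k * (zpow x i * zpow y j))
    = zpow z (k + m * i)%R * (zpow x i * (g * zpow y j)).
  move=> gz gx; rewrite mulg_cj [g * (_ * _)]mulg_cj !cj_zpow (cj_id gz) gx.
  rewrite zpowMg; last exact: commute_zpow.
  rewrite -zpowM zpowD -!mulgA; congr (_ * _); rewrite !mulgA; congr (_ * _ * _).
  by apply/commute_zpow/commute_sym/commute_zpow/commute_sym.
have all_M p : M p.
  apply: pres_ind_left p => [|i p [k [a [b ->]]]|i p [k [a [b ->]]]].
  - by exists 0%R, 0%R, 0%R; rewrite !zpow0 !mulg1.
  - case: (ord3_cases i) => ->.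
    + exists k, (1 + a)%R, b; rewrite -/x mulg_cj cj_zpow (cj_id r2).
      by rewrite zpowD zpow1 !mulgA.
    + exists (k + - q%:Z * a)%R, a, (1 + b)%R; rewrite -/y (Mstep _ _ _ _ _ r3 yx').
      by rewrite [zpow y (1 + b)%R]zpowD zpow1.
    + by exists (1 + k)%R, a, b; rewrite -/z zpowD zpow1 !mulgA.
  case: (ord3_cases i) => ->.
  + exists k, (-1 + a)%R, b; rewrite -/x (mulg_cj x^-1) cj_zpow.
    rewrite (cj_id (commute_sym (commuteV (commute_sym r2)))).
    by rewrite zpowD zpowN zpow1 !mulgA.
  + exists (k + q%:Z * a)%R, a, (-1 + b)%R; rewrite -/y.
    rewrite (Mstep _ _ _ _ _ (commute_sym (commuteV (commute_sym r3))) yx).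
    by rewrite [zpow y (-1 + b)%R]zpowD zpowN zpow1.
  + by exists (-1 + k)%R, a, b; rewrite -/z zpowD zpowN zpow1 !mulgA.
pose F := ev_pres im (rels := rels).
have FM : {morph F : a b / a * b} by exact: ev_presM.
have Fz a k : F (zpow a k) = zpow (F a) k by exact: ev_pres_zpow.
have Fx : F x = t by rewrite /F ev_pgen.
have Fy : F y = s by rewrite /F ev_pgen.
have Fzz : F z = e by rewrite /F ev_pgen.
apply: (isomorphic_inv (f := F)) => // [p|g].
  have [k [i [j ->]]] := all_M p; rewrite !FM !Fz Fx Fy Fzz => eq.
  have [ey ex] : dy (zpow e k * (zpow t i * zpow s j)) = i /\
      dx (zpow e k * (zpow t i * zpow s j)) = j.
    have [xe ye] := (fkerP dx dy e).1 Ae; have [xM yM xs ys xt yt _] := fr.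
    rewrite !xM !yM !int_char_zpow // xe ye xs ys xt yt.
    by rewrite !(GRing.mulr0, GRing.mulr1, GRing.addr0, GRing.add0r).
  rewrite eq (int_char1 (frame_yM fr)) in ey; rewrite eq (int_char1 (frame_xM fr)) in ex.
  move: eq; rewrite -ex -ey !zpow0 !mulg1 => /efree ->.
  by rewrite zpow0.
have [k kE] := Agen (kpart_fker fr g).
exists (zpow z k * (zpow y (dx g) * zpow x (dy g))).
by rewrite !FM !Fz Fx Fy Fzz -kE -frame_form.
Qed.

End RankOne.

End FrameIso.

(** * The group with kernel of rank two *)

Section OmegaForm.
Variables (G : groupType) (e1 e2 u t : G).
Hypotheses (c12 : commute e1 e2) (c1u : commute e1 u) (c2u : commute e2 u).

Lemma omega_step g (m n a b i j : int) : commute g e1 ->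
    cj g e2 = zpow e1 m * e2 -> cj g u = zpow e1 n * (zpow e2 m * u) ->
  g * (zpow e1 a * (zpow e2 b * (zpow u i * zpow t j))) =
  zpow e1 (a + m * b + n * i)%R *
    (zpow e2 (b + m * i)%R * (zpow u i * (g * zpow t j))).
Proof.
have zz (x y : G) k l : commute x y -> commute (zpow x k) (zpow y l).
  by move=> xy; apply/commute_zpow/commute_sym/commute_zpow/commute_sym.
move=> g1 g2 gu; rewrite mulg_cj [g * (_ * (_ * _))]mulg_cj [g * (zpow u i * _)]mulg_cj.
rewrite !cj_zpow (cj_id g1) g2 gu.
rewrite zpowMg; last by have := zz _ _ m 1%R c12.
have cc : commute (zpow e1 n) (zpow e2 m * u).
  by apply: commuteM; [exact: zz|have := zz _ _ n 1%R c1u].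
rewrite zpowMg //; rewrite zpowMg; last by have := zz _ _ m 1%R c2u.
rewrite -!zpowM !zpowD -!mulgA; do 2 congr (_ * _).
by rewrite mulgA (zz _ _ b (n * i)%R (commute_sym c12)) -!mulgA.
Qed.

End OmegaForm.

Section OmegaIso.
Variables (G : groupType) (dx dy : G -> int) (s t : G).
Hypothesis fr : frame dx dy s t.
Local Notation A := (fker dx dy).
Local Notation c := (fcomm s t).
Local Notation v := (shift t c).
Hypotheses (sA : forall a, A a -> cj s a = a) (tv : shift t v = 1)
  (Agen : forall a, A a -> exists k l, a = zpow c k * zpow v l)
  (Afree : forall k l, zpow c k * zpow v l = 1 -> k = 0%R /\ l = 0%R).

(** The first generator goes to [t] and the second to [s]; the commutators [e2]
    and [e1] of the presentation then go to the basis [v^-1 * c] and [v] of the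
    kernel. In the presented group [e1], [e2] and the second generator [u]
    commute and the first generator [t] normalizes the subgroup that they
    generate, which gives the normal forms
    [e1 ^ a * e2 ^ b * u ^ i * t ^ j]. *)
Lemma iso_omega : isomorphic G Omega.
Proof.
have Ac : A c by exact: (fcomm_fker fr).
have Av : A v.
  apply: (subM (fker_subgroup fr)); first exact: (fker_cj fr).
  exact: (subV (fker_subgroup fr)).
have comm_tv : commute t v.
  by apply: cj_idP; rewrite -[RHS]mul1g -tv /shift mulgVK.
pose d := v^-1 * c.
have Ad : A d by apply: (subM (fker_subgroup fr)) => //; exact: (subV (fker_subgroup fr)).
have tc : cj t^-1 c = d.
  apply: (cj_inj (g := t)); rewrite cjVK /d cjM cjV (cj_id comm_tv).
  by rewrite /shift invgM invgK mulgVK.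
have ts : [~ t, s] = d.
  have e : cj t^-1 s = d^-1 * s.
    by apply: (cj_inj (g := t)); rewrite cjVK cjM cjV -tc cjVK cj_t_s mulKg.
  rewrite (_ : [~ t, s] = (cj t^-1 s)^-1 * s); last by rewrite /commg /conjg /cj; gsimp.
  rewrite e invgM invgK -mulgA -[RHS](@cjK _ s) sA // /cj.
  by gsimp.
have td : [~ t, d] = v.
  rewrite (_ : [~ t, d] = (cj t^-1 d)^-1 * d); last by rewrite /commg /conjg /cj; gsimp.
  have e : cj t^-1 v = v by apply: (cj_inj (g := t)); rewrite cjVK (cj_id comm_tv).
  by rewrite {1}/d cjM cjV e tc invgM invgK -mulgA (fker_comm fr Av Ad) mulKg.
pose im (i : 'I_2) : G := if i == 0%R then t else s.
have im0 : im (inord 0) = t by rewrite /im -val_eqE /= inordK.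
have im1 : im (inord 1) = s by rewrite /im -val_eqE /= inordK.
have cases (i : 'I_2) : i = inord 0 \/ i = inord 1.
  by case: i => [[|[|//]] lt]; [left|right]; apply: val_inj; rewrite /= ?inordK.
set gt : free_group 'I_2 := free_gen (inord 0).
set gu : free_group 'I_2 := free_gen (inord 1).
pose rels := [:: [~ gt, [~ gt, [~ gt, gu]]]; [~ gu, [~ gt, gu]]].
have imr r : r \in rels -> ev_free im r = 1.
  rewrite !inE => /orP[] /eqP ->; rewrite !ev_freeR !ev_free_gen im0 im1 ts.
    by rewrite td; apply/eqP/commgP.
  by apply/eqP/commgP/cj_idP/sA.
pose x : presented_group rels := pgen rels (inord 0).
pose y : presented_group rels := pgen rels (inord 1).
pose e2 := [~ x, y]; pose e1 := [~ x, e2].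
have xe1 : commute x e1.
  apply/commgP/eqP; have := @pres_rel _ rels _ (mem_head _ _).
  by rewrite !pres_projR.
have ye2 : commute y e2.
  apply/commgP/eqP; have : pres_proj rels [~ gu, [~ gt, gu]] = 1.
    by apply: pres_rel; rewrite !inE eqxx orbT.
  by rewrite !pres_projR.
have cjV_comm a b : cj a^-1 b = b * [~ a, b]^-1.
  by rewrite /cj /commg /conjg; gsimp.
have Vy : cj x^-1 y = y * e2^-1 by exact: cjV_comm.
have Ve2 : cj x^-1 e2 = e2 * e1^-1 by exact: cjV_comm.
have Ve1 : cj x^-1 e1 = e1 by apply: (cj_inj (g := x)); rewrite cjVK (cj_id xe1).
(* Conjugating the relation that [y] commutes with [e2] by [x^-1] shows that
   [y * e2^-1] commutes with [e2 * e1^-1], and so with [e1]. *)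
have we1 : commute (y * e2^-1) e1.
  have w2 : commute (y * e2^-1) e2.
    by apply/commute_sym/commuteM; [exact/commute_sym|exact/commuteV].
  have w1 : commute (y * e2^-1) (e2 * e1^-1).
    by rewrite /commute -Vy -Ve2 -!cjM ye2.
  rewrite -[e1]invgK; apply: commuteV; rewrite -[e1^-1](mulKg e2).
  by apply: commuteM => //; exact: commuteV.
have ye1 : commute y e1.
  have : cj x (cj x^-1 y * e1) = cj x (e1 * cj x^-1 y) by rewrite Vy we1.
  by rewrite [LHS]cjM [RHS]cjM cjVK (cj_id xe1).
have e12 : commute e1 e2.
  rewrite -[e2]invgK; apply: commuteV; rewrite -[e2^-1](mulKg y).
  by apply: commuteM; apply: commute_sym => //; exact/commute_sym/commuteV/commute_sym.
pose M p := exists a b i j,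
  p = zpow e1 a * (zpow e2 b * (zpow y i * zpow x j)).
have all_M p : M p.
  have yE1 := cj_id ye1; have yE2 := cj_id ye2.
  have E12 : e1 * (e2 * e1^-1) = e2 by rewrite mulgA e12 mulgK.
  have Y2 : e2 * (y * e2^-1) = y by rewrite mulgA -ye2 mulgK.
  have xE2 : cj x e2 = zpow e1 1%R * e2.
    by apply: (cj_inj (g := x^-1)); rewrite cjK cjM zpow1 Ve1 Ve2 E12.
  have xE : cj x y = zpow e1 1%R * (zpow e2 1%R * y).
    by apply: (cj_inj (g := x^-1)); rewrite cjK 2!cjM !zpow1 Ve1 Ve2 Vy mulgA E12 Y2.
  have VE2 : cj x^-1 e2 = zpow e1 (-1)%R * e2.
    by rewrite Ve2 zpowN zpow1; apply: (mulgI e1); rewrite E12 mulVKg.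
  have VE : cj x^-1 y = zpow e1 0%R * (zpow e2 (-1)%R * y).
    by rewrite Vy zpow0 zpowN zpow1 mul1g; apply: (mulgI e2); rewrite Y2 mulVKg.
  have ye2' : cj y e2 = zpow e1 0%R * e2 by rewrite yE2 zpow0 mul1g.
  have yy : cj y y = zpow e1 0%R * (zpow e2 0%R * y).
    by rewrite !zpow0 !mul1g; apply: cj_id.
  have Vye2 : cj y^-1 e2 = zpow e1 0%R * e2.
    by apply: (cj_inj (g := y)); rewrite cjVK zpow0 mul1g.
  have Vyy : cj y^-1 y = zpow e1 0%R * (zpow e2 0%R * y).
    by apply: (cj_inj (g := y)); rewrite cjVK !zpow0 !mul1g; apply/esym/cj_id.
  have Vc (g h : Omega) : commute g h -> commute g^-1 h.
    by move=> gh; apply/commute_sym/commuteV/commute_sym.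
  have st g m n a b i j g1 g2 gu := @omega_step _ e1 e2 y x e12 (commute_sym ye1)
    (commute_sym ye2) g m n a b i j g1 g2 gu.
  apply: pres_ind_left p => [|l p [a [b [i [j ->]]]]|l p [a [b [i [j ->]]]]].
  - by exists 0%R, 0%R, 0%R, 0%R; rewrite !zpow0 !mulg1.
  - case: (cases l) => ->.
      rewrite -/x (st _ _ _ _ _ _ _ xe1 xE2 xE).
      by do 4 eexists; rewrite -{1}[x]zpow1 -zpowD.
    rewrite -/y (st _ _ _ _ _ _ _ ye1 ye2' yy).
    by do 4 eexists; rewrite [zpow y i * _]mulgA -zpowS.
  case: (cases l) => ->.
    rewrite -/x (st _ _ _ _ _ _ _ (Vc _ _ xe1) VE2 VE).
    by do 4 eexists; rewrite -{1}[x]zpow1 -zpowN -zpowD.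
  rewrite -/y (st _ _ _ _ _ _ _ (Vc _ _ ye1) Vye2 Vyy).
  by do 4 eexists; rewrite [zpow y i * _]mulgA -zpowB.
pose F := ev_pres im (rels := rels).
have FM : {morph F : a b / a * b} by exact: ev_presM.
have FR a b : F [~ a, b] = [~ F a, F b] by exact: ev_presR.
have Fz a k : F (zpow a k) = zpow (F a) k by exact: ev_pres_zpow.
have Fx : F x = t by rewrite /F ev_pgen.
have Fy : F y = s by rewrite /F ev_pgen.
have Fe2 : F e2 = d by rewrite /e2 FR Fx Fy.
have Fe1 : F e1 = v by rewrite /e1 FR Fx Fe2.
have cE : c = v * d by rewrite /d mulVKg.
apply: (isomorphic_inv (f := F)) => // [p|g].
  have [a [b [i [j ->]]]] := all_M p; rewrite !FM !Fz Fx Fy Fe1 Fe2 mulgA => eq.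
  have Aab : A (zpow v a * zpow d b).
    have sg := fker_subgroup fr.
    by apply: (subM sg); apply: sub_zpow.
  have [ex ey] : dx (zpow v a * zpow d b * (zpow s i * zpow t j)) = i /\
      dy (zpow v a * zpow d b * (zpow s i * zpow t j)) = j.
    have [xa ya] := (fkerP dx dy _).1 Aab.
    by rewrite (frame_xM fr) (frame_yM fr) xa ya !GRing.add0r (dx_word fr) (dy_word fr).
  rewrite eq (int_char1 (frame_yM fr)) in ey; rewrite eq (int_char1 (frame_xM fr)) in ex.
  move: eq; rewrite -ex -ey !zpow0 !mulg1 => eq.
  have [b0 a0] : b = 0%R /\ (a - b)%R = 0%R.
    have sg := fker_subgroup fr.
    apply: Afree; rewrite (fker_comm fr (a := zpow c b)); [|exact: sub_zpow..].
    have -> : zpow c b = zpow v b * zpow d b.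
      by rewrite -zpowMg ?mulVKg //; exact: (fker_comm fr Av Ad).
    by rewrite mulgA -zpowD GRing.subrK.
  by move/eqP: a0; rewrite b0 GRing.subr0 => /eqP ->; rewrite !zpow0 mul1g.
have [k [l kE]] := Agen (kpart_fker fr g).
exists (zpow (e1 * e2) k * zpow e1 l * (zpow y (dx g) * zpow x (dy g))).
by rewrite FM [X in X * _]FM [X in _ * X]FM !Fz [F (e1 * e2)]FM Fx Fy Fe1 Fe2 -cE -kE -frame_form.
Qed.
End OmegaIso.

Local Open Scope ring_scope.

(** * Balanced nilpotent groups *)

Lemma frame_of_quotient (G : groupType) (N : normal_subgroup G) :
  abelian_set N -> isomorphic (quotient_group N) (free_abelian 2) ->
  exists dx dy s t, @frame G dx dy s t.
Proof.
move=> abN [f bij_f]; have fI := bij_inj bij_f.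
pose pr (g : G) : quotient_group N := \pi g.
have prM g k : pr (g * k)%g = (pr g * pr k)%g by exact: quotient_mulE.
pose h (g : G) : 'rV[int]_2 := f (pr g).
have hM g k : h (g * k)%g = h g + h k by rewrite /h prM gmulfM.
have hS v : exists g, h g = v.
  have [f' _ fK] := bij_f; exists (repr (f' v)); rewrite /h /pr reprK; exact: fK.
have [s hs] := hS (delta_mx 0 0); have [t ht] := hS (delta_mx 0 1).
exists (fun g => h g 0 0), (fun g => h g 0 1), s, t.
split; rewrite ?hs ?ht ?mxE //; try by move=> g k; rewrite hM mxE.
have inN a : h a 0 0 = 0 -> h a 0 1 = 0 -> ns_set N a.
  move=> a0 a1; have h1 : h 1%g = 0 by apply: (addrI (h 1%g)); rewrite -hM mulg1 addr0.
  have ha : h a = h 1%g.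
    rewrite h1; apply/rowP => i; rewrite mxE; case: (unliftP 0 i) => [j|] -> //.
    by rewrite (ord1 j) -[RHS]a1; congr (h a _ _); apply: val_inj.
  have /esym/eqP/quotient_eqP := fI _ _ ha.
  by rewrite invg1 mul1g.
by move=> a b a0 a1 b0 b1; apply: abN; apply: inN.
Qed.

Lemma balanced_rank_le1 (G : groupType) :
  homologically_balanced G -> nilpotent_group G -> all_rank_le1 G.
Proof.
move=> [fgG bal] nilG p dx dy s t pp fr f1 f2 cf1 cf2.
have [es gen] := kernel_fg fr fgG (nilpotent_nil_action _ nilG).
have [b1 [b2 [H1 H2 le]]] := bal 'F_p.
have sep := kernel2_separated 'F_p gen.
exact: (restriction_rank_le1 pp (frame_yM fr) (frame_yt fr) sep H1 H2 le cf1 cf2).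
Qed.

Section RankOneCase.
Variables (G : groupType) (dx dy : G -> int) (s t : G).
Hypothesis fr : frame dx dy s t.
Local Notation A := (fker dx dy).

(** The group acts on an infinite cyclic kernel by multiplication with integers
    [m + 1], and [m] is nilpotent. *)
Lemma cyclic_kernel_central e : nil_action A -> A e ->
    (forall a, A a -> exists k, a = zpow e k) ->
    (forall k, zpow e k = 1%g -> k = 0) ->
  forall g, commute g e.
Proof.
move=> [n nil] Ae Agen efree g; have Ase : A (shift g e).
  apply: (subM (fker_subgroup fr)); first exact: (fker_cj fr).
  exact: (subV (fker_subgroup fr)).
have [m mE] := Agen _ Ase.
have it i : iter i (shift g) e = zpow e (m ^+ i).
  elim: i => [|i IH]; first by rewrite expr0.
  by rewrite iterS IH (shift_zpow fr) // mE -zpowM exprS.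
have := nil g e Ae; rewrite it => /efree/eqP; rewrite expf_eq0 => /andP[_ /eqP m0].
have se : shift g e = 1%g by rewrite mE m0 zpow0.
by apply: cj_idP; rewrite -[RHS]mul1g -se /shift mulgVK.
Qed.

Lemma coords1_generator (X : 'I_1 -> G -> int) : coords A X ->
  exists e, [/\ A e, forall a, A a -> exists k, a = zpow e k &
    forall k, zpow e k = 1%g -> k = 0].
Proof.
move=> [aX iX] /(_ 0)[e Ae eE]; have sA := fker_subgroup fr.
have Xz i k : X i (zpow e k) = k.
  by rewrite (additive_zpow _ sA) // eE (ord1 i) eqxx intz.
exists e; split=> // [a Aa|k k1]; last first.
  by rewrite -(Xz 0 k) k1 -(zpow0 e) Xz.
exists (X 0 a); apply: (mulIg (zpow e (- X 0 a))); rewrite -zpowD subrr zpow0.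
have Az := sub_zpow (- X 0 a) sA Ae.
by apply: iX => [|i]; [exact: (subM sA)|rewrite aX // Xz (ord1 i) subrr].
Qed.

Lemma rank_one_iso e : nil_action A -> A e ->
    (forall a, A a -> exists k, a = zpow e k) ->
    (forall k, zpow e k = 1%g -> k = 0) ->
  isomorphic G (free_abelian 3) \/ exists2 q, (1 <= q)%N & isomorphic G (Gamma q).
Proof.
move=> nilA Ae Agen efree; have cent := cyclic_kernel_central nilA Ae Agen efree.
have [q0 cE] := Agen _ (fcomm_fker fr).
have [q00|q0n] := eqVneq q0 0.
  left; apply: (iso_free_abelian3 fr Ae Agen efree cent).
  by rewrite cE q00 zpow0.
right; exists `|q0|%N; first by rewrite lt0n absz_eq0.
have [q0p|q0n'] := leP 0 q0.
  apply: (iso_gamma fr Ae Agen efree cent).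
  by rewrite cE -zpow_nat gez0_abs.
have Vz k : zpow e^-1%g k = zpow e (- k).
  by rewrite -[e^-1%g]/(zpow e (-1)) -zpowM mulN1r.
apply: (iso_gamma (e := e^-1%g) fr).
- exact: (subV (fker_subgroup fr)).
- by move=> a /Agen[k ->]; exists (- k); rewrite Vz opprK.
- by move=> k; rewrite Vz => /efree/eqP; rewrite oppr_eq0 => /eqP.
- by move=> g; exact/commuteV.
by rewrite -zpow_nat Vz cE ltz0_abs // opprK.
Qed.

End RankOneCase.

Local Close Scope ring_scope.

Theorem corollary21 (G : groupType) :
  homologically_balanced G ->
  nilpotent_group G ->
  ~ isomorphic G (free_abelian 3) ->
  (exists A : normal_subgroup G,
     abelian_set A /\ isomorphic (quotient_group A) (free_abelian 2)) ->
  isomorphic G (free_abelian 2) \/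
  (exists2 q : nat, (1 <= q)%N & isomorphic G (Gamma q)) \/
  isomorphic G Omega.
Proof.
move=> bal nilG notZ3 [N [abN isoN]].
have [dx [dy [s [t fr]]]] := frame_of_quotient abN isoN.
have nilA := nilpotent_nil_action (fker dx dy) nilG.
have rk := balanced_rank_le1 bal nilG; have [fgG _] := bal.
have [n [X cX]] := kernel_coords fr rk nilA fgG.
have := coords_le2 fr rk nilA cX.
case: n X cX => [|[|[|//]]] X cX _.
- by left; apply: (iso_free_abelian2 fr) => a Aa; case: cX => _ iX _; apply: iX => // -[].
- have [e [Ae Agen efree]] := coords1_generator fr cX.
  by case: (rank_one_iso fr nilA Ae Agen efree) => [/notZ3 //|]; right; left.
have [dx' [dy' [s' [t' [fr' sA tt gen free]]]]] := omega_frame fr rk nilA fgG cX.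
by right; right; exact: (iso_omega fr' sA tt gen free).
Qed.
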